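(* Let $c>0$, $m>0$, $\gamma\ge0$ and $r>3/2$. There exist $\delta>0$, depending only on $m,c,\gamma,r$, and a constant $C$, independent of the data, such that if $\eta_0\in H^r(\mathbb T)$ is real valued and mean-zero with $\|\eta_0\|_{H^r}\le\delta$, then the solution $\eta$ of $$\eta_t+cm\Lambda\eta+\gamma\eta=-cP_0\{\eta\Lambda\eta-(\mathcal H\eta)\eta_s\},\qquad \eta(0,\cdot)=\eta_0,$$ is global in time and $$\sup_{t\ge0}\|\eta(t)\|_{H^r}^2+cm\int_0^\infty\|\eta(t)\|_{\dot H^{r+1/2}}^2\,dt\le C\|\eta_0\|_{H^r}^2.$$
   Context: $\mathbb T=\mathbb R/2\pi\mathbb Z$; subscripts $s,t$ denote partial derivatives. $\langle f\rangle=\frac1{2\pi}\int_{\mathbb T}f\,ds$, $P_0f=f-\langle f\rangle$. The periodic Hilbert transform satisfies $\widehat{\mathcal Hf}(k)=-i\,\mathrm{sgn}(k)\hat f(k)$ and $\Lambda=\mathcal H\partial_s$, so $\widehat{\Lambda f}(k)=|k|\hat f(k)$. For mean-zero functions, $\|f\|_{H^r}=\|\Lambda^rf\|_{2}$ and $\|f\|_{\dot H^{r+1/2}}=\|\Lambda^{r+1/2}f\|_2$. Solutions are mean-zero and are understood in the class $\eta\in C([0,T];H^r)\cap L^2(0,T;H^{r+1/2})$ on time intervals $[0,T]$ of existence; the equation is the one satisfied by $\eta=\rho-m$ when $\rho_t+cP_0\{\rho\Lambda\rho-(\mathcal H\rho)\rho_s\}+\gamma(\rho-m)=0$ with $\langle\rho\rangle=m$.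 *)

(* Defs.v *)
From mathcomp Require Import all_boot all_order all_algebra.
From mathcomp Require Import complex.
From mathcomp Require Import all_classical all_reals all_analysis.

Set Implicit Arguments.
Unset Strict Implicit.
Unset Printing Implicit Defensive.

Import Order.TTheory GRing.Theory Num.Theory.
Import numFieldNormedType.Exports.

Local Open Scope classical_set_scope.
Local Open Scope ring_scope.
Local Open Scope complex_scope.

Section Circle.
Context {R : realType}.
Implicit Types (f g phi : R -> R) (a : R) (k : int).

(* A function on R / 2 pi Z is a 2 pi-periodic function on R; integrals over
   the circle are taken over one period. *)
Definition period : set R := `[0, 2 * pi]%classic.

Definition periodic f := forall s, f (s + 2 * pi) = f s.

Definition circle_int f : R :=
  (\int[@lebesgue_measure R]_(s in period) f s)%R.

Definition ae_eq_circle f g :=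
  {ae @lebesgue_measure R, forall s, period s -> f s = g s}.

Definition L2norm f : \bar R :=
  'N[@lebesgue_measure R]_(2%:E)[(EFin \o f) \_ period].

Definition L2 f :=
  [/\ periodic f, measurable_fun period f & (L2norm f < +oo)%E].

Definition mean f : R := (2 * pi)^-1 * circle_int f.

Definition P0 f : R -> R := fun s => f s - mean f.

(* The k-th Fourier coefficient, i.e. the mean of f(s) exp(- i k s). *)
Definition fourier f k : R[i] :=
  mean (fun s => f s * cos (k%:~R * s))
  -i* mean (fun s => f s * sin (k%:~R * s)).

(* The image of f under a Fourier multiplier is an L^2 function, determined up
   to a null set; operators are therefore given by their graphs. *)
Definition fourier_multiplier (sigma : int -> R[i]) f g :=
  [/\ L2 f, L2 g & forall k, fourier g k = sigma k * fourier f k].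

Definition is_Hilbert f g :=
  fourier_multiplier (fun k => - 'i * (sgz k)%:~R) f g.

Definition is_Lambda a f g :=
  fourier_multiplier (fun k => (`|k|%:~R `^ a)%:C) f g.

(* The norm || Lambda^a f ||_2 of a mean-zero f, used for both H^a and its
   homogeneous version.  All g in the set below agree almost everywhere, so
   that the infimum is over at most one value, and it is +oo when there is no
   such g, that is, when f is not in H^a. *)
Definition Hnorm a f : \bar R := ereal_inf [set L2norm g | g in is_Lambda a f].

(* g is the weak derivative of f on the circle. *)
Definition is_weak_derivative f g :=
  [/\ L2 f, L2 g &
    forall phi, periodic phi -> (forall s, derivable phi s 1) ->
      continuous (derive1 phi) ->
      circle_int (fun s => f s * derive1 phi s) =
      - circle_int (fun s => g s * phi s)].

End Circle.

Section Equation.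
Context {R : realType}.
Implicit Types (eta : R -> R -> R).

(* v is the derivative at time t of the L^2-valued curve eta. *)
Definition is_time_derivative eta (t : R) (v : R -> R) :=
  L2 v /\
  (L2norm (fun s => (eta (t + h) s - eta t s) / h - v s) @[h --> 0^']
    --> 0%E).

(* The equation at time t, as an equality in L^2; h, l, ds and dt stand for
   H eta, Lambda eta and the partial derivatives of eta in s and t. *)
Definition equation_at (c m gamma : R) eta (t : R) :=
  exists h l ds dt : R -> R,
    [/\ is_Hilbert (eta t) h, is_Lambda 1 (eta t) l,
        is_weak_derivative (eta t) ds, is_time_derivative eta t dt &
        ae_eq_circle
          (fun s => dt s + c * m * l s + gamma * eta t s)
          (fun s => - c * P0 (fun x => eta t x * l x - h x * ds x) s)].

(* eta is a solution on [0, T] with data eta0, in the class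
   C([0, T]; H^r) /\ L^2(0, T; H^(r + 1/2)) of mean-zero functions; its values
   at times outside [0, T] are irrelevant. *)
Record is_solution (c m gamma r T : R) (eta0 : R -> R) eta : Prop := IsSolution {
  solution_L2 : forall t : R, 0 <= t <= T -> L2 (eta t);
  solution_mean0 : forall t : R, 0 <= t <= T -> mean (eta t) = 0;
  solution_Hr : forall t : R, 0 <= t <= T -> (Hnorm r (eta t) < +oo)%E;
  solution_continuous : forall t0 : R, 0 <= t0 <= T ->
    Hnorm r (fun s => eta t s - eta t0 s)
      @[t --> within `[0, T]%classic (nbhs t0)] --> 0%E;
  solution_L2Hr : (\int[@lebesgue_measure R]_(t in `[0%R, T]%classic)
    (Hnorm (r + 2^-1) (eta t) ^+ 2) < +oo)%E;
  solution_initial : ae_eq_circle (eta 0) eta0;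
  solution_equation : forall t : R, 0 < t < T -> equation_at c m gamma eta t }.

End Equation.

(* Main.v *)
(** Let [x_n] and [y_n] be the means of [eta cos (n s)] and [eta sin (n s)].  The
    nonlinearity [eta Lambda eta - (H eta) eta_s] only couples frequencies of
    opposite signs, so mode [n] is forced by the products of the modes [n + j]
    and [j] with weight [n + 2 j], and it is damped at the rate
    [c m n + gamma].  Dividing the forcing by the damping gains a factor [n],
    which lets the weight [n ^ r] of the output be carried by the higher input
    mode [n + j].  Picard iteration is therefore majorized by the iteration
    [be_n = alpha_n + 4 / (m n) * sum_j 2 (n + 2 j) be_(n + j) be_j], which
    converges in the weighted l^2 space for small data by Young's inequality,
    [n ^ (- r)] being summable.  All iterates stay below
    [be_n exp (- c m n t / 2)]; this gives global existence, and integrating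
    the square of this bound in time gives the estimate.

    Two solutions agree by a contraction for [sup_n n ^ r |.|] as long as both
    are small in that norm, and smallness propagates in time by continuity.

    Modes determine an L^2 function because the trigonometric system is
    complete; the inequality [\int f ^ 2 <= 4 pi sum_n (x_n ^ 2 + y_n ^ 2)] is
    obtained by convolving [f] with nonnegative trigonometric polynomials that
    converge to the indicator function of a short arc. *)

Require Import Defs.
From mathcomp Require Import all_boot all_order all_algebra.
From mathcomp Require Import complex.
From mathcomp Require Import all_classical all_reals all_analysis.
From mathcomp Require Import measurable_realfun ring lra zify.

Set Implicit Arguments.
Unset Strict Implicit.
Unset Printing Implicit Defensive.

Import Order.TTheory GRing.Theory Num.Theory.
Import numFieldNormedType.Exports.
(* [periodic] is also defined in [trigo]. *)
Import Defs.

Local Open Scope classical_set_scope.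
Local Open Scope ring_scope.

(** * Numerical series *)

Section Series.
Context {R : realType}.
Implicit Types (u v M : nat -> R).

(** A pair of frequencies [(k, l)] enters [eta Lambda eta - (H eta) eta_s] with the symbol
    [|l| - sgn k * l], which vanishes when the signs agree and is [2 |l|] otherwise; the pairs
    [(n + j, - j)] and [(- j, n + j)] together produce the weight [2 (n + 2 j)]. The term loses a
    full derivative and the damping regains exactly one, so everything rests on the output frequency
    never exceeding the higher input frequency. Exponential weights [exp (- x n)] are compatible
    with the products for a similar reason, [n <= (n + j) + j]. They use only half of the linear
    rate [c m n]: the other half is the gap by which Duhamel's formula divides, whence
    [2 c / (c m n / 2) = 4 / (m n)]. At positive times the exponential decay makes every operator
    act on an absolutely convergent series. Time [0] is different: [Hnorm] is an infimum over a set
    that may be empty, and the datum itself has to supply the function [Lambda ^ r eta]. A competing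
    solution has no known exponential decay, so the norm used for uniqueness carries no weight in
    time. *)

Definition tsum u : R := limn (series u).

Lemma dominated_cvg_series u M : cvgn (series M) ->
  (forall j, `|u j| <= M j) -> cvgn (series u).
Proof.
move=> cM uM; apply: (@normed_cvg R R^o).
by apply: (series_le_cvg _ _ uM cM) => // n; exact: le_trans (normr_ge0 _) (uM n).
Qed.

Lemma tsum_tail u M N : cvgn (series M) -> (forall j, `|u j| <= M j) ->
  `|tsum u - series u N| <= tsum M - series M N.
Proof.
move=> cM uM; have cu := dominated_cvg_series cM uM.
have h1 : `|series u n - series u N| @[n --> \oo] --> `|tsum u - series u N|.
  by apply: cvg_norm; apply: cvgB => //; exact: cvg_cst.
have h2 : (series M n - series M N) @[n --> \oo] --> tsum M - series M N.
  by apply: cvgB => //; exact: cvg_cst.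
rewrite -(cvg_lim _ h1)// -(cvg_lim _ h2)//; apply: ler_lim.
- by apply/cvg_ex; eexists; exact: h1.
- by apply/cvg_ex; eexists; exact: h2.
near=> n; have Nn : (N <= n)%N by near: n; exact: nbhs_infty_ge.
rewrite !sub_series_geq//; apply: le_trans (ler_norm_sum _ _ _) _.
by apply: ler_sum => i _.
Unshelve. all: by end_near. Qed.

Lemma ler_norm_tsum u M : cvgn (series M) -> (forall j, `|u j| <= M j) ->
  `|tsum u| <= tsum M.
Proof.
by move=> cM uM; have := tsum_tail 0 cM uM; rewrite /series /= !big_geq// !subr0.
Qed.

Lemma tsum_ge0 u : (forall j, 0 <= u j) -> 0 <= tsum u.
Proof.
move=> u0; case: (pselect (cvgn (series u))) => [cu|/dvgP ncu].
  by apply: limr_ge => //; apply: nearW => n; exact: sumr_ge0.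
(* If the series diverges, [limn] takes its default value, which is [0]. *)
by rewrite /tsum ncu.
Qed.

Lemma series_le_tsum u N : cvgn (series u) -> (forall j, 0 <= u j) ->
  series u N <= tsum u.
Proof.
by move=> cu u0; apply: nondecreasing_cvgn_le => //; exact: nondecreasing_series.
Qed.

Lemma ler_tsum u v : cvgn (series v) -> (forall j, 0 <= u j <= v j) ->
  tsum u <= tsum v.
Proof.
move=> cv uv; apply: le_trans (ler_norm _) _; apply: ler_norm_tsum => // j.
by have /andP[? ?] := uv j; rewrite ger0_norm.
Qed.

Lemma cvg_seriesZl k u : cvgn (series u) -> cvgn (series (fun j => k * u j)).
Proof. by move=> cu; have := @is_cvg_seriesZ R u k cu. Qed.

Lemma tsumZl k u : cvgn (series u) -> tsum (fun j => k * u j) = k * tsum u.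
Proof. by move=> cu; have := @lim_seriesZ R u k cu. Qed.

Lemma cvg_seriesD u v : cvgn (series u) -> cvgn (series v) ->
  cvgn (series (fun j => u j + v j)).
Proof. by move=> cu cv; have := @is_cvg_seriesD R u v cu cv. Qed.

Lemma tsumD u v : cvgn (series u) -> cvgn (series v) ->
  tsum (fun j => u j + v j) = tsum u + tsum v.
Proof. by move=> cu cv; have := @lim_seriesD R u v cu cv. Qed.

Lemma tsumB u v : cvgn (series u) -> cvgn (series v) ->
  tsum (fun j => u j - v j) = tsum u - tsum v.
Proof. by move=> cu cv; have := @lim_seriesB R u v cu cv. Qed.

Lemma bounded_cvg_series u B : (forall j, 0 <= u j) ->
  (forall N, series u N <= B) -> cvgn (series u) /\ tsum u <= B.
Proof.
move=> u0 uB; have cu : cvgn (series u).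
  apply: nondecreasing_is_cvgn; first exact: nondecreasing_series.
  by exists B => _ [n _ <-].
by split=> //; apply: limr_le => //; exact: nearW.
Qed.

(** Dominated convergence for series: the tail of [M] controls the tails of [phi x] and of [L] at
    once, which leaves a finite sum. The filter is arbitrary because limits are taken later at a
    point of time, at a punctured neighbourhood of [0], and along the Picard iteration. *)
Lemma tannery {T : Type} (F : set_system T) {FF : ProperFilter F}
    (phi : T -> nat -> R) (L M : nat -> R) :
  cvgn (series M) -> (\forall x \near F, forall j, `|phi x j| <= M j) ->
  (forall j, phi x j @[x --> F] --> L j) ->
  tsum (phi x) @[x --> F] --> tsum L.
Proof.
move=> cM dom cphi.
have LM j : `|L j| <= M j.
  have h : `|phi x j| @[x --> F] --> `|L j| by apply: cvg_norm; exact: cphi.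
  rewrite -(cvg_lim _ h)//; apply: limr_le; first by apply/cvg_ex; eexists; exact: h.
  by near=> x; have : forall j, `|phi x j| <= M j by near: x.
apply/cvgrPdist_le => e e0.
have [N HN] : exists N, tsum M - series M N <= e / 3.
  have /cvgrPdist_le/(_ (e/3)) : series M @ \oo --> tsum M by exact: cM.
  rewrite divr_gt0// => /(_ isT) [N _ HN]; exists N.
  exact: le_trans (ler_norm _) (HN N (leqnn N)).
have cs : series (phi x) N @[x --> F] --> series L N.
  elim: N {HN} => [|N IH]; first by rewrite /series/= big_geq//; under eq_fun do rewrite big_geq//; exact: cvg_cst.
  by under eq_fun do rewrite seriesSr; rewrite seriesSr; exact: cvgD.
have /cvgrPdist_le/(_ (e/3)) : series (phi x) N @[x --> F] --> series L N by [].
rewrite divr_gt0// => /(_ isT) h3.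
near=> x; have dx : forall j, `|phi x j| <= M j by near: x.
have h3x : `|series L N - series (phi x) N| <= e / 3 by near: x.
have := tsum_tail N cM LM; have := tsum_tail N cM dx.
move: h3x HN; rewrite !ler_norml => /andP[? ?] ? /andP[? ?] /andP[? ?].
by apply/andP; split; lra.
Unshelve. all: by end_near. Qed.

Lemma continuous_tsum (phi : R -> nat -> R) (M : nat -> R) :
  cvgn (series M) -> (forall x j, `|phi x j| <= M j) ->
  (forall j, continuous (phi^~ j)) -> continuous (fun x => tsum (phi x)).
Proof.
move=> cM dom cphi x.
apply: (@tannery _ (nbhs x) _ phi (phi x) M cM) => [|j]; last exact: cphi.
by apply: nearW => y j; exact: dom.
Qed.

(* For [r = 3 / 2] the terms are dominated by the telescoping differences of
   [2 / sqrt n]. *)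
Lemma cvg_series_powRN (r : R) : 3 / 2 < r ->
  cvgn (series (fun n => (n%:R `^ r)^-1)).
Proof.
move=> hr.
have le1 n : series (fun n => (n.+1%:R `^ r)^-1) n.+1 <= 3 - 2 / Num.sqrt (n.+1%:R : R).
  elim: n => [|n IH].
    by rewrite /series/= big_nat1 powR1 sqrtr1 divr1 invr1; lra.
  rewrite seriesSr; apply: le_trans (lerD IH (lexx _)) _.
  set a := Num.sqrt (n.+1%:R : R); set b := Num.sqrt (n.+2%:R : R).
  have a0 : 0 < a by rewrite sqrtr_gt0 ltr0n.
  have b0 : 0 < b by rewrite sqrtr_gt0 ltr0n.
  have ab2 : b ^+ 2 = a ^+ 2 + 1 by rewrite !sqr_sqrtr ?ler0n// -natr1.
  have ab : a <= b by rewrite ler_sqrt ?ler0n// ler_nat.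
  have : (n.+2%:R `^ r)^-1 <= (b ^+ 3)^-1.
    rewrite lef_pV2 ?posrE ?powR_gt0 ?exprn_gt0//.
    have -> : b ^+ 3 = n.+2%:R `^ (3 / 2).
      have -> : (3 / 2 : R) = 2^-1 * 3%:R by rewrite mulrC.
      by rewrite powRrM powR12_sqrt ?ler0n// powR_mulrn// ltW.
    by apply: ler_powR; [rewrite ler1n|exact: ltW].
  move=> /(lerD (lexx (3 - 2 / a))) /le_trans; apply.
  rewrite -subr_ge0.
  have -> : 3 - 2 / b - (3 - 2 / a + (b ^+ 3)^-1) =
      (2 * (b - a) * b ^+ 2 - a) / (a * b ^+ 3) by field; rewrite !gt_eqF.
  apply: divr_ge0; last by rewrite mulr_ge0// ?exprn_ge0// ltW.
  (* As [b >= a], this yields [2 b (b - a) >= 1], so the numerator is at least [b - a]. *)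
  have h : (b - a) * (b + a) = 1 by rewrite -subr_sqr ab2; ring.
  have : (b - a) * (2 * b) >= 1 by rewrite -{1}h; apply: ler_wpM2l; lra.
  by nra.
apply: (@bounded_cvg_series _ (1 + 3) _ _).1 => [j|N].
  by rewrite invr_ge0 powR_ge0.
case: N => [|N]; first by rewrite /series/= big_geq//; lra.
rewrite /series /= big_nat_recl//=; apply: lerD.
  by rewrite powR0 ?invr0//; apply/eqP; lra.
case: N => [|N]; first by rewrite big_geq.
apply: le_trans (le1 N) _; rewrite lerBlDr lerDl divr_ge0// sqrtr_ge0.
Qed.

End Series.

(** * Linear scalar differential equations *)

Section ODE.
Context {R : realType}.

Lemma is_derive_expRM (a x : R) :
  is_derive x 1 (fun y => expR (a * y)) (expR (a * x) * a).
Proof.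
have h : is_derive x 1 (fun y : R => a * y) a.
  have -> : (fun y : R => a * y) = a *: (@id R) by [].
  by apply: is_derive_eq; rewrite /GRing.scale/= mulr1.
exact: is_derive1_comp.
Qed.

Lemma continuous_expRM (a : R) : continuous (fun y => expR (a * y)).
Proof.
move=> y; apply: differentiable_continuous.
by apply/derivable1_diffP; case: (is_derive_expRM a y).
Qed.

(** For [s = 1] and [s = -1] the function [K / (la - mu) * exp ((la - mu) t) + s * exp (la t) * v t]
    is nondecreasing and nonnegative at [0]. Differentiability is asked in the open interval only,
    which is all that a solution of the given class provides. *)
Lemma duhamel_bound (T la mu K : R) (v dv : R -> R) :
  0 <= mu < la -> 0 <= K -> {within `[0, T], continuous v} -> v 0 = 0 ->
  (forall t, 0 < t < T -> is_derive t 1 v (dv t)) ->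
  (forall t, 0 < t < T -> `|dv t + la * v t| <= K * expR (- mu * t)) ->
  forall t, 0 <= t <= T -> `|v t| <= K / (la - mu) * expR (- mu * t).
Proof.
move=> /andP[mu0 mula] K0 cv v0 dvE bd t /andP[t0 tT].
have lm0 : 0 < la - mu by rewrite subr_gt0.
have key (s : R) : s = 1 \/ s = -1 ->
    - (K / (la - mu) * expR (- mu * t)) <= s * v t.
  move=> s1.
  pose g x := K / (la - mu) * expR ((la - mu) * x) + s * (expR (la * x) * v x).
  pose dg x := K * expR ((la - mu) * x) + s * (expR (la * x) * (dv x + la * v x)).
  have dgE x : 0 < x < T -> is_derive x 1 g (dg x).
    move=> xT; have hv := dvE _ xT; rewrite /g /dg.
    apply: is_derive_eq; rewrite /GRing.scale/=; field; exact: lt0r_neq0.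
  have h1 x : x \in `]0, T[ -> derivable g x 1.
    by rewrite in_itv/= => xT; have h := dgE _ xT; case: h.
  have h2 x : x \in `]0, T[ -> 0 <= derive1 g x.
    rewrite in_itv/= => xT; have h := dgE _ xT.
    rewrite derive1E; rewrite derive_val /dg.
    have := bd x xT; rewrite ler_norml => /andP[b1 b2].
    have -> : expR ((la - mu) * x) = expR (la * x) * expR (- mu * x).
      by rewrite -expRD; congr expR; ring.
    have := expR_gt0 (la * x) => e0.
    by case: s1 => ->; nra.
  have ce (b : R) : {within `[0, T], continuous (fun y => expR (b * y))}.
    by apply: continuous_subspaceT; exact: continuous_expRM.
  have h3 : {within `[0, T], continuous g}.
    move=> x; rewrite /continuous_at /g; apply: cvgD.
      by apply: cvgM; [exact: cvg_cst|exact: ce].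
    apply: cvgM; first exact: cvg_cst.
    by apply: cvgM; [exact: ce|exact: cv].
  have i1 : (0 : R) \in `[0, T] by rewrite in_itv/= lexx (le_trans t0 tT).
  have i2 : t \in `[0, T] by rewrite in_itv/= t0 tT.
  have := @ger0_derive1_le_cc R g 0 T h1 h2 h3 0 t i1 i2 t0.
  rewrite /g v0 !mulr0 expR0 mulr1 addr0.
  have KK : 0 <= K / (la - mu) by rewrite divr_ge0// ltW.
  have -> : expR ((la - mu) * t) = expR (la * t) * expR (- mu * t).
    by rewrite -expRD; congr expR; ring.
  have := expR_gt0 (la * t).
  move: (expR (la * t)) => e e0 h.
  have : 0 <= e * (K / (la - mu) * expR (- mu * t) + s * v t) by nra.
  rewrite pmulr_rge0// => ?; lra.
have h1 := key 1 (or_introl erefl); have h2 := key (-1) (or_intror erefl).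
by rewrite ler_norml; apply/andP; split; lra.
Qed.

(* The primitive is based at [-1] so that [0] is an interior point of its
   domain. *)
Definition duhamel (a la : R) (f : R -> R) (x : R) : R :=
  let G (y : R) : R :=
    (\int[@lebesgue_measure R]_(t in [set` `[-1, y]]) (expR (la * t) * f t))%R in
  expR (- la * x) * (a + (G x - G 0)).

Lemma duhamel_start a la f : duhamel a la f 0 = a.
Proof. by rewrite /duhamel mulr0 expR0 subrr addr0 mul1r. Qed.

Lemma is_derive_duhamel (a la : R) (f : R -> R) : continuous f ->
  forall t : R, -1 < t ->
    is_derive t 1 (duhamel a la f) (f t - la * duhamel a la f t).
Proof.
move=> cf; pose mu := @lebesgue_measure R.
pose g x := expR (la * x) * f x.
have cg : continuous g.
  by move=> x; rewrite /continuous_at /g; apply: cvgM; [exact: continuous_expRM|exact: cf].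
pose G (x : R) : R := (\int[mu]_(t in [set` `[-1, x]]) (g t))%R.
have dG (x : R) : -1 < x -> is_derive x 1 G (g x).
  move=> x1; have [] := @continuous_FTC1_closed R g (-1) x (x + 1) _ _ x1 (cg x).
  - by rewrite ltrDl.
  - apply: continuous_compact_integrable; first exact: segment_compact.
    exact: continuous_subspaceT.
  by move=> d1 d2; apply: DeriveDef; [exact: d1|rewrite -derive1E; exact: d2].
move=> t t1; have hG := dG _ t1.
rewrite /duhamel -/(G 0).
have -> : (fun x => expR (- la * x) * (a + (\int[@lebesgue_measure R]_(t0 in [set` `[-1, x]])
    (expR (la * t0) * f t0) - G 0))) = (fun x => expR (- la * x) * (a + (G x - G 0))) by [].
rewrite -/(G t); apply: is_derive_eq; rewrite /GRing.scale /= /g.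
have h : expR (- la * t) * expR (la * t) = 1.
  by rewrite -expRD -mulrDl addNr mul0r expR0.
move: h; move: (expR (- la * t)) (expR (la * t)) => x y xy.
transitivity (x * y * f t - la * (x * (a + (G t - G 0)))); last by rewrite xy mul1r.
ring.
Qed.

End ODE.

(** * Fourier coefficients *)

Section CircleIntegral.
Context {R : realType}.
Local Notation mu := (@lebesgue_measure R).
Local Notation per := (@period R).
Implicit Types (f g : R -> R).

Definition circle_integrable f := mu.-integrable per (EFin \o f).

Lemma measurable_period : measurable per.
Proof. exact: measurable_itv. Qed.
#[local] Hint Extern 0 (measurable _) => exact: measurable_period : core.

Lemma twopi_gt0 : 0 < 2 * pi :> R.
Proof. by rewrite mulr_gt0// pi_gt0. Qed.

Lemma continuous_circle_integrable f : continuous f -> circle_integrable f.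
Proof.
move=> cf; apply: continuous_compact_integrable; first exact: segment_compact.
exact: continuous_subspaceT.
Qed.

Lemma circle_integrable_cst (k : R) : circle_integrable (cst k).
Proof. by apply: continuous_circle_integrable => x; exact: cvg_cst. Qed.

Lemma circle_integrableD f g : circle_integrable f -> circle_integrable g ->
  circle_integrable (fun s => f s + g s).
Proof.
move=> intf intg; rewrite /circle_integrable.
rewrite (_ : EFin \o _ = (EFin \o f) \+ (EFin \o g))%E//.
by apply: integrableD.
Qed.

Lemma circle_integrableZl k f : circle_integrable f ->
  circle_integrable (fun s => k * f s).
Proof.
move=> intf; rewrite /circle_integrable.
rewrite (_ : EFin \o _ = (fun s => k%:E * (EFin \o f) s)%E)//.
by apply: integrableZl => //; exact: measurable_period.
Qed.

Lemma circle_integrableB f g : circle_integrable f -> circle_integrable g ->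
  circle_integrable (fun s => f s - g s).
Proof.
move=> intf intg; rewrite /circle_integrable.
rewrite (_ : EFin \o _ = (EFin \o f) \- (EFin \o g))%E//.
by apply: integrableB.
Qed.

Lemma circle_integrable_measurable f : circle_integrable f ->
  measurable_fun per f.
Proof. by move=> /integrableP[mf _]; exact/measurable_EFinP. Qed.

Lemma circle_integrable_norm f : circle_integrable f ->
  circle_integrable (fun s => `|f s|).
Proof.
by move=> /integrable_norm; rewrite /circle_integrable; congr integrable.
Qed.

Lemma le_circle_integrable f g : measurable_fun per f ->
  (forall s, per s -> `|f s| <= g s) -> circle_integrable g ->
  circle_integrable f.
Proof.
move=> mf fg; apply: le_integrable; first exact: measurable_period.
  exact/measurable_EFinP.
by move=> x px /=; rewrite lee_fin; apply: le_trans (fg _ px) _; exact: ler_norm.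
Qed.

Lemma circle_integrable_bounded B f g : circle_integrable f ->
  measurable_fun per g -> (forall s, per s -> `|g s| <= B) ->
  circle_integrable (fun s => f s * g s).
Proof.
move=> intf mg gB.
apply: (@le_circle_integrable _ (fun s => B * `|f s|)).
- by apply: measurable_funM => //; exact: circle_integrable_measurable.
- by move=> s ps; rewrite normrM mulrC ler_wpM2r// gB.
- by apply: circle_integrableZl; exact: circle_integrable_norm.
Qed.

Lemma circle_intD f g : circle_integrable f -> circle_integrable g ->
  circle_int (fun s => f s + g s) = circle_int f + circle_int g.
Proof. by move=> *; rewrite /circle_int RintegralD. Qed.

Lemma circle_intB f g : circle_integrable f -> circle_integrable g ->
  circle_int (fun s => f s - g s) = circle_int f - circle_int g.
Proof. by move=> *; rewrite /circle_int RintegralB. Qed.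

Lemma circle_intZl k f : circle_integrable f ->
  circle_int (fun s => k * f s) = k * circle_int f.
Proof. by move=> *; rewrite /circle_int RintegralZl. Qed.

Lemma circle_int_cst (k : R) : circle_int (fun=> k) = 2 * pi * k.
Proof.
rewrite /circle_int Rintegral_cst//.
by rewrite /= /period lebesgue_measure_itv/= lte_fin twopi_gt0 -EFinB subr0/= mulrC.
Qed.

Lemma le_circle_int f g : circle_integrable f -> circle_integrable g ->
  (forall s, per s -> f s <= g s) -> circle_int f <= circle_int g.
Proof. by move=> *; apply: le_Rintegral. Qed.

Lemma circle_int_ge0 f : (forall s, per s -> 0 <= f s) -> 0 <= circle_int f.
Proof. by move=> *; exact: Rintegral_ge0. Qed.

Lemma ler_norm_circle_int f : circle_integrable f ->
  `|circle_int f| <= circle_int (fun s => `|f s|).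
Proof. by move=> *; exact: le_normr_Rintegral. Qed.

Lemma eq_circle_int f g : (forall s, per s -> f s = g s) ->
  circle_int f = circle_int g.
Proof. by move=> fg; apply: eq_Rintegral => s /set_mem /fg. Qed.

Lemma circle_intE f : circle_integrable f ->
  (\int[mu]_(s in per) (f s)%:E)%E = (circle_int f)%:E.
Proof.
by move=> intf; rewrite /circle_int /Rintegral fineK//; exact: integrable_fin_num.
Qed.

Lemma circle_integrable_sum (F : nat -> R -> R) N :
  (forall n, circle_integrable (F n)) ->
  circle_integrable (fun s => \sum_(0 <= n < N) F n s).
Proof.
move=> intF; elim: N => [|N IH].
  by under eq_fun do rewrite big_geq//; exact: circle_integrable_cst.
by under eq_fun do rewrite big_nat_recr//=; exact: circle_integrableD.
Qed.

Lemma circle_int_sum (F : nat -> R -> R) N :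
  (forall n, circle_integrable (F n)) ->
  circle_int (fun s => \sum_(0 <= n < N) F n s) =
  \sum_(0 <= n < N) circle_int (F n).
Proof.
move=> intF; elim: N => [|N IH].
  by under eq_circle_int do rewrite big_geq//; rewrite big_geq// circle_int_cst mulr0.
under eq_circle_int do rewrite big_nat_recr//=.
by rewrite circle_intD ?IH ?big_nat_recr//; exact: circle_integrable_sum.
Qed.

Lemma ae_eq_circle_int f g : measurable_fun per f -> measurable_fun per g ->
  ae_eq_circle f g -> circle_int f = circle_int g.
Proof.
move=> mf mg fg; rewrite /circle_int /Rintegral; congr fine.
apply: ae_eq_integral => //; [exact/measurable_EFinP|exact/measurable_EFinP|].
move: fg; apply: filterS; first exact: (ae_filter_ringOfSetsType mu).
by move=> x /= fgx /fgx ->.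
Qed.

Definition square_integrable f :=
  measurable_fun per f /\ circle_integrable (fun s => f s ^+ 2).

Lemma square_integrableM f g : square_integrable f -> square_integrable g ->
  circle_integrable (fun s => f s * g s).
Proof.
move=> [mf qf] [mg qg].
apply: (@le_circle_integrable _ (fun s => f s ^+ 2 + g s ^+ 2)).
- exact: measurable_funM.
- move=> s _; rewrite normrM -(real_normK (num_real (f s))) -(real_normK (num_real (g s))).
  have := sqr_ge0 (`|f s| - `|g s|); nra.
- exact: circle_integrableD.
Qed.

Lemma continuous_measurable_period f : continuous f -> measurable_fun per f.
Proof.
move=> cf; apply: measurable_funTS; exact: continuous_measurable_fun.
Qed.

Lemma continuous_square_integrable f : continuous f -> square_integrable f.
Proof.
move=> cf; split; first exact: continuous_measurable_period.
by apply: continuous_circle_integrable => x; apply: cvgM; exact: cf.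
Qed.

Lemma square_integrable_integrable f : square_integrable f -> circle_integrable f.
Proof.
move=> qf; have : square_integrable (fun=> 1 : R).
  by apply: continuous_square_integrable => x; exact: cvg_cst.
by move=> /(square_integrableM qf); under eq_fun do rewrite mulr1.
Qed.

Lemma square_integrableD f g : square_integrable f -> square_integrable g ->
  square_integrable (fun s => f s + g s).
Proof.
move=> qf qg; split; first by apply: measurable_funD; [case: qf|case: qg].
under eq_fun do rewrite sqrrD -mulr_natl.
apply: circle_integrableD; last by case: qg.
apply: circle_integrableD; first by case: qf.
by apply: circle_integrableZl; exact: square_integrableM.
Qed.

Lemma square_integrableZl k f : square_integrable f ->
  square_integrable (fun s => k * f s).
Proof.
move=> [mf qf]; split; first exact: measurable_funM.
by under eq_fun do rewrite exprMn; exact: circle_integrableZl.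
Qed.

Lemma square_integrableB f g : square_integrable f -> square_integrable g ->
  square_integrable (fun s => f s - g s).
Proof.
move=> qf /(square_integrableZl (-1)) qg.
have := square_integrableD qf qg.
by under eq_fun do rewrite mulN1r.
Qed.

Lemma L2normE f : L2norm f = ((\int[mu]_(s in per) (f s ^+ 2)%:E) `^ 2^-1)%E.
Proof.
rewrite /L2norm unlock; congr (_ `^ _)%E.
rewrite [RHS]integral_mkcond; apply: eq_integral => x _.
rewrite /patch; case: ifPn => _; last by rewrite abse0 poweR0r.
by rewrite /= powR_mulrn ?normr_ge0// real_normK// num_real.
Qed.

Lemma L2norm_square_integrable f : square_integrable f ->
  L2norm f = (Num.sqrt (circle_int (fun s => f s ^+ 2)))%:E.
Proof.
move=> [mf qf]; rewrite L2normE circle_intE// poweR_EFin powR12_sqrt//.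
by apply: circle_int_ge0 => s _; exact: sqr_ge0.
Qed.

Lemma L2P f : L2 f <-> periodic f /\ square_integrable f.
Proof.
split=> [[pf mf nf]|[pf qf]]; last first.
  by split=> //; [case: qf|rewrite L2norm_square_integrable// ltry].
split=> //; split=> //.
apply/integrableP; split.
  by apply/measurable_EFinP; exact: measurable_funX.
under eq_integral => s _ do rewrite /= ger0_norm ?sqr_ge0//.
move: nf; rewrite L2normE; apply: lty_poweRy.
by rewrite invr_eq0 pnatr_eq0.
Qed.

Lemma L2norm_ge0 f : (0 <= L2norm f)%E.
Proof. by rewrite L2normE poweR_ge0. Qed.

Lemma meanE f : circle_int f = 2 * pi * mean f.
Proof. by rewrite /mean mulrA divff ?mul1r// gt_eqF// twopi_gt0. Qed.

Lemma meanD f g : circle_integrable f -> circle_integrable g ->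
  mean (fun s => f s + g s) = mean f + mean g.
Proof. by move=> *; rewrite /mean circle_intD// mulrDr. Qed.

Lemma meanB f g : circle_integrable f -> circle_integrable g ->
  mean (fun s => f s - g s) = mean f - mean g.
Proof. by move=> *; rewrite /mean circle_intB// mulrBr. Qed.

Lemma meanZl k f : circle_integrable f -> mean (fun s => k * f s) = k * mean f.
Proof. by move=> *; rewrite /mean circle_intZl// mulrCA. Qed.

Lemma mean_cst (k : R) : mean (fun=> k) = k.
Proof. by rewrite /mean circle_int_cst mulrA mulVf ?mul1r// gt_eqF// twopi_gt0. Qed.

Lemma eq_mean f g : (forall s, per s -> f s = g s) -> mean f = mean g.
Proof. by move=> fg; rewrite /mean (eq_circle_int fg). Qed.

Lemma mean_sum (F : nat -> R -> R) N : (forall n, circle_integrable (F n)) ->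
  mean (fun s => \sum_(0 <= n < N) F n s) = \sum_(0 <= n < N) mean (F n).
Proof. by move=> intF; rewrite /mean circle_int_sum// mulr_sumr. Qed.

Lemma le_mean f g : circle_integrable f -> circle_integrable g ->
  (forall s, per s -> f s <= g s) -> mean f <= mean g.
Proof.
by move=> *; rewrite ler_wpM2l ?invr_ge0 ?(ltW twopi_gt0)//; exact: le_circle_int.
Qed.

Lemma ler_norm_mean f : circle_integrable f ->
  `|mean f| <= mean (fun s => `|f s|).
Proof.
move=> intf; rewrite /mean normrM ger0_norm ?invr_ge0 ?(ltW twopi_gt0)//.
by rewrite ler_wpM2l ?invr_ge0 ?(ltW twopi_gt0)//; exact: ler_norm_circle_int.
Qed.

Lemma mean_ge0 f : (forall s, per s -> 0 <= f s) -> 0 <= mean f.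
Proof.
by move=> f0; rewrite mulr_ge0 ?invr_ge0 ?(ltW twopi_gt0)//; exact: circle_int_ge0.
Qed.

Lemma ae_eq_mean f g : measurable_fun per f -> measurable_fun per g ->
  ae_eq_circle f g -> mean f = mean g.
Proof. by move=> *; rewrite /mean (@ae_eq_circle_int f g). Qed.

End CircleIntegral.

(** * Trigonometric orthogonality and Bessel's inequality *)

Section Trig.
Context {R : realType}.
Local Notation mu := (@lebesgue_measure R).
Local Notation per := (@period R).
Implicit Types (f g : R -> R) (n k N : nat) (a b : nat -> R).

Lemma circle_int_derive (F f : R -> R) : continuous f ->
  (forall s : R, is_derive s 1 F (f s)) -> circle_int f = F (2 * pi) - F 0.
Proof.
move=> cf dF; have cF : continuous F.
  by move=> s; apply: differentiable_continuous; apply/derivable1_diffP; case: (dF s).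
have h : (\int[mu]_(x in per) (f x)%:E)%E = ((F (2 * pi))%:E - (F 0)%:E)%E.
  apply: continuous_FTC2.
  - exact: twopi_gt0.
  - exact: continuous_subspaceT.
  - split; first by move=> x _; case: (dF x).
    + exact/cvg_at_right_filter/cF.
    + exact/cvg_at_left_filter/cF.
  - by move=> x _; rewrite derive1E; case: (dF x).
by rewrite /circle_int /Rintegral h.
Qed.

Lemma cosDnat2pi n (x : R) : cos (x + n%:R * (2 * pi)) = cos x.
Proof.
elim: n => [|n IH]; first by rewrite mul0r addr0.
have -> : x + n.+1%:R * (2 * pi) = x + n%:R * (2 * pi) + pi *+ 2.
  by rewrite -natr1 -mulr_natl; ring.
by rewrite cosD2pi.
Qed.

Lemma sinDnat2pi n (x : R) : sin (x + n%:R * (2 * pi)) = sin x.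
Proof.
elim: n => [|n IH]; first by rewrite mul0r addr0.
have -> : x + n.+1%:R * (2 * pi) = x + n%:R * (2 * pi) + pi *+ 2.
  by rewrite -natr1 -mulr_natl; ring.
by rewrite sinD2pi.
Qed.

Lemma is_derive_scale (c s : R) : is_derive s 1 (fun y : R => c * y) c.
Proof.
have -> : (fun y : R => c * y) = c *: (@id R) by [].
by apply: is_derive_eq; rewrite /GRing.scale/= mulr1.
Qed.

Lemma is_derive_cosM (c s : R) :
  is_derive s 1 (fun y => cos (c * y)) (- (c * sin (c * s))).
Proof.
have h := is_derive_scale c s.
have := @is_derive1_comp R (@cos R) (fun y : R => c * y) s _ _ (is_derive_cos (c * s)) h.
by rewrite mulNr mulrC.
Qed.

Lemma is_derive_sinM (c s : R) :
  is_derive s 1 (fun y => sin (c * y)) (c * cos (c * s)).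
Proof.
have h := is_derive_scale c s.
have := @is_derive1_comp R (@sin R) (fun y : R => c * y) s _ _ (is_derive_sin (c * s)) h.
by rewrite mulrC.
Qed.

Lemma continuous_cosM (c : R) : continuous (fun s => cos (c * s)).
Proof.
move=> s; apply: differentiable_continuous; apply/derivable1_diffP.
by case: (is_derive_cosM c s).
Qed.

Lemma continuous_sinM (c : R) : continuous (fun s => sin (c * s)).
Proof.
move=> s; apply: differentiable_continuous; apply/derivable1_diffP.
by case: (is_derive_sinM c s).
Qed.

Lemma mean_cos n : mean (fun s : R => cos (n%:R * s)) = (n == 0%N)%:R.
Proof.
case: n => [|n].
  by rewrite (@eq_mean _ _ (fun=> 1)) ?mean_cst// => s _; rewrite mul0r cos0.
pose F s := n.+1%:R^-1 * sin (n.+1%:R * s) : R.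
have dF (s : R) : is_derive s 1 F (cos (n.+1%:R * s)).
  have h := is_derive_sinM n.+1%:R s.
  by apply: is_derive_eq; rewrite /GRing.scale/= mulKf.
rewrite /mean (circle_int_derive (@continuous_cosM n.+1%:R) dF) /F.
by rewrite -[n.+1%:R * (2 * pi)]add0r sinDnat2pi mulr0 sin0 subrr mulr0.
Qed.

Lemma mean_sin n : mean (fun s : R => sin (n%:R * s)) = 0.
Proof.
case: n => [|n].
  by rewrite (@eq_mean _ _ (fun=> 0)) ?mean_cst// => s _; rewrite mul0r sin0.
pose F s := - n.+1%:R^-1 * cos (n.+1%:R * s) : R.
have dF (s : R) : is_derive s 1 F (sin (n.+1%:R * s)).
  have h := is_derive_cosM n.+1%:R s.
  by apply: is_derive_eq; rewrite /GRing.scale/= mulrN mulNr opprK mulKf.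
rewrite /mean (circle_int_derive (@continuous_sinM n.+1%:R) dF) /F.
by rewrite -[n.+1%:R * (2 * pi)]add0r cosDnat2pi mulr0 cos0 subrr mulr0.
Qed.

(** The distance [|n - k|]: one of the two truncated differences is [0]. *)
Definition ndist n k := (n - k + (k - n))%N.

Lemma cosMcos n k (s : R) : cos (n%:R * s) * cos (k%:R * s) =
  (cos ((n + k)%:R * s) + cos ((ndist n k)%:R * s)) / 2.
Proof.
have -> : (n + k)%:R * s = n%:R * s + k%:R * s by rewrite natrD mulrDl.
rewrite cosD /ndist; case: (leqP n k) => nk.
  have -> : (n - k + (k - n))%N = (k - n)%N by lia.
  have -> : (k - n)%:R * s = k%:R * s - n%:R * s by rewrite natrB// mulrBl.
  by rewrite cosB; field.
have -> : (n - k + (k - n))%N = (n - k)%N by lia.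
have -> : (n - k)%:R * s = n%:R * s - k%:R * s by rewrite natrB 1?ltnW// mulrBl.
by rewrite cosB; field.
Qed.

Lemma sinMsin n k (s : R) : sin (n%:R * s) * sin (k%:R * s) =
  (cos ((ndist n k)%:R * s) - cos ((n + k)%:R * s)) / 2.
Proof.
have -> : (n + k)%:R * s = n%:R * s + k%:R * s by rewrite natrD mulrDl.
rewrite cosD /ndist; case: (leqP n k) => nk.
  have -> : (n - k + (k - n))%N = (k - n)%N by lia.
  have -> : (k - n)%:R * s = k%:R * s - n%:R * s by rewrite natrB// mulrBl.
  by rewrite cosB; field.
have -> : (n - k + (k - n))%N = (n - k)%N by lia.
have -> : (n - k)%:R * s = n%:R * s - k%:R * s by rewrite natrB 1?ltnW// mulrBl.
by rewrite cosB; field.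
Qed.

(** The sign for which [nsign n k * sin (ndist n k * s) = sin ((n - k) s)]. *)
Definition nsign n k : R := if (k <= n)%N then 1 else -1.

Lemma sinMcos n k (s : R) : sin (n%:R * s) * cos (k%:R * s) =
  (sin ((n + k)%:R * s) + nsign n k * sin ((ndist n k)%:R * s)) / 2.
Proof.
have -> : (n + k)%:R * s = n%:R * s + k%:R * s by rewrite natrD mulrDl.
rewrite sinD /ndist /nsign; case: (leqP k n) => nk.
  have -> : (n - k + (k - n))%N = (n - k)%N by lia.
  have -> : (n - k)%:R * s = n%:R * s - k%:R * s by rewrite natrB// mulrBl.
  by rewrite sinB; field.
have -> : (n - k + (k - n))%N = (k - n)%N by lia.
have -> : (k - n)%:R * s = k%:R * s - n%:R * s by rewrite natrB 1?ltnW// mulrBl.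
by rewrite sinB; field.
Qed.

Lemma circle_integrable_cos n : circle_integrable (fun s : R => cos (n%:R * s)).
Proof. by apply: continuous_circle_integrable; exact: continuous_cosM. Qed.

Lemma circle_integrable_sin n : circle_integrable (fun s : R => sin (n%:R * s)).
Proof. by apply: continuous_circle_integrable; exact: continuous_sinM. Qed.

Lemma mean_cos_cos n k :
  mean (fun s : R => cos (n%:R * s) * cos (k%:R * s)) =
  ((n + k == 0)%N%:R + (n == k)%:R) / 2.
Proof.
under eq_mean do rewrite cosMcos mulrC.
rewrite meanZl ?meanD ?mean_cos; try exact: circle_integrable_cos.
  rewrite mulrC; congr ((_ + _%:R) / _); congr nat_of_bool.
  by apply/idP/idP => /eqP; rewrite /ndist => h; apply/eqP; lia.
by apply: circle_integrableD; exact: circle_integrable_cos.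
Qed.

Lemma mean_sin_sin n k :
  mean (fun s : R => sin (n%:R * s) * sin (k%:R * s)) =
  ((n == k)%:R - (n + k == 0)%N%:R) / 2.
Proof.
under eq_mean do rewrite sinMsin mulrC.
rewrite meanZl ?meanB ?mean_cos; try exact: circle_integrable_cos.
  rewrite mulrC; congr ((_%:R - _) / _); congr nat_of_bool.
  by apply/idP/idP => /eqP; rewrite /ndist => h; apply/eqP; lia.
by apply: circle_integrableB; exact: circle_integrable_cos.
Qed.

Lemma mean_sin_cos n k : mean (fun s : R => sin (n%:R * s) * cos (k%:R * s)) = 0.
Proof.
under eq_mean do rewrite sinMcos mulrC.
have h := circle_integrable_sin.
have h2 := circle_integrableZl (nsign n k) (h (ndist n k)).
rewrite meanZl ?meanD ?meanZl ?mean_sin//; last exact: circle_integrableD.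
by rewrite mulr0 addr0 mulr0.
Qed.

Lemma mean_cos_sin n k : mean (fun s : R => cos (n%:R * s) * sin (k%:R * s)) = 0.
Proof. by under eq_mean do rewrite mulrC; exact: mean_sin_cos. Qed.

(** These are means, without the factor [2] of the classical coefficients, so that [fourier f n] is
    [fcos f n - i fsin f n]. The Fourier series of a mean-zero function is then [2 sum_n (fcos f n
    cos (n s) + fsin f n sin (n s))]; this is the source of the factors [2] below. *)
Definition fcos f n : R := mean (fun s => f s * cos (n%:R * s)).
Definition fsin f n : R := mean (fun s => f s * sin (n%:R * s)).

Lemma integrable_fcos f n : circle_integrable f ->
  circle_integrable (fun s => f s * cos (n%:R * s)).
Proof.
move=> intf; apply: (@circle_integrable_bounded _ 1) => //.
  by apply: continuous_measurable_period; exact: continuous_cosM.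
by move=> s _; exact: cos_max.
Qed.

Lemma integrable_fsin f n : circle_integrable f ->
  circle_integrable (fun s => f s * sin (n%:R * s)).
Proof.
move=> intf; apply: (@circle_integrable_bounded _ 1) => //.
  by apply: continuous_measurable_period; exact: continuous_sinM.
by move=> s _; exact: sin_max.
Qed.

Lemma fcos0 f : fcos f 0 = mean f.
Proof. by apply: eq_mean => s _; rewrite mul0r cos0 mulr1. Qed.

Lemma fsin0 f : fsin f 0 = 0.
Proof.
rewrite /fsin (@eq_mean _ _ (fun=> 0)) ?mean_cst// => s _.
by rewrite mul0r sin0 mulr0.
Qed.

Lemma fcosB f g n : circle_integrable f -> circle_integrable g ->
  fcos (fun s => f s - g s) n = fcos f n - fcos g n.
Proof.
move=> intf intg; rewrite /fcos -meanB; try exact: integrable_fcos.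
by apply: eq_mean => s _; rewrite mulrBl.
Qed.

Lemma fsinB f g n : circle_integrable f -> circle_integrable g ->
  fsin (fun s => f s - g s) n = fsin f n - fsin g n.
Proof.
move=> intf intg; rewrite /fsin -meanB; try exact: integrable_fsin.
by apply: eq_mean => s _; rewrite mulrBl.
Qed.

Lemma fcosD f g n : circle_integrable f -> circle_integrable g ->
  fcos (fun s => f s + g s) n = fcos f n + fcos g n.
Proof.
move=> intf intg; rewrite /fcos -meanD; try exact: integrable_fcos.
by apply: eq_mean => s _; rewrite mulrDl.
Qed.

Lemma fsinD f g n : circle_integrable f -> circle_integrable g ->
  fsin (fun s => f s + g s) n = fsin f n + fsin g n.
Proof.
move=> intf intg; rewrite /fsin -meanD; try exact: integrable_fsin.
by apply: eq_mean => s _; rewrite mulrDl.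
Qed.

Lemma fcosZl c f n : circle_integrable f ->
  fcos (fun s => c * f s) n = c * fcos f n.
Proof.
move=> intf; rewrite /fcos -meanZl; last exact: integrable_fcos.
by apply: eq_mean => s _; rewrite mulrA.
Qed.

Lemma fsinZl c f n : circle_integrable f ->
  fsin (fun s => c * f s) n = c * fsin f n.
Proof.
move=> intf; rewrite /fsin -meanZl; last exact: integrable_fsin.
by apply: eq_mean => s _; rewrite mulrA.
Qed.

Definition trig_mode a b n (s : R) := a n * cos (n%:R * s) + b n * sin (n%:R * s).

Definition trig_poly a b N s := \sum_(0 <= n < N) trig_mode a b n s.

Lemma continuous_trig_mode a b n : continuous (trig_mode a b n).
Proof.
move=> s; apply: cvgD; apply: cvgM; try exact: cvg_cst.
- exact: continuous_cosM.
- exact: continuous_sinM.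
Qed.

Lemma continuous_trig_poly a b N : continuous (trig_poly a b N).
Proof.
move=> s; rewrite /trig_poly /continuous_at.
elim: N => [|N IH].
  by rewrite big_geq//; under eq_fun do rewrite big_geq//; exact: cvg_cst.
rewrite big_nat_recr//=; under eq_fun do rewrite big_nat_recr//=.
by apply: cvgD => //; exact: continuous_trig_mode.
Qed.

Lemma integrable_mul_trig_mode f a b n : circle_integrable f ->
  circle_integrable (fun s => f s * trig_mode a b n s).
Proof.
move=> intf; under eq_fun do rewrite mulrDr mulrCA [X in _ + X]mulrCA.
apply: circle_integrableD; apply: circle_integrableZl.
- exact: integrable_fcos.
- exact: integrable_fsin.
Qed.

Lemma mean_mul_trig_mode f a b n : circle_integrable f ->
  mean (fun s => f s * trig_mode a b n s) = a n * fcos f n + b n * fsin f n.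
Proof.
move=> intf; under eq_mean do rewrite mulrDr mulrCA [X in _ + X]mulrCA.
have h1 := integrable_fcos n intf; have h2 := integrable_fsin n intf.
by rewrite meanD ?meanZl//; exact: circle_integrableZl.
Qed.

Lemma mean_mul_trig_poly f a b N : circle_integrable f ->
  mean (fun s => f s * trig_poly a b N s) =
  \sum_(0 <= n < N) (a n * fcos f n + b n * fsin f n).
Proof.
move=> intf; under eq_mean do rewrite mulr_sumr.
rewrite mean_sum; last by move=> n; exact: integrable_mul_trig_mode.
by apply: eq_bigr => n _; exact: mean_mul_trig_mode.
Qed.

(** A mode of positive frequency has mean square [1 / 2], while the constant has mean square [1];
    the condition at [n = 0] keeps a single formula. *)
Lemma trig_poly_fcos a b N n : (n = 0%N -> a 0%N = 0) ->
  fcos (trig_poly a b N) n = if (n < N)%N then a n / 2 else 0.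
Proof.
move=> a0; rewrite /fcos.
under eq_mean do rewrite mulrC.
rewrite mean_mul_trig_poly; last exact: circle_integrable_cos.
transitivity (\sum_(0 <= k < N) (if k == n then a n / 2 else 0)).
  apply: eq_bigr => k _; rewrite /fcos /fsin mean_cos_cos.
  rewrite mean_cos_sin mulr0 addr0.
  have [->|kn] := eqVneq k n; last first.
    have -> : (n + k == 0)%N = false by lia.
    by rewrite addr0 mul0r mulr0.
  case: n a0 => [|n] a0; first by rewrite a0// !mul0r.
  by rewrite addSn/= add0r mul1r.
case: ltnP => nN.
  rewrite (bigD1_seq n)/= ?mem_index_iota ?iota_uniq//.
  by rewrite eqxx big1 ?addr0// => k /negbTE ->.
rewrite big_nat big1// => k kN; case: eqP => // kn; lia.
Qed.

Lemma trig_poly_fsin a b N n : b 0%N = 0 ->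
  fsin (trig_poly a b N) n = if (n < N)%N then b n / 2 else 0.
Proof.
move=> b0; rewrite /fsin.
under eq_mean do rewrite mulrC.
rewrite mean_mul_trig_poly; last exact: circle_integrable_sin.
transitivity (\sum_(0 <= k < N) (if k == n then b n / 2 else 0)).
  apply: eq_bigr => k _; rewrite /fcos /fsin mean_sin_cos mean_sin_sin.
  rewrite mulr0 add0r.
  have [->|kn] := eqVneq k n; last first.
    have -> : (n + k == 0)%N = false by lia.
    by rewrite subr0 mul0r mulr0.
  case: n => [|n]; first by rewrite b0 !mul0r.
  by rewrite addSn/= subr0 mul1r.
case: ltnP => nN.
  rewrite (bigD1_seq n)/= ?mem_index_iota ?iota_uniq//.
  by rewrite eqxx big1 ?addr0// => k /negbTE ->.
rewrite big_nat big1// => k kN; case: eqP => // kn; lia.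
Qed.

Lemma mean_trig_poly_sqr a b N : a 0%N = 0 -> b 0%N = 0 ->
  mean (fun s => trig_poly a b N s ^+ 2) =
  (\sum_(0 <= n < N) (a n ^+ 2 + b n ^+ 2)) / 2.
Proof.
move=> a0 b0; under eq_mean do rewrite expr2.
rewrite mean_mul_trig_poly; last first.
  by apply: continuous_circle_integrable; exact: continuous_trig_poly.
rewrite mulr_suml big_nat [RHS]big_nat; apply: eq_bigr => n /= nN.
by rewrite trig_poly_fcos// trig_poly_fsin// nN; field.
Qed.

Lemma bessel f N : square_integrable f -> fcos f 0 = 0 ->
  2 * (\sum_(0 <= n < N) (fcos f n ^+ 2 + fsin f n ^+ 2)) <=
  mean (fun s => f s ^+ 2).
Proof.
move=> qf f0; pose a n := 2 * fcos f n; pose b n := 2 * fsin f n.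
have a0 : a 0%N = 0 by rewrite /a f0 mulr0.
have b0 : b 0%N = 0 by rewrite /b fsin0 mulr0.
have cp := @continuous_trig_poly a b N.
have qp := continuous_square_integrable cp.
have intf := square_integrable_integrable qf.
have h0 : 0 <= mean (fun s => (f s - trig_poly a b N s) ^+ 2).
  by apply: mean_ge0 => s _; exact: sqr_ge0.
have h1 : mean (fun s => (f s - trig_poly a b N s) ^+ 2) =
  mean (fun s => f s ^+ 2) - 2 * mean (fun s => f s * trig_poly a b N s)
  + mean (fun s => trig_poly a b N s ^+ 2).
  under eq_mean do rewrite sqrrB -mulr_natl.
  have h := square_integrableM qf qp.
  rewrite meanD ?meanB ?meanZl//; try by [case: qf|case: qp].
    exact: circle_integrableZl.
  by apply: circle_integrableB; [case: qf|exact: circle_integrableZl].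
have h2 : mean (fun s => f s * trig_poly a b N s) =
    2 * (\sum_(0 <= n < N) (fcos f n ^+ 2 + fsin f n ^+ 2)).
  rewrite mean_mul_trig_poly// mulr_sumr; apply: eq_bigr => n _.
  by rewrite /a /b; ring.
have h3 : mean (fun s => trig_poly a b N s ^+ 2) =
    2 * (\sum_(0 <= n < N) (fcos f n ^+ 2 + fsin f n ^+ 2)).
  rewrite mean_trig_poly_sqr// mulr_suml mulr_sumr; apply: eq_bigr => n _.
  by rewrite /a /b; field.
by move: h0; rewrite h1 h2 h3; lra.
Qed.

End Trig.

(** * Completeness of the trigonometric system *)

Section Kernel.
Context {R : realType}.
Implicit Types (p q : R -> R) (P : {poly R}).

(** An even trigonometric polynomial. Every length [M >= N] represents it, so that two of them can
    be added over a common range. *)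
Definition cospoly p := exists (c : nat -> R) N, forall M, (N <= M)%N ->
  forall s, p s = \sum_(0 <= k < M) c k * cos (k%:R * s).

Lemma cospolyD p q : cospoly p -> cospoly q -> cospoly (fun s => p s + q s).
Proof.
move=> [c [N h]] [c' [N' h']]; exists (fun k => c k + c' k), (maxn N N').
move=> M; rewrite geq_max => /andP[NM N'M] s.
by rewrite (h M)// (h' M)// -big_split/=; apply: eq_bigr => k _; rewrite mulrDl.
Qed.

Lemma cospoly_cos (x : R) n : cospoly (fun s => x * cos (n%:R * s)).
Proof.
exists (fun k => if k == n then x else 0), n.+1 => M nM s.
rewrite (bigD1_seq n)/= ?mem_index_iota ?iota_uniq//.
by rewrite eqxx big1 ?addr0// => k /negbTE ->; rewrite mul0r.
Qed.

Lemma eq_cospoly p q : p =1 q -> cospoly p -> cospoly q.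
Proof. by move=> pq [c [N h]]; exists c, N => M NM s; rewrite -pq (h M). Qed.

Lemma cospolyMcos p : cospoly p -> cospoly (fun s => p s * cos s).
Proof.
move=> [c [N h]].
apply: (@eq_cospoly (fun s => \sum_(0 <= k < N) c k * cos (k%:R * s) * cos s)).
  by move=> s; rewrite (h N)// mulr_suml.
elim: N {h} => [|N IH].
  apply: (@eq_cospoly (fun s => 0 * cos (0%:R * s))); last exact: cospoly_cos.
  by move=> s; rewrite big_geq// mul0r.
apply: (@eq_cospoly (fun s => \sum_(0 <= k < N) c k * cos (k%:R * s) * cos s +
    (c N / 2 * cos ((N + 1)%:R * s) + c N / 2 * cos ((ndist N 1)%:R * s)))).
  move=> s; rewrite big_nat_recr//=; congr (_ + _).
  by rewrite -[RHS]mulrA; have := cosMcos N 1 s; rewrite mul1r => ->; field.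
apply: cospolyD => //; apply: cospolyD; exact: cospoly_cos.
Qed.

Lemma cospoly_horner P : cospoly (fun s => P.[cos s]).
Proof.
elim/poly_ind: P => [|P c IH].
  apply: (@eq_cospoly (fun s => 0 * cos (0%:R * s))); last exact: cospoly_cos.
  by move=> s; rewrite horner0 mul0r.
apply: (@eq_cospoly (fun s => P.[cos s] * cos s + c * cos (0%:R * s))).
  by move=> s; rewrite hornerMXaddC mul0r cos0 mulr1.
by apply: cospolyD; [exact: cospolyMcos|exact: cospoly_cos].
Qed.

(* The functions [(1 - y ^ n) ^ (2 ^ n)] tend to [1] where [2 y < 1] and to [0]
   where [2 y > 1]; with [y = 1 / 2 + (cos d - cos s) / 4] they are
   trigonometric polynomials approximating the indicator of [|s| < d]. *)
Definition arc_poly (d : R) n : {poly R} :=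
  (1 - ((2^-1 + cos d / 4)%:P - 4^-1 *: 'X) ^+ n) ^+ (2 ^ n).

Definition arc_kernel (d : R) n (s : R) : R :=
  (1 - (2^-1 + (cos d - cos s) / 4) ^+ n) ^+ (2 ^ n).

Lemma arc_kernelE d n s : arc_kernel d n s = (arc_poly d n).[cos s].
Proof.
rewrite /arc_kernel /arc_poly !hornerE; congr ((1 - _ ^+ _) ^+ _).
by field.
Qed.

Lemma arc_base_itv (d s : R) : 0 <= 2^-1 + (cos d - cos s) / 4 <= 1.
Proof.
have := cos_geN1 d; have := cos_geN1 s; have := cos_le1 d; have := cos_le1 s.
by move=> *; apply/andP; split; lra.
Qed.

Lemma arc_kernel_itv d n s : 0 <= arc_kernel d n s <= 1.
Proof.
have /andP[y0 y1] := arc_base_itv d s.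
rewrite /arc_kernel; set y := _ + _ in y0 y1 *.
have h : 0 <= 1 - y ^+ n <= 1.
  by rewrite subr_ge0 lerBlDr lerDl exprn_ge0// exprn_ile1.
case/andP: h => h0 h1.
by rewrite exprn_ge0//= exprn_ile1.
Qed.

Lemma continuous_arc_kernel d n : continuous (arc_kernel d n).
Proof.
move=> s; have -> : arc_kernel d n = (horner (arc_poly d n)) \o cos.
  by apply/funext => x /=; rewrite arc_kernelE.
by apply: continuous_comp; [exact: continuous_cos|exact: continuous_horner].
Qed.

Lemma bernoulli_le (x : R) n : 0 <= x <= 1 -> 1 - n%:R * x <= (1 - x) ^+ n.
Proof.
move=> /andP[x0 x1]; elim: n => [|n IH]; first by rewrite mul0r subr0.
rewrite exprS -natr1.
have : 0 <= n%:R * x ^+ 2 by rewrite mulr_ge0 ?sqr_ge0.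
have := ler_wpM2l (_ : 0 <= 1 - x) IH; rewrite subr_ge0 => /(_ x1).
by move=> *; lra.
Qed.

(** Induction with [(1 - x) (1 + (n + 1) x) <= 1 + n x]. With [x = y ^ n] and exponent [2 ^ n], this
    and Bernoulli's inequality enclose [arc_kernel] between [1 - (2 y) ^ n] and
    [1 / (1 + (2 y) ^ n)], which gives its two limits. *)
Lemma bernoulli_inv (x : R) n : 0 <= x <= 1 -> (1 - x) ^+ n * (1 + n%:R * x) <= 1.
Proof.
move=> /andP[x0 x1]; elim: n => [|n IH]; first by rewrite mul0r addr0 mulr1.
rewrite exprS -natr1; apply: le_trans IH; rewrite -mulrA mulrCA.
apply: ler_wpM2l; first by rewrite exprn_ge0// subr_ge0.
have : 0 <= n%:R * x ^+ 2 by rewrite mulr_ge0 ?sqr_ge0.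
have := sqr_ge0 x; move=> *; lra.
Qed.

Lemma cvg_arc_kernel1 (d s : R) : cos d < cos s ->
  arc_kernel d n s @[n --> \oo] --> (1 : R).
Proof.
move=> ds; have /andP[y0 y1] := arc_base_itv d s.
rewrite /arc_kernel; set y := _ + _ in y0 y1 *.
have y2 : 2 * y < 1 by rewrite /y; lra.
apply: (@squeeze_cvgr _ _ _ _ (fun n => 1 - (2 * y) ^+ n) (fun=> 1)).
- apply: nearW => n.
  have h : 0 <= y ^+ n <= 1 by rewrite exprn_ge0// exprn_ile1.
  apply/andP; split.
    by rewrite exprMn -natrX; exact: bernoulli_le.
  case/andP: h => h0 h1; apply: exprn_ile1; first by rewrite subr_ge0.
  by rewrite lerBlDr lerDl.
- rewrite -[X in _ --> X]subr0; apply: cvgB; first exact: cvg_cst.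
  by apply: cvg_expr; rewrite ger0_norm// mulr_ge0.
- exact: cvg_cst.
Qed.

Lemma cvg_arc_kernel0 (d s : R) : cos s < cos d ->
  arc_kernel d n s @[n --> \oo] --> (0 : R).
Proof.
move=> ds; have /andP[y0 y1] := arc_base_itv d s.
have hk n := arc_kernel_itv d n s.
rewrite /arc_kernel in hk *; set y := _ + _ in y0 y1 hk *.
have y2 : 1 < 2 * y by rewrite /y; lra.
apply: (@squeeze_cvgr _ _ _ _ (fun=> 0) (fun n => ((2 * y)^-1) ^+ n)).
- apply: nearW => n; have /andP[-> _] /= := hk n.
  have h : 0 <= y ^+ n <= 1 by rewrite exprn_ge0// exprn_ile1.
  have h2 : 0 < (2 * y) ^+ n by rewrite exprn_gt0//; lra.
  rewrite exprVn -(ler_pM2r h2) mulVf ?gt_eqF//.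
  apply: le_trans (bernoulli_inv (2 ^ n) h); apply: ler_wpM2l.
    by have /andP[] := hk n.
  by rewrite exprMn natrX lerDr.
- exact: cvg_cst.
- apply: cvg_expr; rewrite ger0_norm ?invr_ge0; last by lra.
  by rewrite invf_lt1//; lra.
Qed.

(** The range of [u] is that of [s - x] when [s] is in the period and [d < x < 2 pi - d]. Beyond
    [pi] the cosine is reflected to [2 pi - |u|], which still exceeds [d]. *)
Lemma ltr_cos_norm (d u : R) : 0 < d < pi -> `|u| < 2 * pi - d ->
  (`|u| < d -> cos d < cos u) /\ (d < `|u| -> cos u < cos d).
Proof.
move=> /andP[d0 dpi] ud; rewrite -(cos_norm u).
have u0 := normr_ge0 u; move: (`|u|) u0 ud => {}u u0 ud.
have dI : d \in `[0, pi] by rewrite in_itv/= !ltW.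
split=> h; first by rewrite ltr_cos// in_itv/= u0/=; lra.
have [upi|piu] := leP u pi; first by rewrite ltr_cos// in_itv/= u0.
have -> : cos u = cos (2 * pi - u).
  by rewrite -[in LHS]cosN -(cosDnat2pi 1 (- u)) mul1r addrC.
by rewrite ltr_cos// ?in_itv/=; lra.
Qed.

End Kernel.

(** * Parseval's inequality by convolution with arc kernels *)

Section ParsevalInequality.
Context {R : realType}.
Local Notation mu := (@lebesgue_measure R).
Local Notation per := (@period R).
Implicit Types (f p : R -> R).
#[local] Hint Extern 0 (measurable period) => exact: measurable_period : core.

(** Fatou's lemma with the lower limit identified almost everywhere. It serves twice: for the
    kernels converging to an arc, and for the arcs shrinking to a point. *)
Lemma bounded_fatou (D : set R) (u : nat -> R -> R) (g : R -> R) (K : R) :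
  measurable D -> (forall n, measurable_fun D (u n)) -> measurable_fun D g ->
  (forall n x, D x -> 0 <= u n x) -> (forall x, D x -> 0 <= g x) ->
  {ae mu, forall x, D x -> u n x @[n --> \oo] --> g x} ->
  (forall n, (\int[mu]_(x in D) (u n x)%:E <= K%:E)%E) ->
  (\int[mu]_(x in D) (g x)%:E <= K%:E)%E.
Proof.
move=> mD mun mg u0 g0 ug uK.
have mu' n : measurable_fun D (fun x => (u n x)%:E) by exact/measurable_EFinP.
have u0' n x : D x -> (0 <= (u n x)%:E)%E by move=> Dx; rewrite lee_fin u0.
have fat := fatou mu mD mu' u0'.
pose v n x := einfs (fun k => (u k x)%:E) n.
apply: (@le_trans _ _ (\int[mu]_(x in D) limn_einf (fun n => (u n x)%:E))%E).
  apply: ae_ge0_le_integral => //.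
  - exact/measurable_EFinP.
  - move=> x Dx; rewrite limn_einf_lim; apply: lime_ge; first exact: is_cvg_einfs.
    apply: nearW => n; apply: le_ereal_inf_tmp => _ [m /= _ <-].
    by rewrite lee_fin u0.
  - apply: (@emeasurable_fun_cvg _ _ _ D v).
      by move=> n; exact: measurable_fun_einfs.
    by move=> x Dx; rewrite limn_einf_lim; exact: is_cvg_einfs.
  - move: ug; apply: filterS; first exact: (ae_filter_ringOfSetsType mu).
    move=> x /= + Dx => /(_ Dx) ux.
    rewrite is_cvg_limn_einfE; last first.
      by apply/cvg_ex; exists (g x)%:E; apply: cvg_EFin => //; exact: nearW.
    have /cvg_lim -> // : (u n x)%:E @[n --> \oo] --> (g x)%:E by apply: cvg_EFin => //; exact: nearW.
apply: le_trans fat _.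
rewrite limn_einf_lim; apply: lime_le; first exact: is_cvg_einfs.
apply: nearW => n; apply: le_trans (uK n); apply: ereal_inf_lbound.
by exists n => /=.
Qed.

Lemma mean_conv f (c : nat -> R) N (x : R) : circle_integrable f ->
  mean (fun s => f s * \sum_(0 <= k < N) c k * cos (k%:R * (s - x))) =
  trig_poly (fun k => c k * fcos f k) (fun k => c k * fsin f k) N x.
Proof.
move=> intf.
transitivity (mean (fun s => f s * trig_poly (fun k => c k * cos (k%:R * x))
    (fun k => c k * sin (k%:R * x)) N s)).
  apply: eq_mean => s _; congr (_ * _); apply: eq_bigr => k _.
  by rewrite mulrBr cosB /trig_mode; ring.
rewrite mean_mul_trig_poly//; apply: eq_bigr => k _; rewrite /trig_mode; ring.
Qed.

(* As [p] is nonnegative, its Fourier coefficients are bounded by its mean. *)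
Lemma conv_cospoly_bound f p (S : R) : square_integrable f -> fcos f 0 = 0 ->
  (forall N, \sum_(0 <= n < N) (fcos f n ^+ 2 + fsin f n ^+ 2) <= S) ->
  cospoly p -> (forall s, 0 <= p s) ->
  let F x := mean (fun s => f s * p (s - x)) in
  continuous F /\ mean (fun x => F x ^+ 2) <= 2 * mean p ^+ 2 * S.
Proof.
move=> qf f0 fS [c [N h]] p0 F.
have intf := square_integrable_integrable qf.
pose a k := c k * fcos f k; pose b k := c k * fsin f k.
have FE : F = trig_poly a b N.
  apply/funext => x; rewrite -mean_conv//; apply: eq_mean => s _.
  by rewrite (h N).
have pE : p = trig_poly c (fun=> 0) N.
  apply/funext => s; rewrite (h N)//; apply: eq_bigr => k _.
  by rewrite /trig_mode mul0r addr0.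
have intp : circle_integrable p.
  by rewrite pE; apply: continuous_circle_integrable; exact: continuous_trig_poly.
have J0 : 0 <= mean p by exact: mean_ge0.
have cJ k : (0 < k < N)%N -> c k ^+ 2 <= (2 * mean p) ^+ 2.
  move=> /andP[k0 kN].
  have : `|fcos p k| <= mean p.
    apply: le_trans (ler_norm_mean _) _; first exact: integrable_fcos.
    apply: le_mean => //; first by apply: circle_integrable_norm; exact: integrable_fcos.
    move=> s _; rewrite normrM ger0_norm//; apply: ler_piMr => //.
    exact: cos_max.
  rewrite {1}pE trig_poly_fcos; last by lia.
  rewrite kN => ck; rewrite -(real_normK (num_real (c k))) ler_sqr ?nnegrE//; last exact: mulr_ge0.
  by move: ck; rewrite normrM (@ger0_norm _ (2^-1))//; lra.
split; first by rewrite FE; exact: continuous_trig_poly.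
rewrite FE mean_trig_poly_sqr /a /b ?f0 ?fsin0 ?mulr0//.
rewrite ler_pdivrMr//.
have -> : 2 * mean p ^+ 2 * S * 2 = (2 * mean p) ^+ 2 * S by ring.
apply: le_trans (ler_wpM2l (sqr_ge0 _) (fS N)).
rewrite mulr_sumr big_nat [leRHS]big_nat; apply: ler_sum => k /= kN.
have -> : (c k * fcos f k) ^+ 2 + (c k * fsin f k) ^+ 2 =
  c k ^+ 2 * (fcos f k ^+ 2 + fsin f k ^+ 2) by ring.
case: k kN => [|k] kN; first by rewrite f0 fsin0 expr0n/= addr0 !mulr0.
have := @cJ k.+1 kN => hc.
by apply: ler_wpM2r => //; rewrite addr_ge0 ?sqr_ge0.
Qed.

(** Dominated convergence: the kernels lie between [0] and [1] and tend to the indicator of the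
    arc. *)
Lemma cvg_arc_conv f (d x : R) : circle_integrable f -> 0 < d < pi ->
  d < x < 2 * pi - d ->
  mean (fun s => f s * arc_kernel d n (s - x)) @[n --> \oo] -->
  (2 * pi)^-1 * (\int[mu]_(s in ball x d) f s)%R.
Proof.
move=> intf dpi /andP[dx xd].
have cK n : continuous (fun s : R => arc_kernel d n (s - x)).
  move=> s; apply: (@continuous_comp _ _ _ (fun s => s - x) (arc_kernel d n)).
    by apply: cvgB; [exact: cvg_id|exact: cvg_cst].
  exact: continuous_arc_kernel.
have mB : measurable (ball x d) by exact: measurable_ball.
have mf := circle_integrable_measurable intf.
have ballE s : ball x d s = (`|s - x| < d) :> Prop by rewrite /ball/= distrC.
pose g s := f s * (\1_(ball x d) s : R).
have [|||||igg _] := @dominated_convergence _ _ _ mu per measurable_period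
  (fun n s => (f s * arc_kernel d n (s - x))%:E) (fun s => (g s)%:E)
  (fun s => (`|f s|)%:E).
- move=> n; apply/measurable_EFinP; apply: measurable_funM => //.
  exact: continuous_measurable_period.
- by apply/measurable_EFinP; exact: measurable_funM.
(* At the two end points of the arc [y = 1 / 2], and the kernels do not tend to the indicator. *)
- exists [set x - d; x + d]; split.
  + by apply: measurableU; exact: measurable_set1.
  + apply: countable_lebesgue_measure0; apply: finite_set_countable.
    by rewrite finite_setU; split; exact: finite_set1.
  + move=> s /= /not_implyP[ps ncv].
    apply: contrapT => /not_orP[sd1 sd2]; apply: ncv.
    have hs : `|s - x| < 2 * pi - d.
      by move: ps; rewrite /period/= in_itv/= => /andP[? ?]; rewrite ltr_norml; apply/andP; split; lra.
    have [c1 c2] := ltr_cos_norm dpi hs.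
    apply: cvg_EFin; first exact: nearW.
    apply: cvgM; first exact: cvg_cst.
    have [lt|] := ltP `|s - x| d.
      rewrite indicE mem_set ?ballE//; apply: cvg_arc_kernel1; exact: c1.
    rewrite le_eqVlt => /predU1P[eqd|lt].
      exfalso; have [sx|sx] := leP x s.
        by apply: sd2; rewrite eqd ger0_norm ?subr_ge0//; lra.
      by apply: sd1; rewrite eqd ltr0_norm ?subr_lt0//; lra.
    rewrite indicE memNset; last by rewrite ballE; apply/negP; rewrite -leNgt ltW.
    apply: cvg_arc_kernel0; exact: c2.
- by rewrite -/(circle_integrable (fun s => `|f s|)); exact: circle_integrable_norm.
- apply: aeW => s n _; rewrite lee_fin normrM ler_piMr//.
  by have /andP[k0 k1] := arc_kernel_itv d n (s - x); rewrite ger0_norm.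
move=> cv; rewrite /mean; apply: cvgM; first exact: cvg_cst.
rewrite /circle_int /Rintegral.
have -> : (\int[mu]_(s in ball x d) (f s)%:E = \int[mu]_(s in per) (g s)%:E)%E.
  have Bp : ball x d `<=` per.
    move=> s; rewrite ballE ltr_norml => /andP[? ?]; rewrite /period/= in_itv/=.
    by apply/andP; split; lra.
  rewrite -{1}(setIidr Bp) integral_mkcondr; apply: eq_integral => s _.
  rewrite /g /patch indicE; case: ifPn => _; first by rewrite mulr1.
  by rewrite mulr0.
apply: fine_cvg; rewrite fineK//; exact: integrable_fin_num.
Qed.

Lemma fcos_cst1 n : fcos (fun=> 1 : R) n = (n == 0%N)%:R.
Proof. by rewrite -mean_cos; apply: eq_mean => s _; rewrite mul1r. Qed.

Lemma fsin_cst1 n : fsin (fun=> 1 : R) n = 0.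
Proof. by rewrite -(mean_sin n); apply: eq_mean => s _; rewrite mul1r. Qed.

(** This is the convolution limit for the constant [1] at [x = pi]. Translating a cosine polynomial
    does not change its mean, to which only frequency [0] contributes. *)
Lemma cvg_mean_arc_kernel (d : R) : 0 < d < pi ->
  mean (arc_kernel d n) @[n --> \oo] --> d / pi.
Proof.
move=> dpi; have pg := @pi_gt0 R; have [d0 dp] := andP dpi.
have i1 : circle_integrable (fun=> 1 : R) by exact: circle_integrable_cst.
have xd : d < pi < 2 * pi - d by apply/andP; split; lra.
have := cvg_arc_conv i1 dpi xd.
have -> : (2 * pi)^-1 * (\int[mu]_(s in ball pi d) 1)%R = d / pi.
  rewrite Rintegral_cst; last exact: measurable_ball.
  rewrite /= lebesgue_measure_ball//=; last exact: ltW.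
  have pin0 : pi != 0 :> R by rewrite gt_eqF.
  by move: (@pi R) pin0 => x xn0; rewrite -[d *+ 2]mulr_natl; field.
suff -> : (fun n => mean (fun s => 1 * arc_kernel d n (s - pi))) =
  (fun n => mean (arc_kernel d n)) by [].
apply/funext => n.
have [c [N h]] : cospoly (arc_kernel d n).
  apply: eq_cospoly (cospoly_horner (arc_poly d n)) => s.
  by rewrite arc_kernelE.
have e x : mean (fun s => 1 * arc_kernel d n (s - x)) =
    \sum_(0 <= k < N) c k * (k == 0%N)%:R.
  under eq_mean do rewrite (h N)//.
  rewrite mean_conv//; apply: eq_bigr => k _.
  rewrite /trig_mode fcos_cst1 fsin_cst1 mulr0 mul0r addr0.
  by case: k => [|k]; [rewrite mul0r cos0 mulr1|rewrite !(mulr0, mul0r)].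
by rewrite e -(e 0); apply: eq_mean => s _; rewrite mul1r subr0.
Qed.

Definition arc_average f (d x : R) : R := (2 * d)^-1 * (\int[mu]_(s in ball x d) f s)%R.

(** The centres whose arcs of half-length [d] stay inside one period. *)
Definition arc_domain (d : R) : set R := `]d, (2 * pi - d)[%classic.

Section fixed_function.
Variables (f : R -> R) (S : R).
Hypotheses (qf : square_integrable f) (f0 : fcos f 0 = 0).
Hypothesis fS :
  forall N, \sum_(0 <= n < N) (fcos f n ^+ 2 + fsin f n ^+ 2) <= S.

Let intf := square_integrable_integrable qf.

Let S0 : 0 <= S. Proof. by apply: le_trans (fS 0%N); rewrite big_geq. Qed.

(** Divided by the mean [J n] of the kernel, the convolutions have square integral at most [4 pi S]
    uniformly in [n], by [conv_cospoly_bound], and they tend to the arc average; Fatou's lemma keeps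
    the bound. *)
Lemma arc_average_bound (d : R) : 0 < d < pi ->
  measurable_fun (arc_domain d) (arc_average f d) /\
  (\int[mu]_(x in arc_domain d) (arc_average f d x ^+ 2)%:E
    <= (4 * pi * S)%:E)%E.
Proof.
move=> dpi; have pg := @pi_gt0 R; have [d0 dp] := andP dpi.
pose F n x := mean (fun s => f s * arc_kernel d n (s - x)).
pose J n := mean (arc_kernel d n).
pose D := arc_domain d.
have Dper : D `<=` per.
  by move=> s; rewrite /D /arc_domain /period/= !in_itv/= => /andP[? ?]; apply/andP; split; lra.
have cp n : cospoly (arc_kernel d n).
  apply: eq_cospoly (cospoly_horner (arc_poly d n)) => s.
  by rewrite arc_kernelE.
have k0 n s : 0 <= arc_kernel d n s by have /andP[] := arc_kernel_itv d n s.
have FB n : continuous (F n) /\ mean (fun x => F n x ^+ 2) <= 2 * J n ^+ 2 * S.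
  exact: (conv_cospoly_bound qf f0 fS (cp n) (k0 n)).
have FJ x : D x -> F n x / J n @[n --> \oo] --> arc_average f d x.
  move=> Dx.
  have -> : arc_average f d x = (2 * pi)^-1 * (\int[mu]_(s in ball x d) f s)%R / (d / pi).
    have pin0 : pi != 0 :> R by rewrite gt_eqF.
    have dn0 : d != 0 by rewrite gt_eqF.
    rewrite /arc_average; move: (Rintegral _ _ _) => I.
    by move: (@pi R) pin0 => y yn0; field; rewrite ?dn0 ?yn0.
  apply: cvgM; first by apply: cvg_arc_conv; move: Dx; rewrite /D /arc_domain/= in_itv.
  apply: cvgV; first by rewrite gt_eqF// divr_gt0.
  exact: cvg_mean_arc_kernel.
have cFJ n : continuous (fun x => F n x / J n).
  by move=> x; apply: cvgM; [exact: (FB n).1|exact: cvg_cst].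
have mFJ n : measurable_fun D (fun x => F n x / J n).
  by apply: measurable_funTS; exact: continuous_measurable_fun.
have mD : measurable D by exact: measurable_itv.
have mG : measurable_fun D (arc_average f d).
  exact: (measurable_fun_cvg mFJ).
split=> //.
apply: (@bounded_fatou D (fun n x => (F n x / J n) ^+ 2)) => //.
- by move=> n; apply: measurable_funX.
- by apply: measurable_funX.
- by move=> n x _; exact: sqr_ge0.
- by move=> x _; exact: sqr_ge0.
- by apply: aeW => x Dx; under eq_fun do rewrite expr2; rewrite expr2; apply: cvgM; exact: FJ.
move=> n; have cFJ2 : continuous (fun x => (F n x / J n) ^+ 2).
  by move=> x; under eq_fun do rewrite expr2; apply: cvgM; exact: cFJ.
apply: (@le_trans _ _ (\int[mu]_(x in per) ((F n x / J n) ^+ 2)%:E)%E).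
  apply: ge0_subset_integral => //.
  - by apply/measurable_EFinP; exact: continuous_measurable_period.
  - by move=> x _; rewrite lee_fin sqr_ge0.
rewrite circle_intE; last exact: continuous_circle_integrable.
rewrite lee_fin meanE.
have -> : 4 * pi * S = 2 * pi * (2 * S) by ring.
rewrite ler_wpM2l ?(ltW twopi_gt0)//.
under eq_mean do rewrite exprMn mulrC.
rewrite meanZl; last first.
  apply: continuous_circle_integrable => x; under eq_fun do rewrite expr2.
  by apply: cvgM; exact: (FB n).1.
(* When [J n = 0] the quotient is [0] by the convention on inverses. *)
have [J0|J0] := eqVneq (J n) 0.
  by rewrite J0 invr0 expr0n/= mul0r mulr_ge0.
rewrite exprVn mulrC ler_pdivrMr ?exprn_even_gt0//.
by apply: le_trans (FB n).2 _; rewrite mulrAC.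
Qed.

(* Fatou's lemma along arcs shrinking to a point, with Lebesgue's
   differentiation theorem. *)
Lemma parseval_le : circle_int (fun s => f s ^+ 2) <= 4 * pi * S.
Proof.
have pg := @pi_gt0 R; have pg2 := @pi_ge2 R.
have mf := circle_integrable_measurable intf.
pose d (n : nat) : R := n.+1%:R^-1.
have d0 n : 0 < d n by rewrite invr_gt0 ltr0n.
have d1 n : d n <= 1 by rewrite invf_le1 ?ltr0n// ler1n.
have dpi n : 0 < d n < pi by rewrite d0/=; apply: le_lt_trans (d1 n) _; lra.
have cvd : d n @[n --> \oo] --> (0 : R) by exact: cvg_harmonic.
pose D n := arc_domain (d n).
have mD n : measurable (D n) by exact: measurable_itv.
have Dper n : D n `<=` per.
  move=> s; rewrite /D /arc_domain /period/= !in_itv/= => /andP[? ?].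
  by have := d0 n; move=> ?; apply/andP; split; lra.
(* Extension by zero puts all the averages on one domain; every interior point of the period lies in
   [D n] for large [n]. *)
pose H n := (fun x => arc_average f (d n) x ^+ 2) \_ (D n).
have H0 n x : 0 <= H n x by rewrite /H /patch; case: ifP => _ //; exact: sqr_ge0.
rewrite -lee_fin -circle_intE; last by case: qf.
apply: (@bounded_fatou per H) => //.
- move=> n; apply: measurable_funTS.
  have h : measurable_fun (D n) (fun x => arc_average f (d n) x ^+ 2).
    by apply: measurable_funX; exact: (arc_average_bound (dpi n)).1.
  exact: ((measurable_restrictT _ (mD n)).1 h).
- exact: measurable_funX.
- by move=> s _; exact: sqr_ge0.
- have locf : locally_integrable setT (f \_ per) by exact: integrable_locally_restrict.
  (* The end points of the period lie in no [D n]. *)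
  have ends : {ae mu, forall x, ~ [set 0; 2 * pi] x}.
    exists [set 0; 2 * pi]; split.
    + by apply: measurableU; exact: measurable_set1.
    + apply: countable_lebesgue_measure0; apply: finite_set_countable.
      by rewrite finite_setU; split; exact: finite_set1.
    + by move=> s /= /contrapT.
  move: (lebesgue_differentiation locf) ends.
  apply: filterS2; first exact: (ae_filter_ringOfSetsType mu).
  move=> x /= lx /not_orP[x0 x2] px.
  have /andP[x0' x2'] : 0 < x < 2 * pi.
    move: px; rewrite /period/= in_itv/= !le_eqVlt => /andP[/predU1P[|->]].
      by move=> ?; exfalso; apply: x0.
    by case/predU1P.
  have shr y : nicely_shrinking y (fun n => ball y (d n)).
    split; first by move=> n; exact: measurable_ball.
    exists (1, fun n => PosNum (d0 n)); split => //=.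
      by move=> n; exact: subset_refl.
    by move=> n; rewrite mul1e.
  have := nice_lebesgue_differentiation shr locf lx.
  rewrite patchE mem_set// => cv.
  have near_d e : 0 < e -> \forall n \near \oo, d n < e.
    by move=> e0; apply: (cvgr_lt (0 : R)).
  have hx : \forall n \near \oo, D n x.
    near=> n; rewrite /D /arc_domain/= in_itv/=.
    have ? : d n < x by near: n; exact: near_d.
    have ? : d n < 2 * pi - x by near: n; apply: near_d; rewrite subr_gt0.
    by apply/andP; split; lra.
  have cvA : arc_average f (d n) x @[n --> \oo] --> f x.
    move/fine_cvg: cv; apply: cvg_trans; apply: near_eq_cvg.
    near=> n.
    have Dnx : D n x by near: n.
    move: Dnx; rewrite /D /arc_domain/= in_itv/= => /andP[? ?].
    rewrite /arc_average /Rintegral.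
    have -> : (\int[mu]_(y in ball x (d n)) (f y)%:E =
        \int[mu]_(y in ball x (d n)) ((f \_ per) y)%:E)%E.
      apply: eq_integral => y /set_mem; rewrite /ball/= => yx.
      rewrite patchE mem_set// /period/= in_itv/=.
      by move: yx; rewrite ltr_norml => /andP[? ?]; apply/andP; split; lra.
    rewrite lebesgue_measure_ball ?(ltW (d0 n))// -[d n *+ 2]mulr_natl.
    rewrite inver; case: ifPn => [/eqP|dn0].
      by move=> /eqP; rewrite mulf_eq0 pnatr_eq0/= gt_eqF.
    rewrite fineM//.
    apply: integrable_fin_num; first exact: measurable_ball.
    apply: (@integrableS _ _ _ mu setT) => //; first exact: measurable_ball.
    have -> : (fun y => ((f \_ per) y)%:E) = (EFin \o f) \_ per.
      by apply/funext => y; rewrite !patchE; case: ifP.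
    apply/integrable_restrict => //; rewrite setTI; exact: intf.
  suff : (arc_average f (d n) x ^+ 2) @[n --> \oo] --> f x ^+ 2.
    apply: cvg_trans; apply: near_eq_cvg; near=> n.
    by rewrite /H patchE mem_set//; near: n.
  under eq_fun do rewrite expr2; rewrite expr2; exact: cvgM.
- move=> n; apply: le_trans (arc_average_bound (dpi n)).2.
  rewrite -/(D n) -[in leRHS](setIidr (@Dper n)) integral_mkcondr.
  rewrite le_eqVlt; apply/orP; left; apply/eqP; apply: eq_integral => x _.
  by rewrite /H !patchE; case: ifP.
Unshelve. all: by end_near. Qed.

End fixed_function.

End ParsevalInequality.

(** * Fourier multipliers and Sobolev norms *)

Section TrigSeries.
Context {R : realType}.
Local Notation mu := (@lebesgue_measure R).
Local Notation per := (@period R).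
Implicit Types (f g h : R -> R) (a b : nat -> R).
#[local] Hint Extern 0 (measurable period) => exact: measurable_period : core.

Lemma ler_norm_fcos f n : circle_integrable f ->
  `|fcos f n| <= mean (fun s => `|f s|).
Proof.
move=> intf; apply: le_trans (ler_norm_mean (integrable_fcos n intf)) _.
apply: le_mean.
- by apply: circle_integrable_norm; exact: integrable_fcos.
- exact: circle_integrable_norm.
- by move=> s _; rewrite normrM ler_piMr// cos_max.
Qed.

Lemma ler_norm_fsin f n : circle_integrable f ->
  `|fsin f n| <= mean (fun s => `|f s|).
Proof.
move=> intf; apply: le_trans (ler_norm_mean (integrable_fsin n intf)) _.
apply: le_mean.
- by apply: circle_integrable_norm; exact: integrable_fsin.
- exact: circle_integrable_norm.
- by move=> s _; rewrite normrM ler_piMr// sin_max.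
Qed.

Definition abs_summable a b := cvgn (series (fun n => `|a n| + `|b n|)).

Definition trig_series a b (s : R) := tsum (fun n => trig_mode a b n s).

Lemma trig_mode_le a b n s : `|trig_mode a b n s| <= `|a n| + `|b n|.
Proof.
apply: le_trans (ler_normD _ _) _; apply: lerD; rewrite normrM ler_piMr//.
- exact: cos_max.
- exact: sin_max.
Qed.

Lemma continuous_trig_series a b : abs_summable a b -> continuous (trig_series a b).
Proof.
move=> ab; apply: (continuous_tsum ab) => [s n|n]; first exact: trig_mode_le.
exact: continuous_trig_mode.
Qed.

Lemma periodic_trig_series a b : periodic (trig_series a b).
Proof.
move=> s; rewrite /trig_series; congr tsum; apply/funext => n.
by rewrite /trig_mode mulrDr cosDnat2pi sinDnat2pi.
Qed.

Lemma mean_mul_trig_series h a b : circle_integrable h -> abs_summable a b ->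
  mean (fun s => h s * trig_series a b s) =
  tsum (fun n => a n * fcos h n + b n * fsin h n).
Proof.
move=> inth ab.
have ct := continuous_trig_series ab.
pose M n := `|a n| + `|b n|.
have inthn := circle_integrable_norm inth.
have cTh N : circle_integrable (fun s => h s * trig_poly a b N s).
  have := circle_integrable_sum N (fun n => integrable_mul_trig_mode a b n inth).
  by under eq_fun do rewrite -mulr_sumr.
have cT : circle_integrable (fun s => h s * trig_series a b s).
  apply: (@circle_integrable_bounded _ (tsum M)) => //.
    exact: continuous_measurable_period.
  by move=> s _; apply: ler_norm_tsum => // n; exact: trig_mode_le.
suff : series (fun n => a n * fcos h n + b n * fsin h n) N @[N --> \oo] -->
    mean (fun s => h s * trig_series a b s) by move=> /cvg_lim <-.
have tail0 : mean (fun s => `|h s|) * (tsum M - series M N) @[N --> \oo] --> (0 : R).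
  rewrite -(mulr0 (mean (fun s => `|h s|))) -(subrr (tsum M)).
  by apply: cvgM; [exact: cvg_cst|apply: cvgB => //; exact: cvg_cst].
apply/cvgrPdist_le => e e0.
have [N0 _ HN0] := (cvgrPdist_le _ _).1 tail0 e e0.
exists N0 => // N /HN0; rewrite /= sub0r normrN => hN.
apply: le_trans (le_trans (ler_norm _) hN).
rewrite /series/= -mean_mul_trig_poly// -meanB//.
apply: le_trans (ler_norm_mean _) _; first exact: circle_integrableB.
rewrite [leRHS]mulrC -meanZl//; apply: le_mean.
- by apply: circle_integrable_norm; exact: circle_integrableB.
- exact: circle_integrableZl.
move=> s _; rewrite -mulrBr normrM mulrC; apply: ler_wpM2r => //.
by apply: tsum_tail => // n; exact: trig_mode_le.
Qed.

Lemma tsum_delta n (x : R) : tsum (fun k => if k == n then x else 0) = x.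
Proof.
apply/cvg_lim => //; apply: cvg_near_cst; exists n.+1 => // N /= nN.
rewrite /series/= (bigD1_seq n)/= ?mem_index_iota ?iota_uniq//.
by rewrite eqxx big1 ?addr0// => k /negbTE ->.
Qed.

Lemma trig_series_fcos a b n : abs_summable a b -> a 0%N = 0 ->
  fcos (trig_series a b) n = a n / 2.
Proof.
move=> ab a0; rewrite /fcos; under eq_mean do rewrite mulrC.
rewrite mean_mul_trig_series//; last exact: circle_integrable_cos.
rewrite -[RHS](tsum_delta n); congr tsum; apply/funext => k.
rewrite /fcos /fsin mean_cos_cos mean_cos_sin mulr0 addr0.
have [->|kn] := eqVneq k n; last first.
  have -> : (n + k == 0)%N = false by lia.
  by rewrite addr0 mul0r mulr0.
by case: n => [|n]; [rewrite a0 !mul0r|rewrite addSn/= add0r mul1r].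
Qed.

Lemma trig_series_fsin a b n : abs_summable a b -> b 0%N = 0 ->
  fsin (trig_series a b) n = b n / 2.
Proof.
move=> ab b0; rewrite /fsin; under eq_mean do rewrite mulrC.
rewrite mean_mul_trig_series//; last exact: circle_integrable_sin.
rewrite -[RHS](tsum_delta n); congr tsum; apply/funext => k.
rewrite /fcos /fsin mean_sin_cos mean_sin_sin mulr0 add0r.
have [->|kn] := eqVneq k n; last first.
  have -> : (n + k == 0)%N = false by lia.
  by rewrite subr0 mul0r mulr0.
by case: n => [|n]; [rewrite b0 !mul0r|rewrite addSn/= subr0 mul1r].
Qed.

(** Parseval's inequality with [S = 0], applied to the difference. *)
Lemma ae_eq_circle_fourier f g : square_integrable f -> square_integrable g ->
  (forall n, fcos f n = fcos g n) -> (forall n, fsin f n = fsin g n) ->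
  ae_eq_circle f g.
Proof.
move=> qf qg fgc fgs.
have qfg := square_integrableB qf qg.
have intf := square_integrable_integrable qf.
have intg := square_integrable_integrable qg.
have hc n : fcos (fun s => f s - g s) n = 0 by rewrite fcosB// fgc subrr.
have hs n : fsin (fun s => f s - g s) n = 0 by rewrite fsinB// fgs subrr.
have := @parseval_le _ _ 0 qfg (hc 0%N).
rewrite mulr0 => /(_ _) h.
have {h} h : circle_int (fun s => (f s - g s) ^+ 2) = 0.
  apply/eqP; rewrite eq_le circle_int_ge0 ?andbT; last by move=> s _; exact: sqr_ge0.
  by apply: h => N; rewrite big1// => n _; rewrite hc hs expr0n/= addr0.
have [mfg ifg] := qfg.
have := circle_intE ifg; rewrite h => h'.
have mfg2 : measurable_fun per (fun s => ((f s - g s) ^+ 2)%:E).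
  by apply/measurable_EFinP; exact: measurable_funX.
have : (\int[mu]_(s in per) `|((f s - g s) ^+ 2)%:E| = 0)%E.
  rewrite -[RHS]h'; apply: eq_integral => s _.
  by rewrite gee0_abs// lee_fin sqr_ge0.
move/(ae_eq_integral_abs mu measurable_period mfg2).
case=> N [mN N0 subN]; exists N; split=> //; apply: subset_trans subN.
apply: subsetC => s /= + ps => /(_ ps) [] /eqP.
by rewrite sqrf_eq0 subr_eq0 => /eqP.
Qed.

Lemma ae_eq_fcos f g n : measurable_fun per f -> measurable_fun per g ->
  ae_eq_circle f g -> fcos f n = fcos g n.
Proof.
move=> mf mg fg; have mc : measurable_fun per (fun s => cos (n%:R * s)).
  by apply: continuous_measurable_period; exact: continuous_cosM.
apply: ae_eq_mean; [exact: measurable_funM|exact: measurable_funM|].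
move: fg; apply: filterS; first exact: (ae_filter_ringOfSetsType mu).
by move=> s /= + ps => /(_ ps) ->.
Qed.

Lemma ae_eq_fsin f g n : measurable_fun per f -> measurable_fun per g ->
  ae_eq_circle f g -> fsin f n = fsin g n.
Proof.
move=> mf mg fg; have mc : measurable_fun per (fun s => sin (n%:R * s)).
  by apply: continuous_measurable_period; exact: continuous_sinM.
apply: ae_eq_mean; [exact: measurable_funM|exact: measurable_funM|].
move: fg; apply: filterS; first exact: (ae_filter_ringOfSetsType mu).
by move=> s /= + ps => /(_ ps) ->.
Qed.

End TrigSeries.

(** * Multipliers in terms of cosine and sine coefficients *)

Section Operators.
Context {R : realType}.
Local Notation per := (@period R).
Implicit Types (f g : R -> R).

Lemma fourier_nat f n : fourier f (Posz n) = Complex (fcos f n) (- fsin f n).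
Proof. by []. Qed.

Lemma fourier_negz f n : circle_integrable f ->
  fourier f (Negz n) = Complex (fcos f n.+1) (fsin f n.+1).
Proof.
move=> intf; have h (s : R) : (Negz n)%:~R * s = - (n.+1%:R * s).
  by rewrite NegzE mulrNz mulNr.
rewrite /fourier; congr Complex.
  by apply: eq_mean => s _; rewrite h cosN.
under eq_mean do rewrite h sinN mulrN -mulN1r.
by rewrite meanZl ?mulN1r ?opprK//; exact: integrable_fsin.
Qed.

(** The coefficients of a real function at opposite frequencies are conjugate and the symbol is
    even, so comparing the frequencies [n >= 0] is enough. *)
Lemma is_LambdaP (a : R) f g : a != 0 -> is_Lambda a f g <->
  [/\ L2 f, L2 g, forall n, fcos g n = n%:R `^ a * fcos f n &
      forall n, fsin g n = n%:R `^ a * fsin f n].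
Proof.
move=> a0; split.
  case=> Lf Lg h; split=> // n; have := h (Posz n); rewrite !fourier_nat/=;
  case; rewrite !mul0r subr0 ?addr0 => hc hs //.
  by move/eqP: hs; rewrite mulrN eqr_opp => /eqP.
case=> Lf Lg hc hs; split=> // -[n|n].
  by rewrite !fourier_nat hc hs /=; congr Complex; ring.
have [_ /square_integrable_integrable intf] := (L2P f).1 Lf.
have [_ /square_integrable_integrable intg] := (L2P g).1 Lg.
by rewrite !fourier_negz// hc hs; congr Complex; ring.
Qed.

Lemma is_HilbertP f g : is_Hilbert f g <->
  [/\ L2 f, L2 g, mean g = 0, forall n, fcos g n.+1 = - fsin f n.+1 &
      forall n, fsin g n.+1 = fcos f n.+1].
Proof.
split.
  case=> Lf Lg h; split=> //.
  - by have := h 0; rewrite !fourier_nat sgz0 mulr0 mul0r => -[+ _]; rewrite fcos0.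
  - by move=> n; have := h (Posz n.+1); rewrite !fourier_nat/=; case=> + _; rewrite /= => ->; ring.
  - by move=> n; have := h (Posz n.+1); rewrite !fourier_nat/=; case=> _ /eqP; rewrite eqr_oppLR => /eqP ->; ring.
case=> Lf Lg g0 hc hs; split=> // -[[|n]|n].
- by rewrite !fourier_nat sgz0 mulr0 mul0r fcos0 g0 fsin0 oppr0.
- by rewrite !fourier_nat hc hs/=; congr Complex; ring.
have [_ /square_integrable_integrable intf] := (L2P f).1 Lf.
have [_ /square_integrable_integrable intg] := (L2P g).1 Lg.
by rewrite !fourier_negz// hc hs; congr Complex; ring.
Qed.

End Operators.

(** * Weak derivatives and Fourier coefficients *)

Section WeakDerivative.
Context {R : realType}.
Local Notation per := (@period R).
Implicit Types (f g phi : R -> R) (a b : nat -> R).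

Lemma continuous_derivable phi : (forall s, derivable phi s 1) -> continuous phi.
Proof.
by move=> dphi s; apply: differentiable_continuous; apply/derivable1_diffP.
Qed.

Lemma is_derive_derive1 phi : (forall s, derivable phi s 1) ->
  forall s : R, is_derive s 1 phi (derive1 phi s).
Proof. by move=> dphi s; rewrite derive1E; exact/derivableP. Qed.

Lemma derive1_cosM (c : R) : derive1 (fun s => cos (c * s)) = (fun s => - (c * sin (c * s))).
Proof.
apply/funext => s; rewrite derive1E; have h := is_derive_cosM c s.
by rewrite derive_val.
Qed.

Lemma derive1_sinM (c : R) : derive1 (fun s => sin (c * s)) = (fun s => c * cos (c * s)).
Proof.
apply/funext => s; rewrite derive1E; have h := is_derive_sinM c s.
by rewrite derive_val.
Qed.

Lemma periodic_cosM n : periodic (fun s : R => cos (n%:R * s)).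
Proof. by move=> s; rewrite mulrDr cosDnat2pi. Qed.

Lemma periodic_sinM n : periodic (fun s : R => sin (n%:R * s)).
Proof. by move=> s; rewrite mulrDr sinDnat2pi. Qed.

Lemma weak_derivative_fourier f g : is_weak_derivative f g ->
  (forall n, fcos g n = n%:R * fsin f n) /\
  (forall n, fsin g n = - (n%:R * fcos f n)).
Proof.
case=> Lf Lg h.
have [_ /square_integrable_integrable intf] := (L2P f).1 Lf.
split=> n.
  have /(_ _ _) := h (fun s => cos (n%:R * s)) (periodic_cosM n).
  rewrite derive1_cosM => /(_ _ _) e.
  have {e} : circle_int (fun s => f s * - (n%:R * sin (n%:R * s))) =
      - circle_int (fun s => g s * cos (n%:R * s)).
    apply: e => [s|s].
      by case: (is_derive_cosM n%:R s).
    by apply: cvgN; apply: cvgM; [exact: cvg_cst|exact: continuous_sinM].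
  under eq_circle_int do rewrite mulrN mulrCA -mulNr.
  rewrite circle_intZl; last exact: integrable_fsin.
  by rewrite /fcos /fsin /mean mulNr => /oppr_inj <-; rewrite mulrCA.
have /(_ _ _) := h (fun s => sin (n%:R * s)) (periodic_sinM n).
rewrite derive1_sinM => /(_ _ _) e.
have {e} : circle_int (fun s => f s * (n%:R * cos (n%:R * s))) =
    - circle_int (fun s => g s * sin (n%:R * s)).
  apply: e => [s|s].
    by case: (is_derive_sinM n%:R s).
  by apply: cvgM; [exact: cvg_cst|exact: continuous_cosM].
under eq_circle_int do rewrite mulrCA.
rewrite circle_intZl; last exact: integrable_fcos.
by rewrite /fcos /fsin /mean => /eqP; rewrite -eqr_oppLR => /eqP <-; rewrite mulrN mulrCA.
Qed.

(** Integration by parts: the derivative of [phi] times a trigonometric factor has integral [0] by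
    periodicity. *)
Lemma fourier_derive1 phi : periodic phi -> (forall s, derivable phi s 1) ->
  continuous (derive1 phi) ->
  (forall n, fcos (derive1 phi) n = n%:R * fsin phi n) /\
  (forall n, fsin (derive1 phi) n = - (n%:R * fcos phi n)).
Proof.
move=> pphi dphi cd; have cphi := continuous_derivable dphi.
have dE := is_derive_derive1 dphi.
have iphi := continuous_circle_integrable cphi.
have idphi := continuous_circle_integrable cd.
have p2 : phi (2 * pi) = phi 0 by rewrite -[2 * pi]add0r pphi.
split=> n.
  pose F s := phi s * cos (n%:R * s).
  pose dF s := derive1 phi s * cos (n%:R * s) - n%:R * (phi s * sin (n%:R * s)).
  have dFE (s : R) : is_derive s 1 F (dF s).
    have h1 := is_derive_cosM n%:R s; have h2 := dE s.
    by apply: is_derive_eq; rewrite /dF /GRing.scale/=; ring.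
  have cdF : continuous dF.
    move=> s; apply: cvgB; first by apply: cvgM; [exact: cd|exact: continuous_cosM].
    apply: cvgM; first exact: cvg_cst.
    by apply: cvgM; [exact: cphi|exact: continuous_sinM].
  have := circle_int_derive cdF dFE.
  rewrite /F mulr0 cos0 p2 -[_ * (2 * pi)]add0r cosDnat2pi cos0 subrr.
  rewrite circle_intB; [|exact: integrable_fcos|by apply: circle_integrableZl; exact: integrable_fsin].
  rewrite circle_intZl; last exact: integrable_fsin.
  by move/eqP; rewrite subr_eq0 /fcos /fsin /mean => /eqP ->; rewrite mulrCA.
pose F s := phi s * sin (n%:R * s).
pose dF s := derive1 phi s * sin (n%:R * s) + n%:R * (phi s * cos (n%:R * s)).
have dFE (s : R) : is_derive s 1 F (dF s).
  have h1 := is_derive_sinM n%:R s; have h2 := dE s.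
  by apply: is_derive_eq; rewrite /dF /GRing.scale/=; ring.
have cdF : continuous dF.
  move=> s; apply: cvgD; first by apply: cvgM; [exact: cd|exact: continuous_sinM].
  apply: cvgM; first exact: cvg_cst.
  by apply: cvgM; [exact: cphi|exact: continuous_cosM].
have := circle_int_derive cdF dFE.
rewrite /F mulr0 sin0 p2 -[_ * (2 * pi)]add0r sinDnat2pi sin0 subrr.
rewrite circle_intD; [|exact: integrable_fsin|by apply: circle_integrableZl; exact: integrable_fcos].
rewrite circle_intZl; last exact: integrable_fcos.
by move/eqP; rewrite addr_eq0 /fcos /fsin /mean => /eqP ->; rewrite mulrN mulrCA.
Qed.

Lemma L2_trig_series a b : abs_summable a b -> L2 (trig_series a b).
Proof.
move=> ab; apply/L2P; split; first exact: periodic_trig_series.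
by apply: continuous_square_integrable; exact: continuous_trig_series.
Qed.

(** The series is never differentiated term by term: pairing with [phi] turns both sides into series
    in the coefficients of [phi'] and of [phi], and these are compared by [fourier_derive1]. *)
Lemma weak_derivative_trig_series a b : abs_summable a b ->
  abs_summable (fun n => n%:R * b n) (fun n => - (n%:R * a n)) ->
  is_weak_derivative (trig_series a b)
    (trig_series (fun n => n%:R * b n) (fun n => - (n%:R * a n))).
Proof.
move=> ab dab; split; [exact: L2_trig_series|exact: L2_trig_series|].
move=> phi pphi dphi cd; have [h1 h2] := fourier_derive1 pphi dphi cd.
have iphi := continuous_circle_integrable (continuous_derivable dphi).
have idphi := continuous_circle_integrable cd.
rewrite !meanE -mulrN; congr (_ * _).
under eq_mean do rewrite mulrC; rewrite mean_mul_trig_series//.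
under [in RHS]eq_mean do rewrite mulrC; rewrite mean_mul_trig_series//.
rewrite -mulN1r -tsumZl; last first.
  have cM := cvg_seriesZl (k := mean (fun s => `|phi s|)) dab.
  refine (dominated_cvg_series cM _) => n.
  have c1 : `|fcos phi n| <= mean (fun s => `|phi s|) by exact: ler_norm_fcos.
  have c2 : `|fsin phi n| <= mean (fun s => `|phi s|) by exact: ler_norm_fsin.
  apply: le_trans (ler_normD _ _) _; rewrite mulrDr; apply: lerD;
    by rewrite normrM mulrC; apply: ler_wpM2r.
by congr tsum; apply/funext => n; rewrite h1 h2; ring.
Qed.

End WeakDerivative.

(** * Sobolev norms as weighted sums over the modes *)

Section SobolevNorm.
Context {R : realType}.
Local Notation per := (@period R).
Implicit Types (f g : R -> R) (a S : R).

Definition sobolev_sum a f N : R :=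
  \sum_(0 <= n < N) (n%:R `^ a) ^+ 2 * (fcos f n ^+ 2 + fsin f n ^+ 2).

(** Some [g] must be exhibited, since the infimum over an empty set is [+oo]; its norm is then
    bounded by Parseval's inequality. *)
Lemma Hnorm_le a f g S : a != 0 -> is_Lambda a f g ->
  (forall N, sobolev_sum a f N <= S) -> (Hnorm a f <= (Num.sqrt (4 * pi * S))%:E)%E.
Proof.
move=> a0 Lfg fS; have [Lf Lg hc hs] := (is_LambdaP f g a0).1 Lfg.
apply: (@le_trans _ _ (L2norm g)); first by apply: ereal_inf_lbound; exists g.
have [_ qg] := (L2P g).1 Lg.
rewrite L2norm_square_integrable// lee_fin; apply: ler_wsqrtr.
  apply: parseval_le => //; first by rewrite hc powR0// mul0r.
  move=> N; apply: le_trans (fS N); rewrite le_eqVlt; apply/orP; left; apply/eqP.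
  by apply: eq_bigr => n _; rewrite hc hs !exprMn; ring.
Qed.

(** Bessel's inequality for every candidate [g]. *)
Lemma Hnorm_ge a f N : a != 0 ->
  ((Num.sqrt (4 * pi * sobolev_sum a f N))%:E <= Hnorm a f)%E.
Proof.
move=> a0; apply: le_ereal_inf_tmp => _ [g /= Lfg <-].
have [Lf Lg hc hs] := (is_LambdaP f g a0).1 Lfg.
have [_ qg] := (L2P g).1 Lg.
rewrite L2norm_square_integrable// lee_fin; apply: ler_wsqrtr; rewrite meanE.
have g0 : fcos g 0 = 0 by rewrite hc powR0// mul0r.
have := bessel N qg g0 => h.
have -> : 4 * pi * sobolev_sum a f N = 2 * pi * (2 * sobolev_sum a f N) by ring.
apply: ler_wpM2l; first exact: (ltW twopi_gt0).
apply: le_trans h; apply: ler_wpM2l => //; apply: ler_sum => n _.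
by rewrite hc hs !exprMn mulrDr.
Qed.

Lemma Hnorm_fin_Lambda a f : (Hnorm a f < +oo)%E -> exists g, is_Lambda a f g.
Proof.
move=> h; apply: contrapT => /forallNP ng; move: h.
rewrite /Hnorm [X in ereal_inf X](_ : _ = set0) ?ereal_inf0 ?ltxx//.
by apply/seteqP; split=> // x [g /ng].
Qed.

Lemma Hnorm_ge0 a f : (0 <= Hnorm a f)%E.
Proof. by apply: le_ereal_inf_tmp => _ [g _ <-]; exact: L2norm_ge0. Qed.

End SobolevNorm.

(** * The nonlinearity in Fourier modes *)

Section Interaction.
Context {R : realType}.
Local Notation per := (@period R).
Implicit Types (f g h l : R -> R) (u v : bool -> nat -> R).

(* The boolean selects sine ([true]) or cosine ([false]) coefficients. *)
Definition modes f (b : bool) n : R := if b then fsin f n else fcos f n.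

Definition trig_factor (b : bool) n (s : R) : R :=
  if b then sin (n%:R * s) else cos (n%:R * s).

(** With [U k = u false k - i u true k], and [V] likewise from [v], these are the real part
    ([b = false]) and minus the imaginary part ([b = true]) of [(n + 2 j) U (n + j) conj (V j)], in
    accordance with [fourier f n = fcos f n - i fsin f n]. *)
Definition interaction (b : bool) u v n j : R := (n + j.*2)%:R *
  (if b then u true (n + j)%N * v false j - u false (n + j)%N * v true j
   else u false (n + j)%N * v false j + u true (n + j)%N * v true j).

Definition interaction_sum b u v n : R := tsum (interaction b u v n).

Lemma tsum_shift (phi : nat -> R) n : cvgn (series phi) ->
  let psi j := if (n <= j)%N then phi (j - n)%N else 0 in
  cvgn (series psi) /\ tsum psi = tsum phi.
Proof.
move=> cphi psi.
have e N : series psi (N + n)%N = series phi N.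
  rewrite /series/= (big_cat_nat (leq0n n) (leq_addl N n))/= big_nat big1 ?add0r.
    by rewrite -{1}(add0n n) big_addn addnK; apply: eq_bigr => i _; rewrite /psi leq_addl addnK.
  by move=> i /= iN; rewrite /psi leqNgt iN.
have cpsi : series psi N @[N --> \oo] --> tsum phi.
  rewrite -(cvg_shiftn n); under eq_fun do rewrite e.
  exact: cphi.
by split; [apply/cvg_ex; exists (tsum phi)|exact/cvg_lim].
Qed.

Lemma fcos_mul_cos l n j : circle_integrable l ->
  fcos (fun s => l s * cos (n%:R * s)) j = (fcos l (n + j) + fcos l (ndist n j)) / 2.
Proof.
move=> intl; rewrite /fcos; under eq_mean do rewrite -mulrA cosMcos mulrA mulrC mulrDr.
have h k := integrable_fcos k intl.
by rewrite meanZl ?meanD//; [rewrite mulrC|exact: circle_integrableD].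
Qed.

Lemma fsin_mul_sin l n j : circle_integrable l ->
  fsin (fun s => l s * sin (n%:R * s)) j = (fcos l (ndist n j) - fcos l (n + j)) / 2.
Proof.
move=> intl; rewrite /fsin /fcos; under eq_mean do rewrite -mulrA sinMsin mulrA mulrC mulrBr.
have h k := integrable_fcos k intl.
by rewrite meanZl ?meanB//; [rewrite mulrC|exact: circle_integrableB].
Qed.

Lemma mean_mul_sin_cos l n j : circle_integrable l ->
  mean (fun s => l s * (sin (n%:R * s) * cos (j%:R * s))) =
  (fsin l (n + j) + nsign n j * fsin l (ndist n j)) / 2.
Proof.
move=> intl; rewrite /fsin; under eq_mean do rewrite sinMcos mulrA mulrC mulrDr (mulrCA (l _)).
have h k := integrable_fsin k intl.
have h2 := circle_integrableZl (nsign n j) (h (ndist n j)).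
rewrite meanZl ?meanD ?meanZl//; last exact: circle_integrableD.
by rewrite mulrC.
Qed.

Lemma fcos_mul_sin l n j : circle_integrable l ->
  fcos (fun s => l s * sin (n%:R * s)) j =
  (fsin l (n + j) + nsign n j * fsin l (ndist n j)) / 2.
Proof.
move=> intl; rewrite -mean_mul_sin_cos//; apply: eq_mean => s _.
by rewrite mulrA.
Qed.

Lemma fsin_mul_cos l n j : circle_integrable l ->
  fsin (fun s => l s * cos (n%:R * s)) j =
  (fsin l (j + n) + nsign j n * fsin l (ndist j n)) / 2.
Proof.
move=> intl; rewrite -mean_mul_sin_cos//; apply: eq_mean => s _.
by rewrite -mulrA (mulrC (cos _)).
Qed.

Definition summable_modes u := abs_summable (u false) (u true).

Lemma ae_trig_series f : L2 f -> mean f = 0 -> summable_modes (modes f) ->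
  [/\ abs_summable (fun n => 2 * fcos f n) (fun n => 2 * fsin f n) &
  ae_eq_circle f (trig_series (fun n => 2 * fcos f n) (fun n => 2 * fsin f n))].
Proof.
move=> /L2P[_ qf] f0 sf.
have ab : abs_summable (fun n => 2 * fcos f n) (fun n => 2 * fsin f n).
  have := cvg_seriesZl (k := 2) sf; rewrite /abs_summable.
  suff -> : (fun j => 2 * (`|modes f false j| + `|modes f true j|)) =
    (fun n => `|2 * fcos f n| + `|2 * fsin f n|) by [].
  by apply/funext => n; rewrite !normrM (@ger0_norm _ 2)// mulrDr.
split=> //; apply: ae_eq_circle_fourier => //.
- by apply: continuous_square_integrable; exact: continuous_trig_series.
- by move=> n; rewrite trig_series_fcos//; [field|rewrite fcos0 f0 mulr0].
- by move=> n; rewrite trig_series_fsin//; [field|rewrite fsin0 mulr0].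
Qed.

(** Parseval's identity when one factor has summable coefficients: that factor may be replaced by
    its uniformly convergent Fourier series. *)
Lemma mean_mul_ae_series f (g : R -> R) : L2 f -> mean f = 0 ->
  summable_modes (modes f) -> circle_integrable g ->
  mean (fun s => g s * f s) =
  tsum (fun n => 2 * fcos f n * fcos g n + 2 * fsin f n * fsin g n).
Proof.
move=> Lf f0 sf intg; have [ab fE] := ae_trig_series Lf f0 sf.
have [_ [mf _]] := (L2P f).1 Lf.
have mg := circle_integrable_measurable intg.
rewrite -mean_mul_trig_series//; apply: ae_eq_mean.
- exact: measurable_funM.
- apply: measurable_funM => //; apply: continuous_measurable_period.
  exact: continuous_trig_series.
move: fE; case=> N [mN N0 subN]; exists N; split=> //; apply: subset_trans subN.
by apply: subsetC => s /= + ps => /(_ ps) ->.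
Qed.

Lemma ler_norm_lin2 (x y z w B : R) : `|z| <= B -> `|w| <= B ->
  `|2 * x * z + 2 * y * w| <= 2 * B * (`|x| + `|y|).
Proof.
move=> zB wB; apply: le_trans (ler_normD _ _) _.
rewrite !normrM (@ger0_norm _ 2)//.
have := ler_wpM2l (normr_ge0 x) zB; have := ler_wpM2l (normr_ge0 y) wB; lra.
Qed.

Section product.
Variables f h l d : R -> R.
Hypotheses (f0 : mean f = 0) (sf : summable_modes (modes f)).
Hypotheses (fh : is_Hilbert f h) (fl : is_Lambda 1 f l).
Hypothesis (fd : is_weak_derivative f d).

Let Lf : L2 f. Proof. by case: fh. Qed.
Let Lh : L2 h. Proof. by case: fh. Qed.
Let Ll : L2 l. Proof. by case: fl. Qed.
Let Ld : L2 d. Proof. by case: fd. Qed.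
Let il : circle_integrable l.
Proof. by have [_ /square_integrable_integrable] := (L2P l).1 Ll. Qed.
Let id' : circle_integrable d.
Proof. by have [_ /square_integrable_integrable] := (L2P d).1 Ld. Qed.

Let hE : [/\ mean h = 0, forall n, fcos h n = - fsin f n & forall n, fsin h n = fcos f n].
Proof.
have [_ _ h0 hc hs] := (is_HilbertP f h).1 fh; split=> // -[|n] //.
- by rewrite fcos0 h0 fsin0 oppr0.
- by rewrite fsin0 fcos0 f0.
Qed.

Let lE : (forall n, fcos l n = n%:R * fcos f n) /\ (forall n, fsin l n = n%:R * fsin f n).
Proof.
have [|_ _ hc hs] := (is_LambdaP f l _).1 fl; first exact: oner_neq0.
by split=> n; rewrite ?hc ?hs powRr1.
Qed.

Let dE := weak_derivative_fourier fd.

Let sh : summable_modes (modes h).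
Proof.
have [_ hc hs] := hE; rewrite /summable_modes /abs_summable.
suff -> : (fun n => `|modes h false n| + `|modes h true n|) =
  (fun n => `|modes f false n| + `|modes f true n|) by [].
by apply/funext => n; rewrite /modes hc hs normrN addrC.
Qed.

Lemma integrable_nonlinearity : circle_integrable (fun s => f s * l s - h s * d s).
Proof.
have [_ qf] := (L2P f).1 Lf; have [_ qh] := (L2P h).1 Lh.
have [_ ql] := (L2P l).1 Ll; have [_ qd] := (L2P d).1 Ld.
by apply: circle_integrableB; exact: square_integrableM.
Qed.

(** Up to the factor [n + j], the modes [n + j] of [f] are coefficients of the integrable function
    [l], hence bounded, and [n + 2 j <= 2 (n + j)]. The remaining factor is summable in [j]. *)
Lemma interaction_bound : exists B, forall b n j,
  `|interaction b (modes f) (modes f) n j| <= B * (`|fcos f j| + `|fsin f j|).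
Proof.
pose Bl := mean (fun s => `|l s|).
have c1 n : `|fcos l n| <= Bl by exact: ler_norm_fcos.
have c2 n : `|fsin l n| <= Bl by exact: ler_norm_fsin.
move: Bl c1 c2 => Bl c1 c2; have [lc ls] := lE.
have key n j (z : R) : (n + j)%:R * `|z| <= Bl -> (n + j.*2)%:R * `|z| <= 2 * Bl.
  move=> zB; apply: (@le_trans _ _ (2 * ((n + j)%:R * `|z|))); last by lra.
  rewrite mulrA -natrM; apply: ler_wpM2r => //; rewrite ler_nat; lia.
have kc n j : (n + j.*2)%:R * `|fcos f (n + j)| <= 2 * Bl.
  by apply: key; rewrite -(ger0_norm (ler0n _ (n + j))) -normrM -lc.
have ks n j : (n + j.*2)%:R * `|fsin f (n + j)| <= 2 * Bl.
  by apply: key; rewrite -(ger0_norm (ler0n _ (n + j))) -normrM -ls.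
exists (2 * Bl) => b n j; rewrite /interaction normrM (ger0_norm (ler0n _ _)).
case: b => /=.
  apply: (@le_trans _ _ ((n + j.*2)%:R * (`|fsin f (n + j)| * `|fcos f j| + `|fcos f (n + j)| * `|fsin f j|))).
    by apply: ler_wpM2l => //; rewrite -!normrM; exact: ler_normB.
  by rewrite mulrDr !mulrA mulrDr; apply: lerD; apply: ler_wpM2r.
apply: (@le_trans _ _ ((n + j.*2)%:R * (`|fcos f (n + j)| * `|fcos f j| + `|fsin f (n + j)| * `|fsin f j|))).
  by apply: ler_wpM2l => //; rewrite -!normrM; exact: ler_normD.
by rewrite mulrDr !mulrA mulrDr; apply: lerD; apply: ler_wpM2r.
Qed.

(* The terms where the derivative falls on the lower mode [i], respectively on
   the higher mode [n + i]. *)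
Let low (b : bool) n i : R := (i.*2)%:R *
  (if b then fsin f (n + i) * fcos f i - fcos f (n + i) * fsin f i
   else fcos f (n + i) * fcos f i + fsin f (n + i) * fsin f i).

Let high (b : bool) n i : R := 2 * (n + i)%:R *
  (if b then fsin f (n + i) * fcos f i - fcos f (n + i) * fsin f i
   else fcos f (n + i) * fcos f i + fsin f (n + i) * fsin f i).

Let cvg_interaction b n : cvgn (series (interaction b (modes f) (modes f) n)).
Proof.
have [B hB] := interaction_bound.
have cM := cvg_seriesZl (k := B) sf.
by refine (dominated_cvg_series cM _) => j; exact: hB.
Qed.

Let cvg_low b n : cvgn (series (low b n)).
Proof.
have [B hB] := interaction_bound.
have cM := cvg_seriesZl (k := B) sf.
refine (dominated_cvg_series cM _) => j; apply: le_trans (hB b n j).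
rewrite /low /interaction !normrM; apply: ler_wpM2r => //.
by rewrite !ger0_norm// ler_nat leq_addl.
Qed.

Let cvg_high b n : cvgn (series (high b n)).
Proof.
suff -> : high b n = (fun j => 2 * interaction b (modes f) (modes f) n j + -1 * low b n j).
  exact: (cvg_seriesD (cvg_seriesZl (k := 2) (@cvg_interaction b n))
    (cvg_seriesZl (k := -1) (@cvg_low b n))).
apply/funext => j; rewrite /interaction /low /high /modes.
by rewrite -!addnn !natrD; case: b; ring.
Qed.

(** Pairing with the series of [f] and of [h] leaves the coefficients of [l] and [d] at [n + j] and
    at [|n - j|]. The former combine into [high]. The latter cancel for [j < n], where both
    interacting frequencies are positive, and for [j >= n] give [low] with its index shifted by [n].
    The weights add up to [2 (n + j) + 2 j = 2 (n + 2 j)]. *)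
Lemma nonlinearity_modes b n :
  modes (fun s => f s * l s - h s * d s) b n =
  2 * interaction_sum b (modes f) (modes f) n.
Proof.
have [h0 hc hs] := hE; have [lc ls] := lE; have [dc ds] := dE.
have [_ qf] := (L2P f).1 Lf; have [_ qh] := (L2P h).1 Lh.
have [_ ql] := (L2P l).1 Ll; have [_ qd] := (L2P d).1 Ld.
have iw g : circle_integrable g -> circle_integrable (fun s => g s * trig_factor b n s).
  by move=> ig; case: b; [exact: integrable_fsin|exact: integrable_fcos].
have ilw := iw _ il; have idw := iw _ id'.
have [pc [e1 e2]] : cvgn (series (fun j => if (n <= j)%N then low b n (j - n)%N else 0)) /\
    (tsum (fun j => if (n <= j)%N then low b n (j - n)%N else 0) = tsum (low b n)) /\ True.
  by have [? ?] := tsum_shift n (@cvg_low b n).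
transitivity (mean (fun s => l s * trig_factor b n s * f s) - mean (fun s => d s * trig_factor b n s * h s)).
  rewrite -meanB.
  - rewrite /modes /fcos /fsin /trig_factor; case: b {iw ilw idw pc e1} => /=; apply: eq_mean => s _; ring.
  - have := iw _ (square_integrableM qf ql).
    by congr circle_integrable; apply/funext => s; ring.
  - have := iw _ (square_integrableM qh qd).
    by congr circle_integrable; apply/funext => s; ring.
rewrite !mean_mul_ae_series//.
have cser g k (L : L2 g) (g0 : mean g = 0) (sg : summable_modes (modes g)) :
    circle_integrable k ->
    cvgn (series (fun j => 2 * fcos g j * fcos k j + 2 * fsin g j * fsin k j)).
  move=> ik; have cM := cvg_seriesZl (k := 2 * mean (fun s => `|k s|)) sg.
  refine (dominated_cvg_series cM _) => j.
  have k1 : `|fcos k j| <= mean (fun s => `|k s|) by exact: ler_norm_fcos.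
  have k2 : `|fsin k j| <= mean (fun s => `|k s|) by exact: ler_norm_fsin.
  exact: ler_norm_lin2.
rewrite -tsumB; [|exact: cser|exact: cser].
transitivity (tsum (fun j => high b n j +
    (if (n <= j)%N then low b n (j - n)%N else 0))).
  congr tsum; apply/funext => j; rewrite hc hs /trig_factor /high /low.
  case: b {iw ilw idw pc e1} => /=.
    rewrite !fcos_mul_sin// !fsin_mul_sin// !lc !ls !dc !ds /nsign /ndist.
    case: (leqP n j) => nj; last first.
      rewrite (ltnW nj).
      move: (fcos f (n + j)) (fsin f (n + j)) (fcos f j) (fsin f j) => x y z w.
      by move: (fcos f _) (fsin f _) => x' y'; field.
    have [jn|jn] := leqP j n.
      have -> : j = n by lia.
      rewrite subnn !addn0 -addnn addn0.
      move: (fcos f (n + n)) (fsin f (n + n)) (fcos f n) (fsin f n) => x y z w.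
      by move: (fcos f _) (fsin f _) => x' y'; field.
    have -> : (n - j + (j - n))%N = (j - n)%N by lia.
    rewrite -addnn [in RHS]natrD; have -> : (n + (j - n))%N = j by lia.
    move: (fcos f (n + j)) (fsin f (n + j)) (fcos f j) (fsin f j) => x y z w.
    by move: (fcos f _) (fsin f _) => x' y'; field.
  rewrite !fcos_mul_cos// !fsin_mul_cos// !lc !ls !dc !ds /nsign /ndist.
  rewrite (addnC j n) (addnC (j - n) (n - j))%N.
  case: (leqP n j) => nj; last first.
    move: (fcos f (n + j)) (fsin f (n + j)) (fcos f j) (fsin f j) => x y z w.
    by move: (fcos f _) (fsin f _) => x' y'; field.
  have -> : (n - j + (j - n))%N = (j - n)%N by lia.
  rewrite -addnn [in RHS]natrD; have -> : (n + (j - n))%N = j by lia.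
  move: (fcos f (n + j)) (fsin f (n + j)) (fcos f j) (fsin f j) => x y z w.
  by move: (fcos f _) (fsin f _) => x' y'; field.
rewrite tsumD// e1 -tsumD// /interaction_sum -tsumZl//.
congr tsum; apply/funext => j; rewrite /high /low /interaction /modes.
by rewrite -!addnn !natrD; case: b {iw ilw idw pc e1}; ring.
Qed.

End product.

End Interaction.

(** * The majorant iteration *)

Section Majorants.
Context {R : realType}.
Variable r : R.
Hypothesis hr : 3 / 2 < r.
Implicit Types (be de : nat -> R).

Let r0 : r != 0.
Proof. have : 0 < r by move: hr; lra.
by move/lt0r_neq0. Qed.

(** At [n = 0] the value is [0], as [0 ^ r = 0] and its inverse is [0]; a sequence bounded by a
    multiple of [rho] therefore vanishes there, as the modes of a mean-zero function do. *)
Definition rho n : R := (n%:R `^ r)^-1.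

Lemma rho_ge0 n : 0 <= rho n.
Proof. by rewrite invr_ge0 powR_ge0. Qed.

Lemma rho0 : rho 0 = 0.
Proof. by rewrite /rho powR0 ?invr0. Qed.

Lemma cvg_rho : cvgn (series rho).
Proof. exact: cvg_series_powRN. Qed.

Definition rho_sum : R := tsum rho.

Lemma rho_sum_ge0 : 0 <= rho_sum.
Proof. by apply: tsum_ge0; exact: rho_ge0. Qed.

Lemma natr_rho n : n%:R * rho n = (n != 0%N)%:R * (n%:R `^ (r - 1))^-1.
Proof.
case: n => [|n]; first by rewrite !mul0r.
have n0 : n.+1%:R != 0 :> R by rewrite pnatr_eq0.
have -> : rho n.+1 = n.+1%:R^-1 * (n.+1%:R `^ (r - 1))^-1.
  rewrite /rho -invfM; congr (_^-1).
  rewrite -{2}(powRr1 (ler0n R n.+1)) -powRD; last by rewrite n0 implybT.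
  by congr (_ `^ _); ring.
by rewrite mulrA divff// mul1r.
Qed.

(** The sequence [n rho_n = n ^ (1 - r)] decreases because [r > 1]. This is how the lost derivative,
    which sits at the higher input frequency, is moved to the output frequency. *)
Lemma natr_rho_le n k : (0 < n <= k)%N -> k%:R * rho k <= n%:R * rho n.
Proof.
move=> /andP[n0 nk]; rewrite !natr_rho -!lt0n n0 (leq_trans n0 nk) !mul1r.
rewrite lef_pV2 ?posrE ?powR_gt0 ?ltr0n//; last exact: leq_trans nk.
by apply: ge0_ler_powR; rewrite ?nnegrE ?ler0n ?ler_nat//; move: hr; lra.
Qed.

Lemma natr_rho_le1 n : n%:R * rho n <= 1.
Proof.
case: n => [|n]; first by rewrite mul0r.
by apply: le_trans (@natr_rho_le 1 n.+1 _) _ => //; rewrite /rho powR1 invr1 mulr1.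
Qed.

Definition rho_bounded (M : R) be := forall n, 0 <= be n <= M * rho n.

Lemma rho_bounded_cvg M be : rho_bounded M be -> cvgn (series be).
Proof.
move=> bM; refine (dominated_cvg_series (cvg_seriesZl (k := M) cvg_rho) _) => n.
by have /andP[? ?] := bM n; rewrite ger0_norm.
Qed.

Lemma rho_bounded_tsum M be : rho_bounded M be -> tsum be <= M * rho_sum.
Proof.
move=> bM; rewrite /rho_sum -tsumZl; last exact: cvg_rho.
by apply: ler_tsum => //; exact: (cvg_seriesZl (k := M) cvg_rho).
Qed.

(** The factor [2] counts the two products in [interaction]. *)
Definition majorant_term be de n j : R := (n + j.*2)%:R * (2 * be (n + j)%N * de j).

Definition majorant be de n : R := tsum (majorant_term be de n).

Lemma majorant_term_ge0 M M' be de n j : rho_bounded M be -> rho_bounded M' de ->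
  0 <= majorant_term be de n j.
Proof.
move=> bM dM; have /andP[? _] := bM (n + j)%N; have /andP[? _] := dM j.
by rewrite mulr_ge0 ?ler0n// !mulr_ge0.
Qed.

Lemma majorant_term_le M M' be de n j : 0 <= M -> rho_bounded M be ->
  rho_bounded M' de -> majorant_term be de n j <= 4 * M * M' * rho j.
Proof.
move=> M0 bM dM; have /andP[b0 b1] := bM (n + j)%N; have /andP[d0 d1] := dM j.
have h1 : (n + j.*2)%:R * be (n + j)%N <= 2 * M.
  apply: (@le_trans _ _ (2 * ((n + j)%:R * (M * rho (n + j)))%R)).
    rewrite mulrA -natrM; apply: ler_pM => //; rewrite ler_nat; lia.
  rewrite ler_pM2l// mulrCA; apply: ler_piMr => //; exact: natr_rho_le1.
rewrite /majorant_term.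
have -> : (n + j.*2)%:R * (2 * be (n + j)%N * de j) =
  2 * (((n + j.*2)%:R * be (n + j)%N) * de j) by ring.
have -> : 4 * M * M' * rho j = 2 * ((2 * M) * (M' * rho j)) by ring.
by rewrite ler_pM2l//; apply: ler_pM => //; rewrite mulr_ge0.
Qed.

Lemma cvg_majorant M M' be de n : 0 <= M -> rho_bounded M be -> rho_bounded M' de ->
  cvgn (series (majorant_term be de n)).
Proof.
move=> M0 bM dM.
refine (dominated_cvg_series (cvg_seriesZl (k := 4 * M * M') cvg_rho) _) => j.
rewrite ger0_norm; first exact: majorant_term_le.
exact: majorant_term_ge0 bM dM.
Qed.

Lemma majorant_ge0 M M' be de n : rho_bounded M be -> rho_bounded M' de ->
  0 <= majorant be de n.
Proof. by move=> bM dM; apply: tsum_ge0 => j; exact: majorant_term_ge0 bM dM. Qed.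

Lemma ler_majorant M be de n : 0 <= M -> rho_bounded M be -> rho_bounded M de ->
  (forall k, be k <= de k) -> majorant be be n <= majorant de de n.
Proof.
move=> M0 bM dM bd; refine (ler_tsum (@cvg_majorant _ _ _ _ n M0 dM dM) _) => j.
rewrite (majorant_term_ge0 _ _ bM bM)/=.
have /andP[? _] := bM (n + j)%N; have /andP[? _] := bM j.
rewrite ler_wpM2l ?ler0n//; apply: ler_pM => //; first by rewrite mulr_ge0.
by rewrite ler_pM2l.
Qed.

Section weighted.
Variable m : R.
Hypothesis m0 : 0 < m.

(* The gain: dividing by [n] turns the weight [n^r] of the output into the
   weight [(n+j)^r] of the higher input mode. *)
Lemma weighted_majorant_term be de n j : 0 <= be (n + j)%N -> 0 <= de j ->
  n%:R `^ r * (4 / (m * n%:R) * majorant_term be de n j) <=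
  16 / m * ((n + j)%:R `^ r * be (n + j)%N * de j).
Proof.
move=> b0 d0; case: n b0 => [|n] b0.
  rewrite powR0// mul0r.
  by rewrite !mulr_ge0 ?invr_ge0 ?powR_ge0// ltW.
have := @natr_rho_le n.+1 (n.+1 + j); rewrite leq_addr => /(_ isT).
rewrite /rho ler_pdivrMr ?powR_gt0// mulrAC ler_pdivlMr ?powR_gt0// => h.
(* This [2] comes from [n + 2 j <= 2 (n + j)]. Multiplied by the [4] of the iteration and the [2] of
   [majorant_term], it gives the constant [16]. *)
have h2 : (n.+1 + j.*2)%:R * n.+1%:R `^ r <= 2 * (n.+1%:R * (n.+1 + j)%:R `^ r).
  apply: (@le_trans _ _ (2 * ((n.+1 + j)%:R * n.+1%:R `^ r))); last by rewrite ler_pM2l.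
  rewrite mulrA -natrM; apply: ler_wpM2r; rewrite ?powR_ge0// ler_nat; lia.
rewrite /majorant_term.
have -> : n.+1%:R `^ r * (4 / (m * n.+1%:R) * ((n.+1 + j.*2)%:R * (2 * be (n.+1 + j)%N * de j))) =
  8 / (m * n.+1%:R) * (be (n.+1 + j)%N * de j) * ((n.+1 + j.*2)%:R * n.+1%:R `^ r) by ring.
have -> : 16 / m * ((n.+1 + j)%:R `^ r * be (n.+1 + j)%N * de j) =
  8 / (m * n.+1%:R) * (be (n.+1 + j)%N * de j) * (2 * (n.+1%:R * (n.+1 + j)%:R `^ r)).
  by field; rewrite ?gt_eqF// gt_eqF.
apply: ler_wpM2l => //; rewrite mulr_ge0//; last by rewrite mulr_ge0.
by rewrite divr_ge0// mulr_ge0// ltW.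
Qed.

Lemma weighted_majorant M M' be de n : 0 <= M -> rho_bounded M be ->
  rho_bounded M' de ->
  cvgn (series (fun j => (n + j)%:R `^ r * be (n + j)%N * de j)) /\
  n%:R `^ r * (4 / (m * n%:R) * majorant be de n) <=
  16 / m * tsum (fun j => (n + j)%:R `^ r * be (n + j)%N * de j).
Proof.
move=> M0 bM dM.
have f0 k : 0 <= k%:R `^ r * be k <= M.
  have /andP[b0 b1] := bM k; rewrite mulr_ge0 ?powR_ge0//=.
  case: k b0 b1 => [|k] b0 b1; first by rewrite powR0 ?mul0r.
  apply: le_trans (ler_wpM2l (powR_ge0 _ _) b1) _.
  by rewrite /rho mulrCA divff ?mulr1// gt_eqF// powR_gt0 ltr0n.
have cs : cvgn (series (fun j => (n + j)%:R `^ r * be (n + j)%N * de j)).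
  refine (dominated_cvg_series (cvg_seriesZl (k := M) (rho_bounded_cvg dM)) _) => j.
  have /andP[h0 h1] := f0 (n + j)%N; have /andP[d0 _] := dM j.
  by rewrite ger0_norm; [exact: ler_wpM2r|exact: mulr_ge0].
split=> //; have ck := @cvg_majorant _ _ _ _ n M0 bM dM.
rewrite mulrA -tsumZl// -tsumZl//; apply: ler_tsum; first exact: cvg_seriesZl.
move=> j; have /andP[b0 _] := bM (n + j)%N; have /andP[d0 _] := dM j.
rewrite -mulrA weighted_majorant_term// andbT mulr_ge0 ?powR_ge0// mulr_ge0//.
  by rewrite divr_ge0// mulr_ge0// ltW.
exact: majorant_term_ge0 bM dM.
Qed.

End weighted.

Lemma weighted_cauchy_schwarz (f g : nat -> R) J : (forall j, 0 <= g j) ->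
  (\sum_(0 <= j < J) f j * g j) ^+ 2 <=
  (\sum_(0 <= j < J) g j) * (\sum_(0 <= j < J) f j ^+ 2 * g j).
Proof.
move=> g0; elim: J => [|J IH]; first by rewrite !big_geq// expr0n mul0r.
rewrite !big_nat_recr//=.
have : 0 <= \sum_(0 <= j < J) g j by exact: sumr_ge0.
have : 0 <= \sum_(0 <= j < J) f j ^+ 2 * g j.
  by apply: sumr_ge0 => j _; rewrite mulr_ge0 ?sqr_ge0.
move: IH (g0 J).
move: (\sum_(0 <= j < J) f j * g j) (\sum_(0 <= j < J) f j ^+ 2 * g j) => S Q.
move: (\sum_(0 <= j < J) g j) (f J) (g J) => G x y.
move=> SGQ y0 Q0 G0.
(* By the induction hypothesis [(2 S x) ^ 2 <= 4 G Q x ^ 2], and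
   [4 G x ^ 2 Q <= (G x ^ 2 + Q) ^ 2]. *)
have key : 2 * S * x <= G * x ^+ 2 + Q.
  apply: le_trans (ler_norm _) _; rewrite -ler_sqr ?nnegrE//; last first.
    by rewrite addr_ge0// mulr_ge0// sqr_ge0.
  rewrite real_normK ?num_real//.
  have : 0 <= (G * x ^+ 2 - Q) ^+ 2 by exact: sqr_ge0.
  have : 0 <= x ^+ 2 * (G * Q - S ^+ 2) by rewrite mulr_ge0 ?sqr_ge0// subr_ge0.
  lra.
have := ler_wpM2r y0 key; lra.
Qed.

(** Young's inequality from l^1 and l^2 to l^2, for a correlation sum. Cauchy-Schwarz with the
    weight [g] extracts one factor [G]; after exchanging the sums, shifting [f] only decreases its
    l^2 norm, and summing [g] gives the second [G]. The inner sums are finite until the last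
    step. *)
Lemma young_bound (f g : nat -> R) F G N : (forall j, 0 <= g j) ->
  (forall n, 0 <= f n) ->
  (forall n, cvgn (series (fun j => f (n + j)%N * g j))) ->
  (forall K, \sum_(0 <= n < K) f n ^+ 2 <= F) ->
  (forall J, \sum_(0 <= j < J) g j <= G) ->
  \sum_(0 <= n < N) (tsum (fun j => f (n + j)%N * g j)) ^+ 2 <= G ^+ 2 * F.
Proof.
move=> g0 f0 cv fF gG.
have F0 : 0 <= F by apply: le_trans (fF 0%N); rewrite big_geq.
have G0 : 0 <= G by apply: le_trans (gG 0%N); rewrite big_geq.
have shift j : \sum_(0 <= n < N) f (n + j)%N ^+ 2 <= F.
  apply: le_trans (fF (N + j)%N).
  rewrite (big_cat_nat (leq0n j) (leq_addl N j))/=.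
  rewrite -{3}(add0n j) big_addn addnK lerDr; apply: sumr_ge0 => i _.
  exact: sqr_ge0.
have bd J : \sum_(0 <= n < N) (series (fun j => f (n + j)%N * g j) J) ^+ 2 <= G ^+ 2 * F.
  apply: (@le_trans _ _ (\sum_(0 <= n < N)
      G * (\sum_(0 <= j < J) f (n + j)%N ^+ 2 * g j))).
    apply: ler_sum => n _; apply: le_trans (weighted_cauchy_schwarz _ _ g0) _.
    apply: ler_wpM2r => //; apply: sumr_ge0 => j _; by rewrite mulr_ge0 ?sqr_ge0.
  rewrite -mulr_sumr exchange_big/= expr2 -mulrA; apply: ler_wpM2l => //.
  under eq_bigr do rewrite -mulr_suml.
  apply: (@le_trans _ _ (\sum_(0 <= j < J) F * g j)).
    by apply: ler_sum => j _; apply: ler_wpM2r.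
  by rewrite -mulr_sumr mulrC; apply: ler_wpM2r.
have cvS : (\sum_(0 <= n < N) (series (fun j => f (n + j)%N * g j) J) ^+ 2) @[J --> \oo] -->
    \sum_(0 <= n < N) (tsum (fun j => f (n + j)%N * g j)) ^+ 2.
  elim: N {shift bd} => [|N IH].
    by rewrite big_geq//; under eq_fun do rewrite big_geq//; exact: cvg_cst.
  rewrite big_nat_recr//=; under eq_fun do rewrite big_nat_recr//=.
  apply: cvgD => //; rewrite expr2; under eq_fun do rewrite expr2.
  by apply: cvgM; exact: cv.
rewrite -(cvg_lim _ cvS)//; apply: limr_le; first by apply/cvg_ex; eexists; exact: cvS.
by apply: nearW => J; exact: bd.
Qed.

End Majorants.

(** * Picard iteration *)

Section Duhamel.
Context {R : realType}.
Implicit Types (a la mu K : R) (f g : R -> R).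

Lemma continuous_at_duhamel a la f : continuous f ->
  forall t, 0 <= t -> {for t, continuous (duhamel a la f)}.
Proof.
move=> cf t t0; apply: differentiable_continuous; apply/derivable1_diffP.
by have [] := is_derive_duhamel a la cf (lt_le_trans (ltrN10 R) t0).
Qed.

Lemma continuous_duhamel_norm a la f : continuous f ->
  continuous (fun t : R => duhamel a la f `|t|).
Proof.
move=> cf t; apply: (@continuous_comp _ _ _ (fun t : R => `|t|) (duhamel a la f)).
  exact: norm_continuous.
exact: continuous_at_duhamel.
Qed.

Lemma duhamel_cst0 a la t : duhamel a la (fun=> 0) t = expR (- la * t) * a.
Proof.
rewrite /duhamel.
have e y : (\int[@lebesgue_measure R]_(t0 in [set` `[-1, y]]) (expR (la * t0) * 0))%R = 0.
  by under eq_Rintegral do rewrite mulr0; rewrite Rintegral_cst//= mul0r.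
by rewrite !e subrr addr0.
Qed.

Lemma duhamel_dist a la mu K f g : 0 <= mu < la -> 0 <= K ->
  continuous f -> continuous g ->
  (forall t, 0 < t -> `|f t - g t| <= K * expR (- mu * t)) ->
  forall t, 0 <= t ->
  `|duhamel a la f t - duhamel a la g t| <= K / (la - mu) * expR (- mu * t).
Proof.
move=> mula K0 cf cg fg t t0.
pose v x := duhamel a la f x - duhamel a la g x.
pose dv x := (f x - la * duhamel a la f x) - (g x - la * duhamel a la g x).
have cv : {within `[0, t], continuous v}.
  apply: continuous_in_subspaceT => x; rewrite inE/= in_itv/= => /andP[x0 _].
  by apply: cvgB; exact: continuous_at_duhamel.
have v0 : v 0 = 0 by rewrite /v !duhamel_start subrr.
have dvE (x : R) : 0 < x < t -> is_derive x 1 v (dv x).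
  move=> /andP[x0 _]; have x1 : -1 < x by apply: lt_trans x0; exact: ltrN10.
  have h1 := is_derive_duhamel a la cf x1; have h2 := is_derive_duhamel a la cg x1.
  exact: is_deriveB.
have bd (x : R) : 0 < x < t -> `|dv x + la * v x| <= K * expR (- mu * x).
  move=> /andP[x0 _]; apply: le_trans (fg x x0).
  rewrite le_eqVlt; apply/orP; left; apply/eqP; congr `|_|; rewrite /v /dv; ring.
have tt : 0 <= t <= t by rewrite t0 lexx.
exact: (duhamel_bound mula K0 cv v0 dvE bd tt).
Qed.

End Duhamel.

Section Picard.
Context {R : realType}.
Variables (c m gamma r : R).
Hypotheses (c0 : 0 < c) (m0 : 0 < m) (g0 : 0 <= gamma) (hr : 3 / 2 < r).
Variable a : bool -> nat -> R.
Hypothesis a0 : forall b, a b 0%N = 0.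

Local Notation family := (bool -> nat -> R -> R).
Implicit Types (u v : family) (be de : nat -> R).

(** Half of the linear damping per unit of frequency. With the full rate, forcing and damping could
    have the same exponent, and [duhamel_bound] needs a gap. *)
Definition rate : R := c * m / 2.

Definition damping n : R := c * m * n%:R + gamma.

(* Functions of time are extended evenly to negative times, so that they are
   continuous on the whole line. *)
Definition decay n (t : R) : R := expR (- (rate * n%:R) * `|t|).

Definition at_time v t : bool -> nat -> R := fun b n => v b n t.

Definition dominated v be := forall b n t, `|v b n t| <= be n * decay n t.

Definition family_continuous v := forall b n, continuous (v b n).

(** Mode [0] is removed by the projection [P0]; the [2] is that of [nonlinearity_modes]. *)
Definition forcing v b n t : R :=
  if n == 0%N then 0
  else - (2 * c) * interaction_sum b (at_time v t) (at_time v t) n.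

Definition picard v b n (t : R) : R := duhamel (a b n) (damping n) (forcing v b n) `|t|.

Let rate0 : 0 < rate. Proof. by rewrite divr_gt0// mulr_gt0. Qed.

Lemma decay_ge0 n t : 0 <= decay n t. Proof. exact: expR_ge0. Qed.

Lemma decay_le1 n t : decay n t <= 1.
Proof.
by rewrite expR_le1 mulNr oppr_le0 mulr_ge0// mulr_ge0// ltW.
Qed.

(** The frequencies add up to [n + 2 j >= n], so a product of two modes decays at least as fast as
    the envelope of the output mode. *)
Lemma decayD n j t : decay (n + j) t * decay j t <= decay n t.
Proof.
rewrite -expRD ler_expR natrD -mulrDl ler_wpM2r//.
have : 0 <= rate * j%:R by rewrite mulr_ge0// ltW.
lra.
Qed.

Lemma pair_le u v be de b b' n j t : dominated u be -> dominated v de ->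
  0 <= be (n + j)%N -> 0 <= de j ->
  `|at_time u t b (n + j)%N * at_time v t b' j| <= be (n + j)%N * de j * decay n t.
Proof.
move=> ub vd b0 d0; rewrite normrM.
apply: (@le_trans _ _ ((be (n + j)%N * decay (n + j) t) * (de j * decay j t))).
  by apply: ler_pM => //; [exact: ub|exact: vd].
rewrite mulrACA; apply: ler_wpM2l; first exact: mulr_ge0.
exact: decayD.
Qed.

Lemma interaction_le u v be de b n j t : dominated u be -> dominated v de ->
  0 <= be (n + j)%N -> 0 <= de j ->
  `|interaction b (at_time u t) (at_time v t) n j| <=
  majorant_term be de n j * decay n t.
Proof.
move=> ub vd b0 d0; rewrite /interaction /majorant_term normrM ger0_norm ?ler0n//.
rewrite -mulrA; apply: ler_wpM2l; first exact: ler0n.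
have h b1 b2 := @pair_le u v be de b1 b2 n j t ub vd b0 d0.
case: b.
  apply: le_trans (ler_normB _ _) _.
  by have := h true false; have := h false true; lra.
apply: le_trans (ler_normD _ _) _.
by have := h false false; have := h true true; lra.
Qed.

Lemma interactionBl u u' v b n j t :
  interaction b (at_time u t) (at_time v t) n j -
  interaction b (at_time u' t) (at_time v t) n j =
  interaction b (at_time (fun b n t => u b n t - u' b n t) t) (at_time v t) n j.
Proof. by rewrite /interaction /at_time; case: b; ring. Qed.

Lemma interactionBr u v v' b n j t :
  interaction b (at_time u t) (at_time v t) n j -
  interaction b (at_time u t) (at_time v' t) n j =
  interaction b (at_time u t) (at_time (fun b n t => v b n t - v' b n t) t) n j.
Proof. by rewrite /interaction /at_time; case: b; ring. Qed.

Section bounded.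
Variable M : R.
Hypothesis M0 : 0 <= M.

Lemma cvg_interaction v be b n t : dominated v be -> rho_bounded r M be ->
  cvgn (series (interaction b (at_time v t) (at_time v t) n)).
Proof.
move=> vb bM; refine (dominated_cvg_series (@cvg_majorant _ _ hr _ _ _ _ n M0 bM bM) _) => j.
have /andP[b0 _] := bM (n + j)%N; have /andP[b1 _] := bM j.
apply: le_trans (interaction_le b t vb vb b0 b1) _; apply: ler_piMr.
  exact: (majorant_term_ge0 _ _ bM bM).
exact: decay_le1.
Qed.

Lemma continuous_forcing v be b n : family_continuous v -> dominated v be ->
  rho_bounded r M be -> continuous (forcing v b n).
Proof.
move=> cv vb bM; have [n0|n0] := boolP (n == 0%N).
  have -> : forcing v b n = fun=> 0 by apply/funext => t; rewrite /forcing n0.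
  by move=> t; exact: cvg_cst.
have -> : forcing v b n = fun t =>
    - (2 * c) * interaction_sum b (at_time v t) (at_time v t) n.
  by apply/funext => t; rewrite /forcing (negbTE n0).
move=> t; apply: cvgM; first exact: cvg_cst.
have cM := @cvg_majorant _ _ hr _ _ _ _ n M0 bM bM.
apply: (continuous_tsum cM) => [s j|j].
  have /andP[b0 _] := bM (n + j)%N; have /andP[b1 _] := bM j.
  apply: le_trans (interaction_le b s vb vb b0 b1) _; apply: ler_piMr.
    exact: (majorant_term_ge0 _ _ bM bM).
  exact: decay_le1.
move=> s; apply: cvgM; first exact: cvg_cst.
by case: b; [apply: cvgB|apply: cvgD]; apply: cvgM; exact: cv.
Qed.

Lemma continuous_picard v be : family_continuous v -> dominated v be ->
  rho_bounded r M be -> family_continuous (picard v).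
Proof.
move=> cv vb bM b n; apply: continuous_duhamel_norm.
exact: continuous_forcing vb bM.
Qed.

(** The splitting [u u - v v = (u - v) u + v (u - v)] is matched by [de de - be be = (de - be) de +
    be (de - be)]. Differences of functions are thus controlled by differences of majorants, whose
    sum over the iterates telescopes. *)
Lemma interaction_sum_dist u v be de b n t :
  dominated u de -> dominated v be -> rho_bounded r M be -> rho_bounded r M de ->
  (forall k, be k <= de k) ->
  dominated (fun b n t => u b n t - v b n t) (fun k => de k - be k) ->
  `|interaction_sum b (at_time u t) (at_time u t) n -
    interaction_sum b (at_time v t) (at_time v t) n| <=
  (majorant de de n - majorant be be n) * decay n t.
Proof.
move=> ud vb bM dM bd uvd.
have cd := @cvg_majorant _ _ hr _ _ _ _ n M0 dM dM.
have cb := @cvg_majorant _ _ hr _ _ _ _ n M0 bM bM.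
rewrite /interaction_sum -tsumB; [|exact: cvg_interaction ud dM|exact: cvg_interaction vb bM].
rewrite /majorant -tsumB//.
have cdb : cvgn (series (fun j => majorant_term de de n j - majorant_term be be n j)).
  exact: (is_cvg_seriesB cd cb).
rewrite mulrC -tsumZl//; apply: ler_norm_tsum; first exact: cvg_seriesZl.
move=> j; rewrite [leRHS]mulrC.
have /andP[b0 _] := bM (n + j)%N; have /andP[b1 _] := bM j.
have /andP[d0 _] := dM (n + j)%N; have /andP[d1 _] := dM j.
have bd0 := bd (n + j)%N; have bd1 := bd j.
rewrite -(subrKA (interaction b (at_time v t) (at_time u t) n j)) interactionBl interactionBr.
apply: le_trans (ler_normD _ _) _.
have h1 := @interaction_le _ u _ de b n j t uvd ud.
have h2 := @interaction_le v _ be _ b n j t vb uvd.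
rewrite subr_ge0 in h1; rewrite subr_ge0 in h2.
apply: le_trans (lerD (h1 bd0 d1) (h2 b0 bd1)) _.
rewrite -mulrDl le_eqVlt; apply/orP; left; apply/eqP; congr (_ * _).
by rewrite /majorant_term; ring.
Qed.

(** Both images start from the same datum, so [duhamel_dist] bounds their difference by that of the
    forcings. The result is stated as a difference of two values of the scalar iteration, ready to
    be telescoped. *)
Lemma picard_dist u v be de :
  family_continuous u -> family_continuous v ->
  dominated u de -> dominated v be -> rho_bounded r M be -> rho_bounded r M de ->
  (forall k, be k <= de k) ->
  dominated (fun b n t => u b n t - v b n t) (fun k => de k - be k) ->
  dominated (fun b n t => picard u b n t - picard v b n t)
    (fun n => 4 / (m * n%:R) * majorant de de n - 4 / (m * n%:R) * majorant be be n).
Proof.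
move=> cu cv ud vb bM dM bd uvd b n t.
have [->|n0] := eqVneq n 0%N.
  rewrite /picard /forcing eqxx subrr normr0.
  by rewrite mulr0 invr0 mulr0 !mul0r subrr mul0r.
have nR : 0 < n%:R :> R by rewrite ltr0n lt0n.
set D := majorant de de n - majorant be be n.
have D0 : 0 <= D by rewrite subr_ge0; exact: (ler_majorant hr n M0 bM dM bd).
have rn : 0 < rate * n%:R by rewrite mulr_gt0.
(* The gap is at least [rate * n], and [2 c / (rate * n) = 4 / (m n)]. *)
have la2 : damping n - rate * n%:R = rate * n%:R + gamma.
  by rewrite /damping /rate; field.
have hd : 0 <= rate * n%:R < damping n.
  by rewrite (ltW rn)/= -subr_gt0 la2 ltr_wpDr.
have K0 : 0 <= 2 * c * D by rewrite mulr_ge0// mulr_ge0// ltW.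
have := @duhamel_dist _ (a b n) (damping n) (rate * n%:R) (2 * c * D)
  (forcing u b n) (forcing v b n) hd K0 (@continuous_forcing _ _ b n cu ud dM)
  (@continuous_forcing _ _ b n cv vb bM) _ `|t| (normr_ge0 t).
rewrite -/(picard u b n t) -/(picard v b n t) -/(decay n t) => h.
apply: le_trans (h _) _.
  move=> s s0; rewrite /forcing (negbTE n0) -mulrBr normrM normrN.
  have c2 : 0 <= 2 * c by rewrite mulr_ge0// ltW.
  rewrite (ger0_norm c2) -[leRHS]mulrA; apply: ler_wpM2l => //.
  have := interaction_sum_dist b n s ud vb bM dM bd uvd.
  by rewrite /decay (gtr0_norm s0).
apply: ler_wpM2r; first exact: decay_ge0.
rewrite -mulrBr -/D la2.
have -> : 4 / (m * n%:R) * D = 2 * c * D / (rate * n%:R).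
  by rewrite /rate; field; rewrite !gt_eqF.
apply: ler_wpM2l => //; rewrite lef_pV2 ?posrE//; last by rewrite ltr_wpDr.
by rewrite lerDl.
Qed.

End bounded.

End Picard.

(** * Convergence of the Picard iteration *)

Section PicardLimit.
Context {R : realType}.
Variables (c m gamma r : R).
Hypotheses (c0 : 0 < c) (m0 : 0 < m) (g0 : 0 <= gamma) (hr : 3 / 2 < r).
Variable a : bool -> nat -> R.
Hypothesis a0 : forall b, a b 0%N = 0.
Let alpha (n : nat) : R := `|a false n| + `|a true n|.
Variable A : R.
Hypothesis A0 : 0 <= A.
Hypothesis aA : forall N, \sum_(0 <= n < N) (n%:R `^ r * alpha n) ^+ 2 <= A ^+ 2.
Hypothesis A_small : 64 * A * rho_sum r <= m.

Local Notation decay := (decay c m).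
Local Notation dominated := (dominated c m).
Local Notation picard := (picard c m gamma a).
Local Notation damping := (damping c m gamma).

Fixpoint beta p n : R :=
  if p is q.+1 then alpha n + 4 / (m * n%:R) * majorant (beta q) (beta q) n else 0.

Let A2 : 0 <= 2 * A. Proof. by rewrite mulr_ge0. Qed.

Let alpha_ge0 n : 0 <= alpha n. Proof. by rewrite addr_ge0. Qed.

Let weighted_alpha n : n%:R `^ r * alpha n <= A.
Proof.
rewrite -ler_sqr ?nnegrE ?mulr_ge0 ?powR_ge0//.
apply: le_trans (aA n.+1); rewrite big_nat_recr//= lerDr.
by apply: sumr_ge0 => i _; exact: sqr_ge0.
Qed.

Let Z := rho_sum r.
Let Z0 : 0 <= Z. Proof. exact: rho_sum_ge0. Qed.

Let weight_bound M be n : 0 <= M -> rho_bounded r M be -> 0 <= n%:R `^ r * be n <= M.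
Proof.
move=> M0 bM; have /andP[b0 b1] := bM n; rewrite mulr_ge0 ?powR_ge0//=.
case: n b0 b1 => [|n] b0 b1.
  rewrite powR0 ?mul0r//; have : 0 < r by move: hr; lra.
  by move/lt0r_neq0.
apply: le_trans (ler_wpM2l (powR_ge0 _ _) b1) _.
by rewrite /rho mulrCA divff ?mulr1// gt_eqF// powR_gt0 ltr0n.
Qed.

(** The ball of radius [2 A] is invariant: one [A] is the datum, and the quadratic part is at most
    [16 / m * (2 A) * (2 A rho_sum) = 64 A ^ 2 rho_sum / m <= A]. This is where the constant [64] of
    the smallness condition comes from. *)
Lemma beta_rho_bounded p : rho_bounded r (2 * A) (beta p).
Proof.
elim: p => [|p IH] n /=; first by rewrite lexx/= mulr_ge0//; exact: rho_ge0.
have [cs h] := @weighted_majorant _ _ hr _ m0 _ _ _ _ n A2 IH IH.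
have k0 : 0 <= 4 / (m * n%:R) * majorant (beta p) (beta p) n.
  rewrite mulr_ge0 ?(majorant_ge0 n IH IH)//.
  by rewrite divr_ge0// mulr_ge0// ltW.
rewrite addr_ge0//=.
have [->|n0] := eqVneq n 0%N.
  by rewrite mulr0 invr0 mulr0 mul0r addr0 rho0// mulr0 /alpha !a0 normr0 addr0.
have nr0 : 0 < (n%:R : R) `^ r by apply: powR_gt0; rewrite ltr0n lt0n.
rewrite /rho -(ler_pM2l nr0) mulrCA divff ?gt_eqF// mulr1 mulrDr.
suff : 16 / m * tsum (fun j => (n + j)%:R `^ r * beta p (n + j)%N * beta p j) <= A.
  by move=> h2; have := weighted_alpha n; have := le_trans h h2; lra.
have h3 : tsum (fun j => (n + j)%:R `^ r * beta p (n + j)%N * beta p j) <=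
    2 * A * (2 * A * Z).
  apply: (@le_trans _ _ (2 * A * tsum (beta p))); last first.
    by apply: ler_wpM2l => //; exact: rho_bounded_tsum.
  rewrite -tsumZl; last exact: (rho_bounded_cvg hr IH).
  apply: ler_tsum; first exact: (cvg_seriesZl (k := 2 * A) (rho_bounded_cvg hr IH)).
  move=> j; have /andP[w0 w1] := weight_bound (n + j) A2 IH; have /andP[b0 _] := IH j.
  by rewrite mulr_ge0//=; exact: ler_wpM2r.
apply: (@le_trans _ _ (16 / m * (2 * A * (2 * A * Z)))).
  by apply: ler_wpM2l => //; rewrite divr_ge0// ltW.
rewrite mulrAC ler_pdivrMr//.
have -> : 16 * (2 * A * (2 * A * Z)) = A * (64 * A * Z) by ring.
exact: ler_wpM2l.
Qed.

Lemma beta_monotone p n : beta p n <= beta p.+1 n.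
Proof.
elim: p n => [|p IH] n.
  by have /andP[] := beta_rho_bounded 1 n.
rewrite /= lerD2l; apply: ler_wpM2l; first by rewrite divr_ge0// mulr_ge0// ltW.
exact: (ler_majorant hr n A2 (beta_rho_bounded p) (beta_rho_bounded p.+1) IH).
Qed.

(** By [(x + y) ^ 2 <= 2 x ^ 2 + 2 y ^ 2] the datum contributes at most [2 A ^ 2]. So does the
    quadratic part: Young's inequality with [G = 2 A rho_sum] and [F = 4 A ^ 2] bounds its square
    sum by [(64 A rho_sum / m) ^ 2 A ^ 2]. *)
Lemma beta_sobolev p N : \sum_(0 <= n < N) (n%:R `^ r * beta p n) ^+ 2 <= 4 * A ^+ 2.
Proof.
elim: p N => [|p IH] N.
  by rewrite big1 => [|n _]; rewrite ?mulr0 ?expr0n// mulr_ge0// sqr_ge0.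
have bp := beta_rho_bounded p.
pose T n := tsum (fun j => (n + j)%:R `^ r * beta p (n + j)%N * beta p j).
have w0 n : 0 <= n%:R `^ r * beta p n by have /andP[] := weight_bound n A2 bp.
have b0 n : 0 <= beta p n by have /andP[] := bp n.
have hT : \sum_(0 <= n < N) T n ^+ 2 <= (2 * A * Z) ^+ 2 * (4 * A ^+ 2).
  apply: (@young_bound _ (fun n => n%:R `^ r * beta p n) (beta p)) => //.
    by move=> n; have [] := @weighted_majorant _ _ hr _ m0 _ _ _ _ n A2 bp bp.
  move=> J; apply: le_trans (rho_bounded_tsum hr bp).
  exact: (series_le_tsum J (rho_bounded_cvg hr bp)).
have step n : (n%:R `^ r * beta p.+1 n) ^+ 2 <=
    2 * (n%:R `^ r * alpha n) ^+ 2 + 2 * ((16 / m) ^+ 2 * T n ^+ 2).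
  have [_ h] := @weighted_majorant _ _ hr _ m0 _ _ _ _ n A2 bp bp.
  apply: (@le_trans _ _ ((n%:R `^ r * alpha n + 16 / m * T n) ^+ 2)).
    rewrite ler_sqr ?nnegrE.
    - by rewrite /= mulrDr lerD2l.
    - by have /andP[] := weight_bound n A2 (beta_rho_bounded p.+1).
    - rewrite addr_ge0//; apply: mulr_ge0; rewrite ?powR_ge0//.
        by rewrite divr_ge0// ltW.
      by apply: tsum_ge0 => j; exact: mulr_ge0.
  rewrite -exprMn; have := sqr_ge0 (n%:R `^ r * alpha n - 16 / m * T n); lra.
apply: le_trans (ler_sum _ (fun n _ => step n)) _.
rewrite big_split/= -!mulr_sumr.
have h1 := aA N.
have h2 : (16 / m) ^+ 2 * (\sum_(0 <= n < N) T n ^+ 2) <= A ^+ 2.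
  apply: le_trans (ler_wpM2l (sqr_ge0 _) hT) _.
  have -> : (16 / m) ^+ 2 * ((2 * A * Z) ^+ 2 * (4 * A ^+ 2)) =
    (64 * A * Z / m) ^+ 2 * A ^+ 2 by ring.
  apply: ler_piMl; first exact: sqr_ge0.
  apply: exprn_ile1; first by rewrite divr_ge0 ?(ltW m0)// !mulr_ge0.
  by rewrite ler_pdivrMr// mul1r.
by lra.
Qed.

Definition beta_lim n : R := limn (beta^~ n).

Lemma cvg_beta n : beta p n @[p --> \oo] --> beta_lim n.
Proof.
apply: nondecreasing_is_cvgn.
  by apply/nondecreasing_seqP => p; exact: beta_monotone.
exists (2 * A * rho r n) => _ [p _ <-].
by have /andP[] := beta_rho_bounded p n.
Qed.

Lemma beta_le_lim p n : beta p n <= beta_lim n.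
Proof.
apply: (@nondecreasing_cvgn_le _ (beta^~ n)); last exact: cvg_beta.
by apply/nondecreasing_seqP => q; exact: beta_monotone.
Qed.

Lemma beta_lim_rho_bounded : rho_bounded r (2 * A) beta_lim.
Proof.
move=> n; apply/andP; split.
  by apply: le_trans (beta_le_lim 0 n).
rewrite -(cvg_lim _ (@cvg_beta n))//; apply: limr_le; first exact: cvg_beta.
by apply: nearW => p; have /andP[] := beta_rho_bounded p n.
Qed.

Lemma beta_lim_sobolev N :
  \sum_(0 <= n < N) (n%:R `^ r * beta_lim n) ^+ 2 <= 4 * A ^+ 2.
Proof.
have cv : (\sum_(0 <= n < N) (n%:R `^ r * beta p n) ^+ 2) @[p --> \oo] -->
    \sum_(0 <= n < N) (n%:R `^ r * beta_lim n) ^+ 2.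
  elim: N => [|N IH].
    by rewrite big_geq//; under eq_fun do rewrite big_geq//; exact: cvg_cst.
  rewrite big_nat_recr//=; under eq_fun do rewrite big_nat_recr//=.
  apply: cvgD => //; rewrite expr2; under eq_fun do rewrite expr2.
  by apply: cvgM; apply: cvgM; (try exact: cvg_cst); exact: cvg_beta.
rewrite -(cvg_lim _ cv)//; apply: limr_le; first by apply/cvg_ex; eexists; exact: cv.
by apply: nearW => p; exact: beta_sobolev.
Qed.

(** The limit passes through the infinite sum by [tannery], the terms being dominated by those of
    [beta_lim]. *)
Lemma beta_lim_fixed n :
  beta_lim n = alpha n + 4 / (m * n%:R) * majorant beta_lim beta_lim n.
Proof.
have cv1 : beta p.+1 n @[p --> \oo] --> beta_lim n.
  by rewrite (@cvg_shiftS _ (beta^~ n)); exact: cvg_beta.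
suff cv2 : beta p.+1 n @[p --> \oo] -->
    alpha n + 4 / (m * n%:R) * majorant beta_lim beta_lim n.
  by rewrite -(cvg_lim _ cv1)// (cvg_lim _ cv2).
apply: cvgD; first exact: cvg_cst.
apply: cvgM; first exact: cvg_cst.
have bl := beta_lim_rho_bounded.
have cM := @cvg_majorant _ _ hr _ _ _ _ n A2 bl bl.
apply: (tannery cM).
  apply: nearW => p j; rewrite ger0_norm; last first.
    exact: (majorant_term_ge0 n j (beta_rho_bounded p) (beta_rho_bounded p)).
  have /andP[? _] := beta_rho_bounded p (n + j)%N; have /andP[? _] := beta_rho_bounded p j.
  apply: ler_wpM2l => //; apply: ler_pM => //; first by rewrite mulr_ge0.
    by rewrite ler_pM2l//; exact: beta_le_lim.
  exact: beta_le_lim.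
move=> j; apply: cvgM; first exact: cvg_cst.
apply: cvgM; last exact: cvg_beta.
by apply: cvgM; [exact: cvg_cst|exact: cvg_beta].
Qed.

Fixpoint iterate p : bool -> nat -> R -> R :=
  if p is q.+1 then picard (iterate q) else fun _ _ _ => 0.

Lemma dominated_picard0 : dominated (picard (iterate 0)) (beta 1).
Proof.
move=> b n t; rewrite /picard.
have -> : forcing c (iterate 0) b n = fun=> 0.
  apply/funext => s; rewrite /forcing; case: ifP => // _.
  rewrite /interaction_sum; have -> : interaction b (at_time (iterate 0) s) (at_time (iterate 0) s) n = fun=> 0.
    by apply/funext => j; rewrite /interaction /at_time /=; case: (b); ring.
  rewrite (_ : tsum _ = 0) ?mulr0//.
  apply/cvg_lim => //; apply: cvg_near_cst; apply: nearW => N.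
  by rewrite /series/= big1.
rewrite duhamel_cst0 normrM ger0_norm ?expR_ge0// mulrC.
apply: ler_pM => //.
- apply: (@le_trans _ _ (alpha n)); last first.
    have /andP[b0 _] := beta_rho_bounded 1 n.
    rewrite /= lerDl mulr_ge0//; first by rewrite divr_ge0// mulr_ge0// ltW.
    by apply: tsum_ge0 => j; rewrite /majorant_term /= !mulr0.
  by rewrite /alpha; case: b; rewrite ?lerDl ?lerDr.
- rewrite ler_expR ler_wpM2r// lerN2 /damping /rate.
  have : 0 <= c * m * n%:R by rewrite !mulr_ge0// ltW.
  by move: g0; lra.
Qed.

(** The three claims need one induction: the bound on an iterate is the previous bound plus the
    bound on the step, and [picard_dist] bounds the next step only for iterates already continuous
    and dominated. *)
Lemma iterate_spec p : [/\ family_continuous (iterate p),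
  dominated (iterate p) (beta p) &
  dominated (fun b n t => iterate p.+1 b n t - iterate p b n t)
    (fun n => beta p.+1 n - beta p n)].
Proof.
elim: p => [|p [cp dp ddp]].
  split.
  - by move=> b n t; exact: cvg_cst.
  - by move=> b n t; rewrite normr0 mul0r.
  - move=> b n t; have := dominated_picard0 b n t.
    by rewrite [iterate 1]/= [iterate 0]/= [beta 0 n]/= !subr0.
have cp1 : family_continuous (iterate p.+1).
  exact: (continuous_picard c0 m0 hr A2 cp dp (beta_rho_bounded p)).
have dp1 : dominated (iterate p.+1) (beta p.+1).
  move=> b n t; have := dp b n t; have := ddp b n t; rewrite mulrBl => h1 h2.
  rewrite -(subrK (iterate p b n t) (iterate p.+1 b n t)).
  by apply: le_trans (ler_normD _ _) _; lra.
split=> // b n t.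
have := picard_dist c0 m0 g0 hr a A2 cp1 cp dp1 dp (beta_rho_bounded p)
  (beta_rho_bounded p.+1) (beta_monotone p) ddp b n t.
move=> h; apply: le_trans h _; rewrite le_eqVlt; apply/orP; left; apply/eqP.
by congr (_ * _); rewrite /=; ring.
Qed.

Definition solution b n t : R := limn (fun p => iterate p b n t).

Let step_bound b n t p : `|iterate p.+1 b n t - iterate p b n t| <= beta p.+1 n - beta p n.
Proof.
have [_ _ /(_ b n t) h] := iterate_spec p; apply: le_trans h _.
apply: ler_piMr; first by rewrite subr_ge0; exact: beta_monotone.
exact: decay_le1.
Qed.

Let cvg_step n : cvgn (series (fun p => beta p.+1 n - beta p n)).
Proof.
have -> : series (fun p => beta p.+1 n - beta p n) = beta^~ n.
  apply/funext => N; rewrite /series/=.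
  by rewrite (telescope_sumr (beta^~ n) (leq0n N))/= subr0.
exact: cvg_beta.
Qed.

Lemma solution_tsum b n t :
  cvgn (fun p => iterate p b n t) /\
  solution b n t = tsum (fun p => iterate p.+1 b n t - iterate p b n t).
Proof.
have e : (fun p => iterate p b n t) = series (fun p => iterate p.+1 b n t - iterate p b n t).
  apply/funext => N; rewrite /series/=.
  by rewrite (telescope_sumr (fun p => iterate p b n t) (leq0n N))/= subr0.
rewrite /solution /tsum -e; split=> //; rewrite e.
exact: dominated_cvg_series (@cvg_step n) (step_bound b n t).
Qed.

Lemma continuous_solution : family_continuous solution.
Proof.
move=> b n; have -> : solution b n =
    fun t => tsum (fun p => iterate p.+1 b n t - iterate p b n t).
  by apply/funext => t; have [] := solution_tsum b n t.
apply: (continuous_tsum (@cvg_step n)) => [t p|p t]; first exact: step_bound.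
by apply: cvgB; [have [h _ _] := iterate_spec p.+1|have [h _ _] := iterate_spec p]; exact: h.
Qed.

Lemma solution_dist p : dominated (fun b n t => solution b n t - iterate p b n t)
  (fun n => beta_lim n - beta p n).
Proof.
move=> b n t; have [cv _] := solution_tsum b n t.
have cv1 : `|iterate q b n t - iterate p b n t| @[q --> \oo] -->
    `|solution b n t - iterate p b n t|.
  by apply: cvg_norm; apply: cvgB => //; exact: cvg_cst.
have cv2 : (beta q n - beta p n) * decay n t @[q --> \oo] -->
    (beta_lim n - beta p n) * decay n t.
  by apply: cvgM; [apply: cvgB; [exact: cvg_beta|exact: cvg_cst]|exact: cvg_cst].
rewrite -(cvg_lim _ cv1)// -(cvg_lim _ cv2)//; apply: ler_lim.
- by apply/cvg_ex; eexists; exact: cv1.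
- by apply/cvg_ex; eexists; exact: cv2.
exists p => // q /= pq; rewrite -(subnKC pq); elim: (q - p)%N => [|k IH].
  by rewrite addn0 !subrr normr0 mul0r.
rewrite addnS; have [_ _ /(_ b n t) h] := iterate_spec (p + k).
rewrite -(subrKA (iterate (p + k) b n t)).
apply: le_trans (ler_normD _ _) _; apply: le_trans (lerD h IH) _.
by rewrite -mulrDl subrKA.
Qed.

Lemma dominated_solution : dominated solution beta_lim.
Proof.
move=> b n t; have := solution_dist 0 b n t.
by rewrite [iterate 0]/= [beta 0 n]/= !subr0.
Qed.

(** Both sides are limits of the iterates: by [picard_dist] and [beta_lim_fixed], [picard solution]
    is within [beta_lim n - beta p.+1 n] of [iterate p.+1]. *)
Lemma solution_fixed b n t : picard solution b n t = solution b n t.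
Proof.
have bd p : `|picard solution b n t - iterate p.+1 b n t| <= beta_lim n - beta p.+1 n.
  have [cp dp _] := iterate_spec p.
  have h := picard_dist c0 m0 g0 hr a A2 continuous_solution cp dominated_solution dp
    (beta_rho_bounded p) beta_lim_rho_bounded (beta_le_lim p) (solution_dist p) b n t.
  apply: le_trans h _.
  have -> : 4 / (m * n%:R) * majorant beta_lim beta_lim n -
    4 / (m * n%:R) * majorant (beta p) (beta p) n = beta_lim n - beta p.+1 n.
    by rewrite [in RHS]beta_lim_fixed /=; ring.
  apply: ler_piMr; first by rewrite subr_ge0; exact: beta_le_lim.
  exact: decay_le1.
have [cv _] := solution_tsum b n t.
apply/eqP; rewrite -subr_eq0 -normr_le0.
have cv1 : `|picard solution b n t - iterate p.+1 b n t| @[p --> \oo] -->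
    `|picard solution b n t - solution b n t|.
  apply: cvg_norm; apply: cvgB; first exact: cvg_cst.
  by rewrite (@cvg_shiftS _ (fun p => iterate p b n t)).
have cv2 : beta_lim n - beta p.+1 n @[p --> \oo] --> (0 : R).
  rewrite -(subrr (beta_lim n)); apply: cvgB; first exact: cvg_cst.
  by rewrite (@cvg_shiftS _ (beta^~ n)); exact: cvg_beta.
rewrite -(cvg_lim _ cv1)// -(cvg_lim _ cv2)//; apply: ler_lim.
- by apply/cvg_ex; eexists; exact: cv1.
- by apply/cvg_ex; eexists; exact: cv2.
by apply: nearW => p; exact: bd.
Qed.

Lemma solution_start b n : solution b n 0 = a b n.
Proof. by rewrite -solution_fixed /picard normr0 duhamel_start. Qed.

Lemma solution_mode0 b t : solution b 0 t = 0.
Proof.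
rewrite -solution_fixed /picard.
have -> : forcing c solution b 0 = fun=> 0 by [].
by rewrite duhamel_cst0 a0 mulr0.
Qed.

Lemma is_derive_solution b n (t : R) : 0 < t -> is_derive t 1 (solution b n)
  (forcing c solution b n t - damping n * solution b n t).
Proof.
move=> t0; have cf : continuous (forcing c solution b n).
  exact: (continuous_forcing c0 m0 hr A2 continuous_solution dominated_solution
    beta_lim_rho_bounded).
have t1 : -1 < t by apply: lt_trans t0; exact: ltrN10.
have := is_derive_duhamel (a b n) (damping n) cf t1.
have -> : duhamel (a b n) (damping n) (forcing c solution b n) t = solution b n t.
  by rewrite -solution_fixed /picard gtr0_norm.
apply: near_eq_is_derive.
near=> s; rewrite -solution_fixed /picard gtr0_norm//.
by near: s; exact: lt_nbhsr.
Unshelve. all: by end_near. Qed.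

End PicardLimit.

(** * Uniqueness *)

Section ModeEquation.
Context {R : realType}.
Local Notation per := (@period R).
Implicit Types (f g : R -> R) (eta : R -> R -> R).

Lemma modesB f g b n : circle_integrable f -> circle_integrable g ->
  modes (fun s => f s - g s) b n = modes f b n - modes g b n.
Proof. by case: b; [exact: fsinB|exact: fcosB]. Qed.

Lemma modesD f g b n : circle_integrable f -> circle_integrable g ->
  modes (fun s => f s + g s) b n = modes f b n + modes g b n.
Proof. by case: b; [exact: fsinD|exact: fcosD]. Qed.

Lemma modesZl k f b n : circle_integrable f ->
  modes (fun s => k * f s) b n = k * modes f b n.
Proof. by case: b; [exact: fsinZl|exact: fcosZl]. Qed.

Lemma modes_cst k b n : modes (fun=> k : R) b n.+1 = 0.
Proof.
have e : (fun=> k) = (fun s : R => k * (fun=> 1) s) by apply/funext => s; rewrite mulr1.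
rewrite e modesZl; last exact: circle_integrable_cst.
by case: b; rewrite /modes ?fsin_cst1 ?fcos_cst1 mulr0.
Qed.

Lemma modes_P0 f b n : circle_integrable f -> modes (P0 f) b n.+1 = modes f b n.+1.
Proof.
by move=> intf; rewrite /P0 modesB ?modes_cst ?subr0//; exact: circle_integrable_cst.
Qed.

Lemma ae_eq_modes f g b n : measurable_fun per f -> measurable_fun per g ->
  ae_eq_circle f g -> modes f b n = modes g b n.
Proof. by case: b; [exact: ae_eq_fsin|exact: ae_eq_fcos]. Qed.

Lemma L2_square_integrable f : L2 f -> square_integrable f.
Proof. by case/L2P. Qed.

Lemma L2_integrable f : L2 f -> circle_integrable f.
Proof. by move=> /L2_square_integrable/square_integrable_integrable. Qed.

(** The mean of [(f - x w) ^ 2] is nonnegative and that of [w ^ 2] is at most [1], so [x ^ 2] is at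
    most the mean of [f ^ 2]. Unlike [bessel], this does not ask for mean zero and applies to
    difference quotients. *)
Lemma mode_le_L2norm f b n : square_integrable f -> (`|modes f b n|%:E <= L2norm f)%E.
Proof.
move=> qf; have [mf iff] := qf.
pose w s : R := trig_factor b n s.
have cw : continuous w.
  by rewrite /w; case: (b); [exact: continuous_sinM|exact: continuous_cosM].
have wB s : `|w s| <= 1 by rewrite /w; case: (b); [exact: sin_max|exact: cos_max].
have qw := continuous_square_integrable cw.
pose x := modes f b n.
have xE : x = mean (fun s => f s * w s) by rewrite /x /modes /w /trig_factor; case: (b).
have h0 : 0 <= mean (fun s => (f s - x * w s) ^+ 2).
  by apply: mean_ge0 => s _; exact: sqr_ge0.
have ifw := square_integrableM qf qw.
have h1 : mean (fun s => (f s - x * w s) ^+ 2) =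
  mean (fun s => f s ^+ 2) - 2 * x * x + x ^+ 2 * mean (fun s => w s ^+ 2).
  rewrite {3}xE -meanZl// -meanZl; last by case: qw.
  have i2 := circle_integrableZl (2 * x) ifw.
  have i3 := circle_integrableZl (x ^+ 2) qw.2.
  rewrite -meanB// -meanD//; last exact: circle_integrableB.
  by apply: eq_mean => s _; ring.
have h2 : mean (fun s => w s ^+ 2) <= 1.
  rewrite -[leRHS](@mean_cst R); apply: le_mean; first by case: qw.
    exact: circle_integrable_cst.
  move=> s _; rewrite -(real_normK (num_real (w s))).
  by apply: exprn_ile1.
have h3 : x ^+ 2 <= mean (fun s => f s ^+ 2).
  have := ler_wpM2l (sqr_ge0 x) h2; move: h0; rewrite h1; lra.
have q0 : 0 <= mean (fun s => f s ^+ 2) by exact: le_trans (sqr_ge0 _) h3.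
rewrite L2norm_square_integrable// lee_fin -/x -sqrtr_sqr; apply: ler_wsqrtr.
apply: le_trans h3 _; rewrite meanE; apply: ler_peMl => //.
by have := @pi_ge2 R; lra.
Qed.

Lemma cvg_ereal_bound {T : Type} (F : set_system T) {FF : Filter F}
    (f : T -> \bar R) (g : T -> R) :
  f x @[x --> F] --> 0%E -> (\forall x \near F, (`|g x|%:E <= f x)%E) ->
  g x @[x --> F] --> (0 : R).
Proof.
move=> /fine_cvgP[ffin f0] gf; apply/cvgrPdist_le => e e0.
have h : \forall x \near F, `|0 - fine (f x)| <= e by move/cvgrPdist_le : f0; exact.
near=> x; rewrite sub0r normrN.
have fx : f x \is a fin_num by near: x.
have gx : (`|g x|%:E <= f x)%E by near: x.
have hx : `|0 - fine (f x)| <= e by near: x.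
rewrite -lee_fin; apply: le_trans gx _; rewrite -(fineK fx) lee_fin.
by apply: le_trans (ler_norm _) _; move: hx; rewrite sub0r normrN.
Unshelve. all: by end_near. Qed.

(** A mode is a linear functional bounded by the L^2 norm, so convergence of the difference
    quotients in L^2 passes to every mode. *)
Lemma mode_derivative eta (t : R) v b n :
  (\forall s \near t, L2 (eta s)) -> is_time_derivative eta t v ->
  is_derive t 1 (fun s => modes (eta s) b n) (modes v b n).
Proof.
move=> Leta [Lv cvv].
have Lt : L2 (eta t) by exact: nbhs_singleton Leta.
suff : h^-1 *: (modes (eta (h *: 1 + t)) b n - modes (eta t) b n) @[h --> 0^']
    --> modes v b n.
  move=> cv; split; first by apply/cvg_ex; exists (modes v b n).
  exact/cvg_lim.
apply/subr_cvg0; apply: (cvg_ereal_bound cvv).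
have Lh : \forall h \near 0^', L2 (eta (t + h)).
  suff : t + h @[h --> (0 : R)] --> t by move=> ct; apply: cvg_within; exact: ct Leta.
  by rewrite -{2}(addr0 t); apply: cvgD; [exact: cvg_cst|exact: cvg_id].
apply: filterS Lh => h Lh; rewrite scaler1 (addrC h) /GRing.scale/=.
have q1 := L2_square_integrable Lh; have q2 := L2_square_integrable Lt.
have q3 := L2_square_integrable Lv.
have qd := square_integrableB q1 q2.
have qh := square_integrableZl h^-1 qd.
have -> : (fun s => (eta (t + h) s - eta t s) / h - v s) =
  (fun s => h^-1 * (eta (t + h) s - eta t s) - v s).
  by apply/funext => s; rewrite mulrC.
rewrite -modesB; [|exact: L2_integrable|exact: L2_integrable].
rewrite -modesZl; last exact: square_integrable_integrable.
rewrite -modesB; [|exact: square_integrable_integrable|exact: L2_integrable].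
by apply: mode_le_L2norm; exact: square_integrableB.
Qed.

Lemma is_Lambda_modes (a : R) f g b n : a != 0 -> is_Lambda a f g ->
  modes g b n = n%:R `^ a * modes f b n.
Proof. by move=> a0 /(is_LambdaP _ _ a0)[_ _ hc hs]; case: b; rewrite /modes. Qed.

Lemma mode_le_Hnorm (a : R) f b n : a != 0 ->
  ((n%:R `^ a * `|modes f b n|)%:E <= Hnorm a f)%E.
Proof.
move=> a0; apply: le_ereal_inf_tmp => _ [g /= Lfg <-].
have Lg : L2 g by case: Lfg.
have := mode_le_L2norm b n (L2_square_integrable Lg).
by rewrite (is_Lambda_modes b n a0 Lfg) normrM (ger0_norm (powR_ge0 _ _)).
Qed.

Lemma equation_modes (c m gamma : R) eta (t : R) b n :
  (\forall s \near t, L2 (eta s)) -> mean (eta t) = 0 ->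
  summable_modes (modes (eta t)) -> equation_at c m gamma eta t ->
  is_derive t 1 (fun s => modes (eta s) b n.+1)
    (- (2 * c) * interaction_sum b (modes (eta t)) (modes (eta t)) n.+1 -
     damping c m gamma n.+1 * modes (eta t) b n.+1).
Proof.
move=> Leta e0 se [h [l [ds [dt [eh el eds edt eq]]]]].
have [Ldt _] := edt; have Le : L2 (eta t) by case: el.
have Ll : L2 l by case: el.
have idt := L2_integrable Ldt; have ie := L2_integrable Le; have il := L2_integrable Ll.
have iN := integrable_nonlinearity eh el eds.
have iP : circle_integrable (P0 (fun x => eta t x * l x - h x * ds x)).
  by apply: circle_integrableB => //; exact: circle_integrable_cst.
have icl := circle_integrableZl (c * m) il.
have ige := circle_integrableZl gamma ie.
have i12 := circle_integrableD idt icl.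
have i3 := circle_integrableD i12 ige.
have iR := circle_integrableZl (- c) iP.
have := ae_eq_modes b n.+1 (circle_integrable_measurable i3) (circle_integrable_measurable iR) eq.
rewrite (modesD b n.+1 i12 ige) (modesD b n.+1 idt icl).
rewrite (modesZl _ b n.+1 il) (modesZl _ b n.+1 ie) (modesZl _ b n.+1 iP) (modes_P0 b n iN) (nonlinearity_modes e0 se eh el eds).
rewrite (is_Lambda_modes b n.+1 (oner_neq0 R) el) powRr1 ?ler0n// => E.
have := mode_derivative b n.+1 Leta edt.
suff -> : modes dt b n.+1 =
  - (2 * c) * interaction_sum b (modes (eta t)) (modes (eta t)) n.+1 -
     damping c m gamma n.+1 * modes (eta t) b n.+1 by [].
rewrite /damping; move: E; move: (modes dt b n.+1) (modes (eta t) b n.+1) (interaction_sum _ _ _ _).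
by move=> x y z E; lra.
Qed.

End ModeEquation.

(** * Contraction in the weighted supremum norm *)

Section Uniqueness.
Context {R : realType}.
Variables (c m gamma r : R).
Hypotheses (c0 : 0 < c) (m0 : 0 < m) (g0 : 0 <= gamma) (hr : 3 / 2 < r).
Implicit Types (u v : bool -> nat -> R) (M P Q : R).
Local Notation rho := (rho r).
Local Notation rho_sum := (rho_sum r).

Definition rho_dominated P u := forall b n, `|u b n| <= P * rho n.

Lemma rho_dominated_ge0 P u : rho_dominated P u -> 0 <= P.
Proof.
move=> /(_ true 1%N); rewrite /rho powR1 invr1 mulr1.
by apply: le_trans.
Qed.

(** The weight satisfies [n + 2 j <= 2 (n + j)], and [(n + j) rho_(n + j) <= n rho_n]. The surviving
    factor [n] is to be divided by the damping. *)
Lemma interaction_rho_le b u v P Q n j : (0 < n)%N ->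
  rho_dominated P u -> rho_dominated Q v ->
  `|interaction b u v n j| <= 4 * P * Q * (n%:R * rho n) * rho j.
Proof.
move=> n0 uP vQ.
have P0 := rho_dominated_ge0 uP; have Q0 := rho_dominated_ge0 vQ.
have r1 := rho_ge0 r (n + j)%N; have r2 := rho_ge0 r j.
have pr b1 b2 : `|u b1 (n + j)%N * v b2 j| <= P * rho (n + j)%N * (Q * rho j).
  by rewrite normrM; apply: ler_pM.
have h : `|interaction b u v n j| <= (n + j.*2)%:R * (2 * (P * rho (n + j)%N * (Q * rho j))).
  rewrite /interaction normrM ger0_norm ?ler0n//; apply: ler_wpM2l => //.
  have := pr true true; have := pr true false; have := pr false true; have := pr false false.
  case: b; rewrite !ler_norml; lra.
apply: le_trans h _.
have h1 : (n + j.*2)%:R * rho (n + j)%N <= 2 * (n%:R * rho n).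
  apply: (@le_trans _ _ (2 * ((n + j)%:R * rho (n + j)%N))).
    rewrite mulrA; apply: ler_wpM2r => //; rewrite -natrM ler_nat; lia.
  by apply: ler_wpM2l => //; apply: natr_rho_le => //; rewrite n0 leq_addr.
have k0 : 0 <= 2 * P * Q * rho j by rewrite !mulr_ge0.
have := ler_wpM2r k0 h1; nra.
Qed.

Lemma cvg_interaction_rho b u v P Q n : (0 < n)%N ->
  rho_dominated P u -> rho_dominated Q v -> cvgn (series (interaction b u v n)).
Proof.
move=> n0 uP vQ.
refine (dominated_cvg_series (cvg_seriesZl (k := 4 * P * Q * (n%:R * rho n)) (cvg_rho hr)) _) => j.
exact: interaction_rho_le.
Qed.

Lemma interaction_sum_lipschitz b u v M om n : (0 < n)%N ->
  rho_dominated M u -> rho_dominated M v ->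
  rho_dominated om (fun b n => u b n - v b n) ->
  `|interaction_sum b u u n - interaction_sum b v v n| <=
  8 * M * om * rho_sum * (n%:R * rho n).
Proof.
move=> n0 uM vM uvom.
have cu := @cvg_interaction_rho b u u M M n n0 uM uM.
have cv := @cvg_interaction_rho b v v M M n n0 vM vM.
rewrite /interaction_sum -tsumB//.
have cr := cvg_seriesZl (k := 8 * M * om * (n%:R * rho n)) (cvg_rho hr).
have -> : 8 * M * om * rho_sum * (n%:R * rho n) =
  tsum (fun j => 8 * M * om * (n%:R * rho n) * rho j).
  by rewrite tsumZl ?/rho_sum; [ring|exact: cvg_rho].
refine (ler_norm_tsum cr _) => j.
have -> : interaction b u u n j - interaction b v v n j =
  interaction b (fun b n => u b n - v b n) u n j +
  interaction b v (fun b n => u b n - v b n) n j.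
  by rewrite /interaction; case: (b); ring.
apply: le_trans (ler_normD _ _) _.
have := @interaction_rho_le b _ _ _ _ n j n0 uvom uM.
have := @interaction_rho_le b _ _ _ _ n j n0 vM uvom; lra.
Qed.

Definition mode_equation (v : bool -> nat -> R -> R) (t : R) := forall b n,
  is_derive t 1 (v b n.+1)
    (- (2 * c) * interaction_sum b (at_time v t) (at_time v t) n.+1 -
     damping c m gamma n.+1 * v b n.+1 t).

Section contraction.
Variables (T M : R) (u v : bool -> nat -> R -> R).
Hypotheses (cu : forall b n, {within `[0, T], continuous (u b n)})
  (cv : forall b n, {within `[0, T], continuous (v b n)}).
Hypothesis uv0 : forall b n, u b n 0 = v b n 0.
Hypotheses (eu : forall t, 0 < t < T -> mode_equation u t)
  (ev : forall t, 0 < t < T -> mode_equation v t).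
Hypotheses (uM : forall t, 0 <= t <= T -> rho_dominated M (at_time u t))
  (vM : forall t, 0 <= t <= T -> rho_dominated M (at_time v t)).
Hypothesis M_small : 32 * M * rho_sum <= m.

Let dominated_diff om := forall t, 0 <= t <= T ->
  rho_dominated om (fun b n => u b n t - v b n t).

(** [duhamel_bound] is used with [mu = 0], so the gap is at least the whole [c m n]. The Lipschitz
    constant [2 c * 8 M rho_sum n], divided by it, is [16 M rho_sum / m <= 1 / 2]. This holds on the
    whole interval, whatever its length. *)
Lemma mode_contraction om : dominated_diff om -> dominated_diff (om / 2).
Proof.
move=> uvom t tT b n.
have om0 : 0 <= om by exact: rho_dominated_ge0 (uvom t tT).
have M0 : 0 <= M by exact: rho_dominated_ge0 (uM tT).
case: n => [|n].
  by have := uvom t tT b 0%N; rewrite rho0 ?mulr0//; move: hr; lra.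
have n0 : (0 < n.+1)%N by [].
pose la := damping c m gamma n.+1.
have cmn : 0 < c * m * n.+1%:R by rewrite !mulr_gt0.
have la0 : c * m * n.+1%:R <= la by rewrite /la /damping lerDl.
pose K := 2 * c * (8 * M * om * rho_sum * (n.+1%:R * rho n.+1)).
have z0 := rho_sum_ge0 r; have r0 := rho_ge0 r n.+1.
have K0 : 0 <= K by rewrite /K; do ?[apply: mulr_ge0 => //]; exact: ltW.
pose w t := u b n.+1 t - v b n.+1 t.
pose F t := - (2 * c) * interaction_sum b (at_time u t) (at_time u t) n.+1
  + 2 * c * interaction_sum b (at_time v t) (at_time v t) n.+1.
have cw : {within `[0, T], continuous w}.
  by move=> x; apply: cvgB; [exact: cu|exact: cv].
have w0 : w 0 = 0 by rewrite /w uv0 subrr.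
have dw s : 0 < s < T -> is_derive s 1 w (F s - la * w s).
  move=> sT; have h1 := eu sT b n; have h2 := ev sT b n.
  rewrite /w; apply: is_derive_eq; rewrite /F -/la; ring.
have c2 : 0 <= 2 * c by rewrite mulr_ge0// ltW.
have mu0 : 0 <= (0 : R) < la by rewrite lexx/=; exact: lt_le_trans la0.
have := @duhamel_bound R T la 0 K w _ mu0 K0 cw w0 dw.
have bd s : 0 < s < T -> `|F s - la * w s + la * w s| <= K * expR (- 0 * s).
  move=> /andP[s0 sT]; have sT' : 0 <= s <= T by rewrite !ltW.
  rewrite subrK oppr0 mul0r expR0 mulr1 /F.
  have := interaction_sum_lipschitz b n0 (uM sT') (vM sT') (uvom s sT').
  have -> : forall x y : R, - (2 * c) * x + 2 * c * y = - (2 * c * (x - y)) by move=> x y; ring.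
  move=> h; rewrite normrN normrM (ger0_norm c2).
  exact: ler_wpM2l.
move=> /(_ bd t tT); rewrite oppr0 mul0r expR0 mulr1 addr0 => h.
apply: le_trans h _; rewrite ler_pdivrMr; last exact: lt_le_trans la0.
apply: (@le_trans _ _ (om / 2 * rho n.+1 * (c * m * n.+1%:R))); last first.
  by apply: ler_wpM2l => //; rewrite !mulr_ge0.
have k0 : 0 <= om / 2 * rho n.+1 * c * n.+1%:R.
  by do ?[apply: mulr_ge0 => //]; rewrite ?invr_ge0//; exact: ltW.
have := ler_wpM2l k0 M_small; rewrite /K; lra.
Qed.

(** The difference is at most [2 M rho_n] to begin with, and the contraction halves this bound
    indefinitely. *)
Lemma mode_uniqueness t b n : 0 <= t <= T -> u b n t = v b n t.
Proof.
move=> tT.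
have h k : dominated_diff (2 * M / 2 ^+ k).
  elim: k => [|k IH]; last by rewrite exprSr invfM mulrA; exact: mode_contraction.
  rewrite expr0 divr1 => s sT b' n'.
  apply: le_trans (ler_normB _ _) _.
  have := uM sT b' n'; have := vM sT b' n'; rewrite /at_time; lra.
apply/subr0_eq/normr0_eq0/le_anti; rewrite normr_ge0 andbT.
have cv2 : 2 * M / 2 ^+ k * rho n @[k --> \oo] --> 0 * rho n.
  apply: cvgM; last exact: cvg_cst.
  rewrite -(mulr0 (2 * M)); apply: cvgM; first exact: cvg_cst.
  under eq_fun do rewrite -exprVn.
  by apply: cvg_expr; rewrite ger0_norm; lra.
rewrite -(mul0r (rho n)) -(cvg_lim _ cv2)//.
apply: limr_ge; first by apply/cvg_ex; eexists; exact: cv2.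
by apply: nearW => k; exact: h.
Qed.

End contraction.

(** * Propagation of smallness in time *)

Section bootstrap.
Variables (T M : R) (z v : bool -> nat -> R -> R).
Hypotheses (T0 : 0 < T) (M0 : 0 < M).
Hypothesis cz : forall t0, 0 <= t0 <= T -> forall e, 0 < e ->
  \forall t \near within `[0, T] (nbhs t0),
    rho_dominated e (fun b n => z b n t - z b n t0).
Hypothesis cv : family_continuous v.
Hypothesis zv0 : forall b n, z b n 0 = v b n 0.
Hypotheses (ez : forall t, 0 < t < T -> mode_equation z t)
  (ev : forall t, 0 < t < T -> mode_equation v t).
Hypothesis vM : forall t, 0 <= t <= T -> rho_dominated (M / 2) (at_time v t).
Hypothesis M_small : 32 * M * rho_sum <= m.

Lemma continuous_equicontinuous b n : {within `[0, T], continuous (z b n)}.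
Proof.
apply/subspace_continuousP => t0 /=; rewrite in_itv/= => t0T.
apply/cvgrPdist_le => e e0.
have d0 : 0 < e / (rho n + 1) by rewrite divr_gt0// ltr_wpDl// rho_ge0.
apply: filterS (cz t0T d0) => t /(_ b n) h; rewrite distrC; apply: le_trans h _.
rewrite -mulrAC ler_pdivrMr ?ler_pM2l//; first by rewrite lerDl.
by rewrite ltr_wpDl// rho_ge0.
Qed.

Let controlled t := 0 <= t <= T /\
  forall s, 0 <= s <= t -> rho_dominated M (at_time z s).

Lemma controlled_eq t b n : controlled t -> z b n t = v b n t.
Proof.
move=> [/andP[t0 tT] zM].
apply: (@mode_uniqueness t M z v) => //.
- move=> b' n'; apply: continuous_subspaceW (@continuous_equicontinuous b' n').
  by apply: subset_itvl; rewrite bnd_simp.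
- by move=> b' n'; apply: continuous_subspaceT; exact: cv.
- by move=> s /andP[s0 st]; apply: ez; rewrite s0 (lt_le_trans st).
- by move=> s /andP[s0 st]; apply: ev; rewrite s0 (lt_le_trans st).
- move=> s /andP[s0 st] b' n'; have sT : 0 <= s <= T by rewrite s0 (le_trans st).
  apply: le_trans (vM sT b' n') _; apply: ler_wpM2r; first exact: rho_ge0.
  by move: M0; lra.
- by rewrite t0 lexx.
Qed.

(* On a controlled interval [z] equals [v], which is bounded by [M / 2]; this
   leaves room for a variation of [M / 2]. *)
Lemma controlled_extend t s : controlled t -> 0 <= s <= T ->
  rho_dominated (M / 2) (fun b n => z b n s - z b n t) ->
  rho_dominated M (at_time z s).
Proof.
move=> ct sT zst b n; have [tT _] := ct.
have h1 := zst b n; have h2 := vM tT b n.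
rewrite /at_time -(controlled_eq b n ct) in h2.
rewrite /at_time -(subrK (z b n t) (z b n s)).
apply: le_trans (ler_normD _ _) _; lra.
Qed.

(** The controlled times form an interval containing [0]. Its supremum [t1] is controlled, and it
    cannot lie before [T], both by the uniform continuity of the modes at [t1]. *)
Lemma controlled_end : controlled T.
Proof.
have c00 : controlled 0.
  split=> [|s /andP[s0 s1]]; first by rewrite lexx ltW.
  have -> : s = 0 by apply/le_anti; rewrite s0 s1.
  have T00 : 0 <= (0 : R) <= T by rewrite lexx ltW.
  move=> b n; rewrite /at_time zv0; apply: le_trans (vM T00 b n) _.
  by apply: ler_wpM2r; [exact: rho_ge0|move: M0; lra].
pose S : set R := [set t | controlled t].
have hS : has_sup S.
  by split; [exists 0|exists T => t [/andP[]]].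
pose t1 := sup S.
have t10 : 0 <= t1 by apply: sup_upper_bound.
have t1T : t1 <= T by apply: ge_sup => //; [exists 0|move=> t [/andP[]]].
have before t : 0 <= t < t1 -> controlled t.
  move=> /andP[t0 tt1].
  have [s [/andP[s0 sT] hs] ts] := sup_gt (proj1 hS) tt1.
  split; first by rewrite t0 (le_trans (ltW tt1)).
  by move=> x /andP[x0 xt]; apply: hs; rewrite x0 (le_trans xt)// ltW.
have M20 : 0 < M / 2 by rewrite divr_gt0.
have t1T' : 0 <= t1 <= T by rewrite t10.
have := cz t1T' M20.
rewrite near_withinE => -[d /= d0 hd].
have ball_near s : 0 <= s <= T -> `|t1 - s| < d ->
    rho_dominated (M / 2) (fun b n => z b n s - z b n t1).
  by move=> sT sd; apply: hd => //; rewrite /= in_itv.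
have ct1 : controlled t1.
  split=> // s /andP[s0]; rewrite le_eqVlt => /predU1P[->|st1]; last first.
    by have [] := before s; rewrite ?s0//= => _ h; apply: h; rewrite s0 lexx.
  move: t10; rewrite le_eqVlt => /predU1P[<-|t10].
    by have [_ h] := c00; apply: h; rewrite lexx.
  (* A controlled time so close to [t1] that the modes vary by at most [M / 2 * rho_n] between the
     two. *)
  pose x := Num.max 0 (t1 - d / 2).
  have x0 : 0 <= x by rewrite le_max lexx.
  have xt1 : x < t1 by rewrite gt_max t10/= gtrBl divr_gt0.
  have xT : 0 <= x <= T by rewrite x0 (le_trans (ltW xt1)).
  apply: (@controlled_extend x) => //; first by apply: before; rewrite x0.
  move=> b n; rewrite distrC; apply: ball_near => //.
  rewrite ger0_norm ?subr_ge0 ?(ltW xt1)//.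
  have : t1 - d / 2 <= x by rewrite le_max lexx orbT.
  by move: d0; lra.
have [->//|t1nT] := eqVneq T t1.
have t1lT : t1 < T by rewrite lt_neqAle eq_sym t1nT.
(* Control up to this [x > t1] contradicts the choice of the supremum. *)
pose x := Num.min T (t1 + d / 2).
have xT : x <= T by rewrite ge_min lexx.
have t1x : t1 < x by rewrite lt_min t1lT/= ltrDl divr_gt0.
have x0 : 0 <= x by exact: le_trans (ltW t1x).
have : controlled x.
  split; first by rewrite x0.
  move=> s /andP[s0 sx]; have [st1|t1s] := leP s t1.
    by have [_] := ct1; apply; rewrite s0.
  apply: (controlled_extend ct1); first by rewrite s0 (le_trans sx).
  apply: ball_near; first by rewrite s0 (le_trans sx).
  rewrite distrC ger0_norm ?subr_ge0 ?(ltW t1s)//.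
  have : x <= t1 + d / 2 by rewrite ge_min lexx orbT.
  by move: d0 sx; lra.
move=> /(sup_upper_bound hS); rewrite -/t1 => h.
by move: t1x; rewrite ltNge h.
Qed.

Lemma mode_global_uniqueness t b n : 0 <= t <= T -> z b n t = v b n t.
Proof.
move=> /andP[t0 tT]; apply: controlled_eq; have [_ h] := controlled_end.
split; first by rewrite t0.
by move=> s /andP[s0 st]; apply: h; rewrite s0 (le_trans st).
Qed.

End bootstrap.

End Uniqueness.

(** * The modes of an arbitrary solution *)

Section SolutionModes.
Context {R : realType}.
Variables (c m gamma r : R).
Hypotheses (c0 : 0 < c) (m0 : 0 < m) (g0 : 0 <= gamma) (hr : 3 / 2 < r).
Implicit Types (f g : R -> R) (u : bool -> nat -> R).

Let rn0 : r != 0. Proof. by apply: lt0r_neq0; move: hr; lra. Qed.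

Lemma rho_dominated_summable P u : rho_dominated r P u -> summable_modes u.
Proof.
move=> uP.
refine (dominated_cvg_series (cvg_seriesZl (k := 2 * P) (cvg_rho hr)) _) => n.
rewrite ger0_norm ?addr_ge0//.
have := uP false n; have := uP true n; lra.
Qed.

Lemma Hnorm_rho_dominated f M : mean f = 0 -> (Hnorm r f <= M%:E)%E ->
  rho_dominated r M (modes f).
Proof.
move=> f0 fM b [|n].
  by rewrite rho0// mulr0; case: b; rewrite /modes ?fsin0 ?fcos0 ?f0 normr0.
have := le_trans (mode_le_Hnorm f b n.+1 rn0) fM; rewrite lee_fin mulrC.
by rewrite -ler_pdivlMr// powR_gt0// ltr0n.
Qed.

Lemma Hnorm_summable f : mean f = 0 -> (Hnorm r f < +oo)%E -> summable_modes (modes f).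
Proof.
move=> f0 fM; apply: (@rho_dominated_summable (fine (Hnorm r f))).
apply: Hnorm_rho_dominated => //; rewrite fineK//.
by rewrite ge0_fin_numE// Hnorm_ge0.
Qed.

Variables (T : R) (eta0 : R -> R) (zeta : R -> R -> R).
Hypotheses (T0 : 0 < T) (sol : is_solution c m gamma r T eta0 zeta).

Definition solution_modes b n (t : R) : R := modes (zeta t) b n.

(** Continuity in [H^r] controls all modes at once with the weight [n ^ r]; the bootstrap needs this
    uniformity. *)
Lemma solution_modes_equicontinuous t0 : 0 <= t0 <= T -> forall e, 0 < e ->
  \forall t \near within `[0, T] (nbhs t0),
    rho_dominated r e (fun b n => solution_modes b n t - solution_modes b n t0).
Proof.
move=> t0T e e0; have /fine_cvgP[ffin f0] := solution_continuous sol t0T.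
have h : \forall t \near within `[0, T] (nbhs t0),
    `|0 - fine (Hnorm r (fun s => zeta t s - zeta t0 s))| <= e.
  by move/cvgrPdist_le : f0; exact.
have hT : \forall t \near within `[0, T] (nbhs t0), 0 <= t <= T.
  by rewrite near_withinE; apply: nearW => t /=; rewrite in_itv.
near=> t; have tT : 0 <= t <= T by near: t.
have H1 : Hnorm r (fun s => zeta t s - zeta t0 s) \is a fin_num by near: t.
have H2 : `|0 - fine (Hnorm r (fun s => zeta t s - zeta t0 s))| <= e by near: t.
have It := L2_integrable (solution_L2 sol tT).
have It0 := L2_integrable (solution_L2 sol t0T).
have : rho_dominated r e (modes (fun s => zeta t s - zeta t0 s)).
  apply: Hnorm_rho_dominated.
    by rewrite meanB// !(solution_mean0 sol)// subrr.
  rewrite -(fineK H1) lee_fin; apply: le_trans H2.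
  by rewrite sub0r normrN ler_norm.
by move=> H3 b n; have := H3 b n; rewrite modesB.
Unshelve. all: by end_near. Qed.

Lemma solution_mode_equation t : 0 < t < T -> mode_equation c m gamma solution_modes t.
Proof.
move=> /andP[t0 tT] b n.
have tT' : 0 <= t <= T by rewrite !ltW.
apply: equation_modes.
- near=> s; apply: (solution_L2 sol); apply/andP; split; apply/ltW.
    by near: s; exact: lt_nbhsr.
  by near: s; exact: lt_nbhsl.
- exact: (solution_mean0 sol tT').
- by apply: Hnorm_summable; [exact: (solution_mean0 sol tT')|exact: (solution_Hr sol tT')].
- by apply: (solution_equation sol); rewrite t0.
Unshelve. all: by end_near. Qed.

Lemma solution_modes_start b n : L2 eta0 -> solution_modes b n 0 = modes eta0 b n.
Proof.
move=> L0; apply: ae_eq_modes; last exact: (solution_initial sol).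
  have : L2 (zeta 0) by apply: (solution_L2 sol); rewrite lexx ltW.
  by case.
by case: L0.
Qed.

End SolutionModes.

(** * From modes to functions *)

Section Synthesis.
Context {R : realType}.
Implicit Types (u : bool -> nat -> R) (a x : R).

(** Half of the exponential absorbs the power, through [y ^ (p + 1) / (p + 1)! <= exp y] at
    [y = x n / 2], and the other half is geometric. At positive times this makes every multiplier
    [n ^ a] applicable to the solution. *)
Lemma cvg_series_powR_expR a x : 0 < x ->
  cvgn (series (fun n => n%:R `^ a * expR (- (x * n%:R)))).
Proof.
move=> x0; pose q := expR (- (x / 2)); pose p := Num.truncn `|a|.
pose C := p.+1`!%:R * (2 / x) ^+ p.+1.
have C0 : 0 <= C by rewrite mulr_ge0// exprn_ge0// divr_ge0// ltW.
(* The [+ 1] covers [n = 0], where the power is [1] if [a = 0]. *)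
have cq : cvgn (series (geometric (C + 1) q)).
  apply: is_cvg_geometric_series; rewrite ger0_norm ?expR_ge0//.
  by rewrite expR_lt1 oppr_lt0 divr_gt0.
refine (dominated_cvg_series cq _) => n.
rewrite ger0_norm ?mulr_ge0 ?powR_ge0 ?expR_ge0// /geometric/=.
have -> : q ^+ n = expR (- (x * n%:R)) * expR (x / 2 * n%:R).
  by rewrite -expRD /q -expRM_natl; congr expR; lra.
rewrite mulrCA [leLHS]mulrC; apply: ler_wpM2l; first exact: expR_ge0.
case: n => [|n].
  rewrite mulr0 expR0 mulr1; apply: (@le_trans _ _ 1); last by rewrite lerDr.
  by have [->|a0] := eqVneq a 0; rewrite ?powRr0// powR0.
have n1 : 1 <= n.+1%:R :> R by rewrite ler1n.
have h1 : n.+1%:R `^ a <= n.+1%:R ^+ p.+1 :> R.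
  rewrite -powR_mulrn ?ler0n//; apply: ler_powR => //.
  apply: le_trans (ler_norm a) _; apply: ltW.
  by have /andP[] := truncn_itv (normr_ge0 a).
have y0 : 0 <= x / 2 * n.+1%:R by rewrite mulr_ge0// divr_ge0// ltW.
have h2 := expR_ge1Dxn p y0.
apply: le_trans h1 _.
have -> : n.+1%:R ^+ p.+1 = C * ((x / 2 * n.+1%:R) ^+ p.+1 / p.+1`!%:R).
  have e : forall k y z : R, 0 < k -> k * y * (z / k) = y * z.
    by move=> k y z /lt0r_neq0 kn0; field.
  rewrite /C e// -exprMn; congr (_ ^+ _).
  by move: x0 => /lt0r_neq0 xn0; field.
apply: (@le_trans _ _ (C * expR (x / 2 * n.+1%:R))); last by apply: ler_wpM2r => //; rewrite lerDl.
by apply: ler_wpM2l => //; move: h2; lra.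
Qed.

(** The factor [2] compensates the normalization of [fcos] and [fsin], so that the modes of
    [synthesis u] are [u]. *)
Definition synthesis u : R -> R :=
  trig_series (fun n => 2 * u false n) (fun n => 2 * u true n).

Definition scaled a u b n : R := n%:R `^ a * u b n.

Definition hilbert_modes u b n : R := if b then u false n else - u true n.

Definition derivative_modes u b n : R :=
  if b then - (n%:R * u false n) else n%:R * u true n.

Lemma summable_modes_le u v : (forall b n, `|u b n| <= `|v false n| + `|v true n|) ->
  summable_modes v -> summable_modes u.
Proof.
move=> uv sv; refine (dominated_cvg_series (cvg_seriesZl (k := 2) sv) _) => n.
rewrite ger0_norm ?addr_ge0//; have := uv false n; have := uv true n; lra.
Qed.

Section static.
Variable u : bool -> nat -> R.
Hypotheses (u0 : forall b, u b 0%N = 0) (su : summable_modes u).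

Lemma summable_double : abs_summable (fun n => 2 * u false n) (fun n => 2 * u true n).
Proof.
have := cvg_seriesZl (k := 2) su; rewrite /abs_summable.
under eq_fun do rewrite mulrDr -{1 2}(@ger0_norm _ 2)// -!normrM.
by [].
Qed.

Lemma continuous_synthesis : continuous (synthesis u).
Proof. exact: continuous_trig_series summable_double. Qed.

Lemma L2_synthesis : L2 (synthesis u).
Proof. exact: L2_trig_series summable_double. Qed.

Lemma modes_synthesis b n : modes (synthesis u) b n = u b n.
Proof.
have h := summable_double.
by case: b; rewrite /modes /synthesis ?trig_series_fsin ?trig_series_fcos ?u0 ?mulr0//;
  lra.
Qed.

Lemma mean_synthesis : mean (synthesis u) = 0.
Proof. by rewrite -fcos0 -/(modes _ false 0) modes_synthesis. Qed.

End static.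

Lemma is_Lambda_synthesis a u : a != 0 -> (forall b, u b 0%N = 0) ->
  summable_modes u -> summable_modes (scaled a u) ->
  is_Lambda a (synthesis u) (synthesis (scaled a u)).
Proof.
move=> a0 u0 su sau; apply/(is_LambdaP _ _ a0).
have v0 b : scaled a u b 0 = 0 by rewrite /scaled u0 mulr0.
split; [exact: L2_synthesis|exact: L2_synthesis| |] => n.
  rewrite -/(modes (synthesis u) false n) (modes_synthesis u0 su).
  exact: (modes_synthesis v0 sau false n).
rewrite -/(modes (synthesis u) true n) (modes_synthesis u0 su).
exact: (modes_synthesis v0 sau true n).
Qed.

Lemma is_Hilbert_synthesis u : (forall b, u b 0%N = 0) -> summable_modes u ->
  is_Hilbert (synthesis u) (synthesis (hilbert_modes u)).
Proof.
move=> u0 su.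
have sh : summable_modes (hilbert_modes u).
  by apply: summable_modes_le su => b n; case: b; rewrite /= ?normrN ?lerDl ?lerDr.
have h0 b : hilbert_modes u b 0 = 0 by case: b; rewrite /= u0 ?oppr0.
apply/is_HilbertP; split; [exact: L2_synthesis|exact: L2_synthesis| | |].
- exact: mean_synthesis.
- move=> n; rewrite -/(modes (synthesis u) true n.+1) (modes_synthesis u0 su).
  exact: (modes_synthesis h0 sh false n.+1).
- move=> n; rewrite -/(modes (synthesis u) false n.+1) (modes_synthesis u0 su).
  exact: (modes_synthesis h0 sh true n.+1).
Qed.

Lemma weak_derivative_synthesis u : summable_modes u -> summable_modes (scaled 1 u) ->
  is_weak_derivative (synthesis u) (synthesis (derivative_modes u)).
Proof.
move=> su s1u.
have sd : summable_modes (derivative_modes u).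
  apply: summable_modes_le s1u => b n; rewrite /scaled powRr1 ?ler0n//.
  by case: b; rewrite /= ?normrN ?lerDl ?lerDr.
have -> : synthesis (derivative_modes u) =
   trig_series (fun n => n%:R * (2 * u true n)) (fun n => - (n%:R * (2 * u false n))).
  by congr trig_series; apply/funext => n; rewrite /=; ring.
apply: weak_derivative_trig_series; first exact: summable_double.
have := summable_double sd; rewrite /abs_summable/=.
suff -> : (fun n => `|2 * (n%:R * u true n)| + `|2 * - (n%:R * u false n)|) =
  (fun n => `|n%:R * (2 * u true n)| + `|- (n%:R * (2 * u false n))|) by [].
by apply/funext => n; rewrite mulrN !(mulrCA 2).
Qed.

End Synthesis.

Section EvolutionAux.
Context {R : realType}.

Lemma cvg_ereal_squeeze0 {T : Type} (F : set_system T) {FF : Filter F}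
    (f : T -> \bar R) (g : T -> R) :
  (\forall x \near F, (0 <= f x <= (g x)%:E)%E) -> g x @[x --> F] --> (0 : R) ->
  f x @[x --> F] --> 0%E.
Proof.
move=> fg g0; apply: (squeeze_cvge fg); first exact: cvg_cst.
by apply: cvg_EFin => //; exact: nearW.
Qed.

Lemma tsum_cst0 : tsum (fun=> 0 : R) = 0.
Proof.
have -> : (fun=> 0) = (fun _ : nat => 0 * 0 : R) by apply/funext => n; rewrite mulr0.
have c0 : cvgn (series (fun _ : nat => 0 : R)).
  by refine (dominated_cvg_series (@cvg_rho R 2 _) _) => [|j]; [lra|rewrite normr0 rho_ge0].
by rewrite (tsumZl 0 c0) mul0r.
Qed.

Lemma sqr_le_norm (x y : R) : `|x| <= y -> x ^+ 2 <= y ^+ 2.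
Proof. by rewrite ler_norml => /andP[h1 h2]; nra. Qed.

Lemma cvg_sqrt0 {T : Type} (F : set_system T) {FF : Filter F} (k : R) (g : T -> R) :
  g x @[x --> F] --> (0 : R) -> Num.sqrt (k * g x) @[x --> F] --> (0 : R).
Proof.
move=> cg; have ck : k * g x @[x --> F] --> k * 0 by apply: cvgM; [exact: cvg_cst|].
rewrite mulr0 in ck; rewrite -(sqrtr0 R).
exact: (cvg_comp _ _ ck (@sqrt_continuous R 0)).
Qed.

End EvolutionAux.

(** * The evolution as a curve in the Sobolev class *)

Section Evolution.
Context {R : realType}.
Variables (c m gamma r A : R).
Hypotheses (c0 : 0 < c) (m0 : 0 < m) (g0 : 0 <= gamma) (hr : 3 / 2 < r).
Hypothesis A0 : 0 <= A.
Variables (v : bool -> nat -> R -> R) (be : nat -> R).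
Hypotheses (v0 : forall b t, v b 0%N t = 0) (cv : family_continuous v).
Hypotheses (vbe : dominated c m v be) (bM : rho_bounded r (2 * A) be).
Hypothesis bS : forall N, \sum_(0 <= n < N) (n%:R `^ r * be n) ^+ 2 <= 4 * A ^+ 2.

Local Notation rate := (rate c m).
Local Notation decay := (decay c m).
Implicit Types (t : R) (b : bool) (n : nat).

Definition evolution t : R -> R := synthesis (at_time v t).

Let rn0 : r != 0. Proof. by apply: lt0r_neq0; move: hr; lra. Qed.

Let rate0 : 0 < rate. Proof. by rewrite divr_gt0// mulr_gt0. Qed.

Lemma envelope_ge0 n : 0 <= be n.
Proof. by have /andP[] := bM n. Qed.

Lemma at_time_bound b n t : `|v b n t| <= be n.
Proof.
apply: le_trans (vbe b n t) _; apply: ler_piMr; first exact: envelope_ge0.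
exact: decay_le1.
Qed.

Lemma at_time_rho_dominated t : rho_dominated r (2 * A) (at_time v t).
Proof.
by move=> b n; apply: le_trans (at_time_bound b n t) _; have /andP[] := bM n.
Qed.

Lemma at_time0 t b : at_time v t b 0%N = 0. Proof. exact: v0. Qed.

Lemma summable_at_time t : summable_modes (at_time v t).
Proof. exact (rho_dominated_summable hr (at_time_rho_dominated t)). Qed.

Lemma envelope_le n : be n <= 2 * A.
Proof.
have /andP[_ h] := bM n; apply: le_trans h _; rewrite -[leRHS]mulr1.
apply: ler_wpM2l; first by rewrite mulr_ge0.
have := natr_rho_le1 hr n; have := rho_ge0 r n; case: n => [|n] h1 h2.
  by rewrite rho0.
have : 1 <= n.+1%:R :> R by rewrite ler1n.
nra.
Qed.

Lemma scaled_at_time_le a t b n : 0 <= t ->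
  `|scaled a (at_time v t) b n| <= 2 * A * (n%:R `^ a * expR (- (rate * t * n%:R))).
Proof.
move=> t0; rewrite /scaled normrM ger0_norm ?powR_ge0// mulrCA.
apply: ler_wpM2l; first exact: powR_ge0.
apply: le_trans (vbe b n t) _.
have -> : expR (- (rate * t * n%:R)) = decay n t.
  by rewrite /decay ger0_norm//; congr expR; ring.
by apply: ler_wpM2r; [exact: expR_ge0|exact: envelope_le].
Qed.

Lemma summable_scaled_at_time a t : 0 < t -> summable_modes (scaled a (at_time v t)).
Proof.
move=> t0; have x0 : 0 < rate * t by rewrite mulr_gt0.
refine (dominated_cvg_series (cvg_seriesZl (k := 4 * A) (@cvg_series_powR_expR _ a _ x0)) _) => n.
rewrite ger0_norm ?addr_ge0//.
have := scaled_at_time_le a false n (ltW t0).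
have := scaled_at_time_le a true n (ltW t0); lra.
Qed.

Lemma modes_evolution t b n : modes (evolution t) b n = v b n t.
Proof. by rewrite modes_synthesis//; [exact: at_time0|exact: summable_at_time]. Qed.

Lemma fcos_evolution t n : fcos (evolution t) n = v false n t.
Proof. exact: modes_evolution t false n. Qed.

Lemma fsin_evolution t n : fsin (evolution t) n = v true n t.
Proof. exact: modes_evolution t true n. Qed.

Lemma L2_evolution t : L2 (evolution t).
Proof. exact: (L2_synthesis (@summable_at_time t)). Qed.

Lemma mean_evolution t : mean (evolution t) = 0.
Proof. by rewrite mean_synthesis//; [exact: at_time0|exact: summable_at_time]. Qed.

Lemma continuous_evolution t : continuous (evolution t).
Proof. exact: (continuous_synthesis (@summable_at_time t)). Qed.

Lemma evolution_Lambda_gt0 a t : a != 0 -> 0 < t ->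
  is_Lambda a (evolution t) (synthesis (scaled a (at_time v t))).
Proof.
move=> a0 t0; apply: is_Lambda_synthesis => //; first exact: at_time0.
  exact: summable_at_time.
exact: summable_scaled_at_time.
Qed.

Lemma cvg_envelope_sobolev k : cvgn (series (fun n => k * (n%:R `^ r * be n) ^+ 2)).
Proof.
apply: cvg_seriesZl.
have h : forall N, series (fun n => (n%:R `^ r * be n) ^+ 2) N <= 4 * A ^+ 2 by [].
by have [] := bounded_cvg_series (fun n => sqr_ge0 _) h.
Qed.

Lemma sobolev_sum_evolution t N : sobolev_sum r (evolution t) N <= 8 * A ^+ 2.
Proof.
apply: (@le_trans _ _ (\sum_(0 <= n < N) 2 * (n%:R `^ r * be n) ^+ 2)).
  apply: ler_sum => n _; rewrite fcos_evolution fsin_evolution exprMn mulrCA.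
  apply: ler_wpM2l; first exact: sqr_ge0.
  have := sqr_le_norm (at_time_bound true n t).
  have := sqr_le_norm (at_time_bound false n t); lra.
rewrite -mulr_sumr; have := bS N; lra.
Qed.

(** At positive times the scaled series converges absolutely and represents [Lambda ^ r]. At time
    [0] the modes need not decay exponentially, and the representative must come from the datum. *)
Hypothesis start_Hr : exists g, is_Lambda r (evolution 0) g.

Lemma evolution_Lambda t : 0 <= t -> exists g, is_Lambda r (evolution t) g.
Proof.
rewrite le_eqVlt => /predU1P[<-//|t0].
by exists (synthesis (scaled r (at_time v t))); exact: evolution_Lambda_gt0.
Qed.

Lemma Hnorm_evolution_le t : 0 <= t ->
  (Hnorm r (evolution t) <= (Num.sqrt (4 * pi * (8 * A ^+ 2)))%:E)%E.
Proof.
move=> t0; have [g Lg] := evolution_Lambda t0.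
by apply: (Hnorm_le rn0 Lg) => N; exact: sobolev_sum_evolution.
Qed.

(** Every mode is continuous, and the weighted squares of the differences are dominated by
    [8 (n ^ r be_n) ^ 2], which is summable and independent of time; [tannery] concludes. *)
Lemma evolution_continuous T t0 : 0 <= t0 ->
  Hnorm r (fun s => evolution t s - evolution t0 s)
    @[t --> within `[0, T]%classic (nbhs t0)] --> 0%E.
Proof.
move=> t00.
pose D t n := (n%:R `^ r) ^+ 2 *
  ((v false n t - v false n t0) ^+ 2 + (v true n t - v true n t0) ^+ 2).
have vd b n t : `|v b n t - v b n t0| <= 2 * be n.
  apply: le_trans (ler_normB _ _) _.
  have := at_time_bound b n t; have := at_time_bound b n t0; lra.
have DM t n : `|D t n| <= 8 * (n%:R `^ r * be n) ^+ 2.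
  rewrite ger0_norm ?mulr_ge0 ?addr_ge0 ?sqr_ge0// /D exprMn mulrCA.
  apply: ler_wpM2l; first exact: sqr_ge0.
  have := sqr_le_norm (vd false n t); have := sqr_le_norm (vd true n t); lra.
have D0 t n : 0 <= D t n by rewrite mulr_ge0 ?addr_ge0 ?sqr_ge0.
have cM := @cvg_envelope_sobolev 8.
have cD : tsum (D t) @[t --> t0] --> tsum (fun=> 0 : R).
  apply: (tannery (F := nbhs t0) cM); first by apply: nearW => t; exact: DM.
  move=> n.
  have -> : 0 = (n%:R `^ r) ^+ 2 * (0 ^+ 2 + 0 ^+ 2) :> R by rewrite expr0n addr0 mulr0.
  apply: cvgM; first exact: cvg_cst.
  have h b : v b n t - v b n t0 @[t --> t0] --> 0.
    by apply/subr_cvg0; exact: cv.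
  by apply: cvgD; rewrite expr2; under eq_fun do rewrite expr2; apply: cvgM.
apply: (@cvg_ereal_squeeze0 _ _ _ _ _ (fun t => Num.sqrt (4 * pi * tsum (D t)))); last first.
  by apply: cvg_within_filter; apply: cvg_sqrt0; rewrite -tsum_cst0.
rewrite near_withinE; apply: nearW => t /=; rewrite in_itv/= => /andP[t_ge0 _].
rewrite Hnorm_ge0/=.
have [g Lg] := evolution_Lambda t_ge0; have [h Lh] := evolution_Lambda t00.
have [L1 L2' g1 g2] := (is_LambdaP _ _ rn0).1 Lg.
have [L3 L4 h1 h2] := (is_LambdaP _ _ rn0).1 Lh.
have I1 := L2_integrable L1; have I2 := L2_integrable L2'.
have I3 := L2_integrable L3; have I4 := L2_integrable L4.
have L2B (f f' : R -> R) : L2 f -> L2 f' -> L2 (fun s => f s - f' s).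
  move=> /L2P[pf qf] /L2P[pf' qf']; apply/L2P; split.
    by move=> s; rewrite pf pf'.
  exact: square_integrableB.
have Lgh : is_Lambda r (fun s => evolution t s - evolution t0 s) (fun s => g s - h s).
  apply/(is_LambdaP _ _ rn0); split; [exact: L2B|exact: L2B| |] => n.
    by rewrite !fcosB// g1 h1 mulrBr.
  by rewrite !fsinB// g2 h2 mulrBr.
apply: (Hnorm_le rn0 Lgh) => N.
have cDt := dominated_cvg_series cM (DM t).
apply: le_trans (series_le_tsum N cDt (D0 t)).
by rewrite /series/= /sobolev_sum; apply: ler_sum => n _;
  rewrite fcosB// fsinB// !fcos_evolution !fsin_evolution.
Qed.

End Evolution.

(** * The evolution satisfies the equation *)

Section EvolutionEquation.
Context {R : realType}.
Variables (c m gamma r A : R).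
Hypotheses (c0 : 0 < c) (m0 : 0 < m) (g0 : 0 <= gamma) (hr : 3 / 2 < r).
Hypothesis A0 : 0 <= A.
Variables (v : bool -> nat -> R -> R) (be : nat -> R).
Hypotheses (v0 : forall b t, v b 0%N t = 0) (cv : family_continuous v).
Hypotheses (vbe : dominated c m v be) (bM : rho_bounded r (2 * A) be).

Local Notation rate := (rate c m).
Local Notation decay := (decay c m).
Local Notation damping := (damping c m gamma).
Local Notation evolution := (evolution v).
Implicit Types (t h : R) (b : bool) (n : nat).

Definition drift t b n := forcing c v b n t - damping n * v b n t.

Hypothesis be_majorant : forall n, majorant be be n.+1 <= m * n.+1%:R / 4 * be n.+1.
Hypothesis dvE : forall b n t, 0 < t -> is_derive t 1 (v b n) (drift t b n).

Let rate0 : 0 < rate. Proof. by rewrite divr_gt0// mulr_gt0. Qed.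

Let A2 : 0 <= 2 * A. Proof. by rewrite mulr_ge0. Qed.

Let B : R := (2 * (c * m) + gamma) * (2 * A).

Let B0 : 0 <= B.
Proof. by rewrite mulr_ge0// addr_ge0// mulr_ge0// mulr_ge0 ?ltW. Qed.

Lemma interaction_sum_le b n t :
  `|interaction_sum b (at_time v t) (at_time v t) n| <= majorant be be n * decay n t.
Proof.
have cM := @cvg_majorant _ _ hr _ _ _ _ n A2 bM bM.
rewrite mulrC /majorant -tsumZl//; refine (ler_norm_tsum (cvg_seriesZl (k := decay n t) cM) _) => j.
rewrite mulrC; apply: interaction_le => //; exact: (envelope_ge0 bM).
Qed.

Lemma drift0 t b : drift t b 0 = 0.
Proof. by rewrite /drift /forcing eqxx v0 mulr0 subrr. Qed.

(** By [be_majorant] the forcing is at most [c m n / 2 * be n * decay n t], and the damping is at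
    most [(c m + gamma) n] for [n >= 1]. The envelope [be n] is bounded by [2 A], and [B] collects
    these constants, rounded up. *)
Lemma drift_le t b n : `|drift t b n| <= B * (n%:R * decay n t).
Proof.
case: n => [|n]; first by rewrite drift0 normr0 mul0r mulr0.
have d0 := decay_ge0 c m n.+1 t.
have e0 := envelope_ge0 bM n.+1.
have e1 := envelope_le hr A0 bM n.+1.
have n1 : 1 <= n.+1%:R :> R by rewrite ler1n.
have h1 := vbe b n.+1 t.
have h2 := interaction_sum_le b n.+1 t.
have h3 : majorant be be n.+1 * decay n.+1 t <= m * n.+1%:R / 4 * be n.+1 * decay n.+1 t.
  exact: ler_wpM2r.
rewrite /drift /forcing/=; apply: le_trans (ler_normB _ _) _.
rewrite !normrM normrN normrM (@ger0_norm _ 2)// (@ger0_norm _ c) ?(ltW c0)//.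
have dam0 : 0 <= damping n.+1 by rewrite /damping addr_ge0// !mulr_ge0 ?ltW.
rewrite (ger0_norm dam0).
have k1 : 0 <= 2 * c by rewrite mulr_ge0 ?ltW.
have q1 := ler_wpM2l k1 (le_trans h2 h3).
have q2 := ler_wpM2l dam0 h1.
have dn : damping n.+1 <= (c * m + gamma) * n.+1%:R by have := ler_wpM2l g0 n1; rewrite /damping; lra.
have bd0 : 0 <= be n.+1 * decay n.+1 t by rewrite mulr_ge0.
have q3 := ler_wpM2r bd0 dn.
have k3 : 0 <= (2 * (c * m) + gamma) * n.+1%:R * decay n.+1 t.
  by rewrite !mulr_ge0// addr_ge0// mulr_ge0// mulr_ge0 ?ltW.
have q4 := ler_wpM2l k3 e1.
have k5 : 0 <= c * m * n.+1%:R * (be n.+1 * decay n.+1 t).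
  by apply: mulr_ge0 => //; apply: mulr_ge0 => //; apply: mulr_ge0; exact: ltW.
rewrite /B; lra.
Qed.

Lemma summable_drift t : 0 < t -> summable_modes (drift t).
Proof.
move=> t0; have x0 : 0 < rate * t by rewrite mulr_gt0.
refine (dominated_cvg_series (cvg_seriesZl (k := 2 * B) (@cvg_series_powR_expR _ 1 _ x0)) _) => n.
rewrite ger0_norm ?addr_ge0// powRr1 ?ler0n//.
have h1 := drift_le t false n; have h2 := drift_le t true n.
have e : expR (- (rate * t * n%:R)) = decay n t.
  by rewrite /decay gtr0_norm//; congr expR; ring.
by rewrite e; lra.
Qed.

Lemma decay_le n (x y : R) : 0 <= x <= y -> decay n y <= decay n x.
Proof.
move=> /andP[x0 xy]; rewrite /decay ler_expR !ger0_norm//; last exact: le_trans xy.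
by rewrite !mulNr lerN2; apply: ler_wpM2l => //; apply: mulr_ge0 => //; exact: ltW.
Qed.

Lemma mode_lipschitz b n (x y : R) : 0 < x -> x < y ->
  `|v b n y - v b n x| <= B * (n%:R * decay n x) * (y - x).
Proof.
move=> x0 xy.
have dv z : z \in `]x, y[ -> is_derive z 1 (v b n) (drift z b n).
  by rewrite in_itv/= => /andP[xz _]; apply: dvE; exact: lt_trans xz.
have cvn : {within `[x, y], continuous (v b n)} by apply: continuous_subspaceT; exact: cv.
have [z zxy ->] := MVT xy dv cvn.
have yx0 : 0 <= y - x by rewrite subr_ge0 ltW.
rewrite normrM (ger0_norm yx0); apply: ler_wpM2r => //.
apply: le_trans (drift_le z b n) _; apply: ler_wpM2l => //; apply: ler_wpM2l => //.
by apply: decay_le; move: zxy; rewrite in_itv/= => /andP[xz _]; rewrite !ltW.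
Qed.

(** For [|h| < t / 2] all intermediate times exceed [t / 2], so that the decay at [t / 2] bounds the
    quotients uniformly in [h]. *)
Lemma difference_quotient_le b n t h : 0 < t -> `|h| < t / 2 -> h != 0 ->
  `|(v b n (t + h) - v b n t) / h| <= B * (n%:R * decay n (t / 2)).
Proof.
move=> t0 ht hn0.
have dd (x : R) : t / 2 <= x -> decay n x <= decay n (t / 2).
  by move=> tx; apply: decay_le; rewrite tx andbT divr_ge0// ltW.
have key (x : R) : t / 2 <= x ->
    B * (n%:R * decay n x) * `|h| <= B * (n%:R * decay n (t / 2)) * `|h|.
  move=> tx; apply: ler_wpM2r => //; apply: ler_wpM2l => //; apply: ler_wpM2l => //.
  exact: dd.
rewrite normrM normfV ler_pdivrMr ?normr_gt0//.
move: ht; rewrite ltr_norml => /andP[h1 h2].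
have [hp|hn|h00] := ltgtP h 0.
- apply: le_trans (key (t + h) _); last by lra.
  rewrite distrC (ltr0_norm hp).
  have := @mode_lipschitz b n (t + h) t.
  have -> : t - (t + h) = - h by ring.
  by apply; lra.
- apply: le_trans (key t _); last by lra.
  rewrite (gtr0_norm hn).
  have := @mode_lipschitz b n t (t + h).
  have -> : t + h - t = h by ring.
  by apply; lra.
- by rewrite h00 eqxx in hn0.
Qed.

(** Parseval's inequality turns the L^2 error of the difference quotient into a series over the
    modes. Each term tends to [0], and [tannery] applies thanks to the exponential decay. *)
Lemma evolution_time_derivative t : 0 < t ->
  is_time_derivative evolution t (synthesis (drift t)).
Proof.
move=> t0.
have sd := summable_drift t0.
have Ld : L2 (synthesis (drift t)) by exact: L2_synthesis.
split=> //.
pose D h b n := (v b n (t + h) - v b n t) / h - drift t b n.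
pose E h n := D h false n ^+ 2 + D h true n ^+ 2.
have E0 h n : 0 <= E h n by rewrite addr_ge0 ?sqr_ge0.
have x0 : 0 < rate * t by rewrite mulr_gt0.
(* Twice the square of [2 B n * decay n (t / 2)], the decay squared being [exp (- rate t n)]. *)
pose M n := 8 * B ^+ 2 * (n%:R `^ 2%:R * expR (- (rate * t * n%:R))).
have cM : cvgn (series M) by exact: (cvg_seriesZl (@cvg_series_powR_expR _ 2%:R _ x0)).
have DB h b n : `|h| < t / 2 -> h != 0 -> `|D h b n| <= 2 * B * (n%:R * decay n (t / 2)).
  move=> ht hn0; apply: le_trans (ler_normB _ _) _.
  have h1 := difference_quotient_le b n t0 ht hn0.
  have h2 := drift_le t b n.
  have h3 : decay n t <= decay n (t / 2).
    by apply: decay_le; apply/andP; split; move: t0; lra.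
  have k0 : 0 <= B * n%:R by rewrite mulr_ge0.
  have := ler_wpM2l k0 h3; lra.
have EM h n : `|h| < t / 2 -> h != 0 -> `|E h n| <= M n.
  move=> ht hn0; rewrite ger0_norm// /E /M.
  have -> : 8 * B ^+ 2 * (n%:R `^ 2%:R * expR (- (rate * t * n%:R))) =
      2 * (2 * B * (n%:R * decay n (t / 2))) ^+ 2.
    rewrite powR_mulrn ?ler0n//.
    have t20 : 0 <= t / 2 by rewrite divr_ge0// ltW.
    have -> : expR (- (rate * t * n%:R)) = decay n (t / 2) ^+ 2.
      rewrite /decay -expRM_natl ger0_norm//; congr expR; lra.
    by ring.
  have := sqr_le_norm (DB h false n ht hn0); have := sqr_le_norm (DB h true n ht hn0); lra.
have small : \forall h \near (0 : R)^', `|h| < t / 2 /\ h != 0.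
  near=> h; split.
    by near: h; apply: dnbhs0_lt; rewrite divr_gt0.
  by near: h; exact: nbhs_dnbhs_neq.
have cE : tsum (E h) @[h --> (0 : R)^'] --> tsum (fun=> 0 : R).
  apply: (tannery (F := (0 : R)^') cM).
    by apply: filterS small => h [h1 h2] n; exact: EM.
  move=> n.
  have cD b : D h b n @[h --> (0 : R)^'] --> 0.
    apply/subr_cvg0.
    have [dv1 dv2] := dvE b n t0.
    move: dv1; rewrite /derivable => /cvg_ex[l cl].
    have le : l = drift t b n by rewrite -dv2 /derive; apply/esym/cvg_lim.
    rewrite -le; move: cl; apply: cvg_trans; apply: near_eq_cvg.
    by apply: nearW => h /=; rewrite scaler1 (addrC h) /GRing.scale/= mulrC.
  have sq b : D h b n ^+ 2 @[h --> (0 : R)^'] --> (0 * 0 : R).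
    by under eq_fun do rewrite expr2; apply: cvgM.
  by have := cvgD (sq false) (sq true); rewrite mulr0 addr0; apply.
apply: (@cvg_ereal_squeeze0 _ _ _ _ _ (fun h => Num.sqrt (4 * pi * tsum (E h)))); last first.
  by apply: cvg_sqrt0; rewrite tsum_cst0 in cE.
apply: filterS small => h [h1 h2]; rewrite L2norm_ge0/=.
have q x := L2_square_integrable (L2_evolution c0 m0 hr vbe bM x).
have L x := L2_integrable (L2_evolution c0 m0 hr vbe bM x).
have qd := L2_square_integrable Ld; have id' := L2_integrable Ld.
have qdiff := square_integrableB (q (t + h)) (q t).
have idiff := circle_integrableB (L (t + h)) (L t).
have qq := square_integrableZl h^-1 qdiff.
have iq := circle_integrableZl h^-1 idiff.
have eqf : (fun s => (evolution (t + h) s - evolution t s) / h - synthesis (drift t) s) =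
    (fun s => h^-1 * (evolution (t + h) s - evolution t s) - synthesis (drift t) s).
  by apply/funext => s; rewrite mulrC.
have mE b n : modes (fun s => h^-1 * (evolution (t + h) s - evolution t s) -
    synthesis (drift t) s) b n = D h b n.
  rewrite (modesB b n iq id') (modesZl _ b n idiff) (modesB b n (L _) (L _)) !(modes_evolution c0 m0 hr v0 vbe bM).
  by rewrite modes_synthesis//; [rewrite mulrC|exact: drift0].
rewrite eqf L2norm_square_integrable; last exact: square_integrableB.
rewrite lee_fin; apply: ler_wsqrtr.
apply: parseval_le; first exact: square_integrableB.
  by have := mE false 0%N; rewrite /modes => ->; rewrite /D !v0 drift0 subrr mul0r subrr.
move=> N; have cEh := dominated_cvg_series cM (fun n => EM h n h1 h2).
apply: le_trans (series_le_tsum N cEh (E0 h)).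
rewrite /series/=; apply: ler_sum => n _.
by have := mE false n; have := mE true n; rewrite /modes => -> ->.
Unshelve. all: by end_near. Qed.

(** For [t > 0] all the series involved converge absolutely, so both sides are continuous functions
    with the same modes, and [ae_eq_circle_fourier] identifies them. *)
Lemma evolution_equation t : 0 < t -> equation_at c m gamma evolution t.
Proof.
move=> t0.
have u0 b : at_time v t b 0%N = 0 by exact: v0.
have su : summable_modes (at_time v t) by exact: (@summable_at_time _ _ _ _ _ c0 m0 hr _ _ vbe bM t).
have s1u : summable_modes (scaled 1 (at_time v t)).
  exact: (@summable_scaled_at_time _ _ _ _ _ c0 m0 hr A0 _ _ vbe bM 1 t t0).
have sd := summable_drift t0.
pose h := synthesis (hilbert_modes (at_time v t)).
pose l := synthesis (scaled 1 (at_time v t)).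
pose ds := synthesis (derivative_modes (at_time v t)).
pose dt := synthesis (drift t).
have eh : is_Hilbert (evolution t) h by exact: is_Hilbert_synthesis.
have el : is_Lambda 1 (evolution t) l by apply: is_Lambda_synthesis => //; exact: oner_neq0.
have eds : is_weak_derivative (evolution t) ds by exact: weak_derivative_synthesis.
have edt := evolution_time_derivative t0.
exists h, l, ds, dt; split=> //.
have sh : summable_modes (hilbert_modes (at_time v t)).
  by apply: summable_modes_le su => b n; case: b; rewrite /= ?normrN ?lerDl ?lerDr.
have sds : summable_modes (derivative_modes (at_time v t)).
  apply: summable_modes_le s1u => b n; rewrite /scaled powRr1 ?ler0n//.
  by case: b; rewrite /= ?normrN ?lerDl ?lerDr.
have ce : continuous (evolution t) by exact: (@continuous_evolution _ _ _ _ _ c0 m0 hr _ _ vbe bM t).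
have ch := continuous_synthesis sh; have cl := continuous_synthesis s1u.
have cds := continuous_synthesis sds; have cdt := continuous_synthesis sd.
pose N s := evolution t s * l s - h s * ds s.
have cN : continuous N.
  by move=> s; apply: cvgB; apply: cvgM; [exact: ce|exact: cl|exact: ch|exact: cds].
have cL : continuous (fun s => dt s + c * m * l s + gamma * evolution t s).
  move=> s; apply: cvgD; first apply: cvgD; first exact: cdt.
    by apply: cvgM; [exact: cvg_cst|exact: cl].
  by apply: cvgM; [exact: cvg_cst|exact: ce].
have cP : continuous (P0 N) by move=> s; apply: cvgB; [exact: cN|exact: cvg_cst].
have cR : continuous (fun s => - c * P0 N s).
  by move=> s; apply: cvgM; [exact: cvg_cst|exact: cP].
have e0 : mean (evolution t) = 0 by exact: (mean_evolution c0 m0 hr v0 vbe bM t).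
have se : summable_modes (modes (evolution t)).
  have -> // : modes (evolution t) = at_time v t.
  by apply/funext => b; apply/funext => n; rewrite (modes_evolution c0 m0 hr v0 vbe bM).
have iN := continuous_circle_integrable cN.
have iP := continuous_circle_integrable cP.
have il := continuous_circle_integrable cl.
have ie := continuous_circle_integrable ce.
have idt := continuous_circle_integrable cdt.
have icl := circle_integrableZl (c * m) il.
have ige := circle_integrableZl gamma ie.
have i12 := circle_integrableD idt icl.
have modesL b n : modes (fun s => dt s + c * m * l s + gamma * evolution t s) b n =
    forcing c v b n t.
  rewrite (modesD b n i12 ige) (modesD b n idt icl) (modesZl _ b n il) (modesZl _ b n ie) (is_Lambda_modes b n (oner_neq0 R) el).
  rewrite (modes_evolution c0 m0 hr v0 vbe bM) powRr1 ?ler0n//.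
  rewrite /dt modes_synthesis//; last by exact: drift0.
  by rewrite /drift /damping; ring.
have modesR b n : modes (fun s => - c * P0 N s) b n = forcing c v b n t.
  rewrite (modesZl _ b n iP); case: n => [|n].
    rewrite /forcing eqxx; case: b; rewrite /modes ?fsin0 ?mulr0// fcos0.
    by rewrite /P0 meanB ?mean_cst ?subrr ?mulr0//; exact: circle_integrable_cst.
  rewrite modes_P0// (nonlinearity_modes e0 se eh el eds) /forcing/=.
  have -> : modes (evolution t) = at_time v t.
    by apply/funext => b'; apply/funext => n'; rewrite (modes_evolution c0 m0 hr v0 vbe bM).
  by ring.
apply: ae_eq_circle_fourier.
- exact: continuous_square_integrable.
- exact: continuous_square_integrable.
- by move=> n; have := modesL false n; rewrite -(modesR false n).
- by move=> n; have := modesL true n; rewrite -(modesR true n).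
Qed.

End EvolutionEquation.

(** * The time integral of the smoothing norm *)

Section IntegralAux.
Context {R : realType}.
Local Notation mu := (@lebesgue_measure R).

(** The integral of a nonnegative function is a supremum over simple functions below it, so it is
    monotone without measurability. This form allows comparing [t |-> Hnorm (r + 2^-1) (evolution v
    t) ^+ 2] with an explicit function directly. *)
Lemma ge0_le_integral_subset (D1 D2 : set R) (f1 f2 : R -> \bar R) :
  D1 `<=` D2 -> (forall x, D1 x -> 0 <= f1 x)%E -> (forall x, D2 x -> 0 <= f2 x)%E ->
  (forall x, D1 x -> f1 x <= f2 x)%E ->
  (\int[mu]_(x in D1) f1 x <= \int[mu]_(x in D2) f2 x)%E.
Proof.
move=> D12 f10 f20 f12; rewrite !ge0_integralE//.
apply: ge_ereal_sup => _ [h /= hf <-]; apply: ereal_sup_ubound; exists h => //= x.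
apply: le_trans (hf x) _; rewrite /patch.
case: ifPn => [/set_mem D1x|_]; first by rewrite mem_set; [exact: f12|exact: D12].
by case: ifPn => // /set_mem; exact: f20.
Qed.

Lemma tsum_nneseries (w : nat -> R) : cvgn (series w) ->
  (\sum_(n <oo) (w n)%:E = (tsum w)%:E)%E.
Proof.
move=> cw; rewrite /tsum -EFin_lim//; apply: congr_lim; apply/funext => N /=.
by rewrite sumEFin.
Qed.

Lemma lee_sqr (x : \bar R) (y : R) : (0 <= x)%E -> (x <= y%:E)%E ->
  (x ^+ 2 <= (y ^+ 2)%:E)%E.
Proof. by move=> x0 xy; rewrite expe2 expr2 EFinM; apply: lee_pmul. Qed.

Lemma integral_expR_decay (k : R) : 0 < k ->
  (\int[mu]_(x in `[0%R, +oo[) (k * expR (- k * x))%:E = 1)%E.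
Proof.
move=> k0; rewrite -(integral_exponential_pdf k0) integral_mkcond.
by apply: eq_integral => x _; rewrite /exponential_pdf restrict_EFin.
Qed.

End IntegralAux.

Section EvolutionIntegral.
Context {R : realType}.
Local Notation mu := (@lebesgue_measure R).
Variables (c m gamma r A : R).
Hypotheses (c0 : 0 < c) (m0 : 0 < m) (g0 : 0 <= gamma) (hr : 3 / 2 < r).
Hypothesis A0 : 0 <= A.
Variables (v : bool -> nat -> R -> R) (be : nat -> R).
Hypotheses (v0 : forall b t, v b 0%N t = 0).
Hypotheses (vbe : dominated c m v be) (bM : rho_bounded r (2 * A) be).
Hypothesis bS : forall N, \sum_(0 <= n < N) (n%:R `^ r * be n) ^+ 2 <= 4 * A ^+ 2.

Implicit Types (t : R) (n : nat).

Let cm0 : 0 < c * m. Proof. by rewrite mulr_gt0. Qed.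

(** The contribution of mode [n] to the squared norm in [H^(r + 1/2)]: [4 pi] from Parseval, [2]
    from the two coefficients, [n] from the extra half derivative, and the square of [decay n t]. *)
Definition smoothing_term n t : R :=
  8 * pi * (n%:R `^ r * be n) ^+ 2 * (n%:R * expR (- (c * m * n%:R) * t)).

Lemma smoothing_term_ge0 n t : 0 <= smoothing_term n t.
Proof.
rewrite /smoothing_term; apply: mulr_ge0; last by rewrite mulr_ge0// expR_ge0.
by apply: mulr_ge0; [rewrite mulr_ge0// pi_ge0|exact: sqr_ge0].
Qed.

Lemma cvg_smoothing_term t : 0 < t -> cvgn (series (smoothing_term ^~ t)).
Proof.
move=> t0.
have h := @cvg_envelope_sobolev _ r A be bS (8 * pi * (c * m * t)^-1).
refine (dominated_cvg_series h _) => n.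
rewrite ger0_norm ?smoothing_term_ge0// /smoothing_term mulrAC.
apply: ler_wpM2r; first exact: sqr_ge0.
apply: ler_wpM2l; first by rewrite mulr_ge0// pi_ge0.
have x0 : 0 < c * m * t by rewrite mulr_gt0.
rewrite -(ler_pM2l x0) divff ?gt_eqF//.
have e := expR_ge1Dx (c * m * n%:R * t).
have := expR_ge0 (- (c * m * n%:R * t)) => e0.
have ee : expR (c * m * n%:R * t) * expR (- (c * m * n%:R * t)) = 1 by rewrite -expRD subrr expR0.
rewrite mulNr.
have := ler_wpM2r e0 e; rewrite ee; lra.
Qed.

Lemma Hnorm_half_le t : 0 < t ->
  (Hnorm (r + 2^-1) (evolution v t) ^+ 2 <= \sum_(n <oo) (smoothing_term n t)%:E)%E.
Proof.
move=> t0.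
have rp : r + 2^-1 != 0 by apply: lt0r_neq0; move: hr; lra.
have Lf := evolution_Lambda_gt0 c0 m0 hr A0 v0 vbe bM rp t0.
have ct := cvg_smoothing_term t0.
rewrite tsum_nneseries//.
have t_ge0 : 0 <= tsum (smoothing_term ^~ t) by apply: tsum_ge0 => n; exact: smoothing_term_ge0.
rewrite -(sqr_sqrtr t_ge0); apply: lee_sqr; first exact: Hnorm_ge0.
have pi0 := @pi_gt0 R.
have -> : tsum (smoothing_term ^~ t) = 4 * pi * (tsum (smoothing_term ^~ t) / (4 * pi)).
  by rewrite mulrC divfK// mulf_neq0// gt_eqF.
apply: (Hnorm_le rp Lf) => N.
rewrite ler_pdivlMr ?mulr_gt0//.
apply: le_trans (series_le_tsum N ct (fun n => smoothing_term_ge0 n t)).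
rewrite /sobolev_sum /series/= mulr_suml; apply: ler_sum => n _.
rewrite (fcos_evolution c0 m0 hr v0 vbe bM) (fsin_evolution c0 m0 hr v0 vbe bM).
have -> : (n%:R `^ (r + 2^-1)) ^+ 2 = (n%:R `^ r) ^+ 2 * n%:R :> R.
  case: n => [|n]; first by rewrite !powR0 ?expr0n ?mulr0// gt_eqF//; move: hr; lra.
  rewrite powRD ?pnatr_eq0 ?implybT// exprMn; congr (_ * _).
  by rewrite powR12_sqrt// sqr_sqrtr.
rewrite /smoothing_term.
have -> : expR (- (c * m * n%:R) * t) = decay c m n t ^+ 2.
  rewrite /decay -expRM_natl gtr0_norm//; congr expR; rewrite /rate; lra.
have h b := sqr_le_norm (vbe b n t).
have h1 : v false n t ^+ 2 + v true n t ^+ 2 <= 2 * (be n * decay c m n t) ^+ 2.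
  by have := h false; have := h true; lra.
have k0 : 0 <= 4 * pi * ((n%:R `^ r) ^+ 2 * n%:R).
  by rewrite mulr_ge0// mulr_ge0 ?sqr_ge0// ltW.
have := ler_wpM2l k0 h1; rewrite !exprMn; lra.
Qed.

(** Integrated term by term: [n] times the integral of [exp (- c m n t)] is [1 / (c m)] for [n > 0],
    so the extra half derivative is exactly paid for. What remains is [8 pi / (c m)] times a sum
    bounded by [4 A ^ 2]. *)
Lemma integral_smoothing :
  (\int[mu]_(t in `[0%R, +oo[) (\sum_(n <oo) (smoothing_term n t)%:E)
    <= (32 * pi * A ^+ 2 / (c * m))%:E)%E.
Proof.
have mexp (k : R) : measurable_fun (`[0%R, +oo[ : set R) (fun x => (expR (- k * x))%:E).
  apply/measurable_EFinP; apply: measurable_funTS; apply: continuous_measurable_fun.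
  exact: continuous_expRM.
have termE n : (fun t => (smoothing_term n t)%:E) = (fun t =>
    (8 * pi / (c * m) * (n%:R `^ r * be n) ^+ 2)%:E *
    (c * m * n%:R * expR (- (c * m * n%:R) * t))%:E)%E.
  apply/funext => t; rewrite -EFinM /smoothing_term; congr EFin.
  by move: (@pi R) (n%:R `^ r * be n) (expR _) (lt0r_neq0 c0) (lt0r_neq0 m0) => x y z cn mn;
    field; rewrite cn mn.
have mk n : measurable_fun (`[0%R, +oo[ : set R) (fun x => (c * m * n%:R * expR (- (c * m * n%:R) * x))%:E).
  apply/measurable_EFinP; apply: measurable_funM => //.
  by apply/measurable_EFinP; exact: mexp.
have C0 n : 0 <= 8 * pi / (c * m) * (n%:R `^ r * be n) ^+ 2.
  apply: mulr_ge0; last exact: sqr_ge0.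
  by rewrite divr_ge0 ?mulr_ge0 ?pi_ge0// ltW.
rewrite integral_nneseries//=; last 2 first.
- by move=> n; rewrite termE; apply: measurable_funeM; exact: mk.
- by move=> n x _; rewrite lee_fin smoothing_term_ge0.
have cv := @cvg_envelope_sobolev _ r A be bS (8 * pi / (c * m)).
apply: (@le_trans _ _ (\sum_(n <oo) (8 * pi / (c * m) * (n%:R `^ r * be n) ^+ 2)%:E)%E).
  apply: lee_nneseries.
    by move=> n _ _; apply: integral_ge0 => x _; rewrite lee_fin smoothing_term_ge0.
  move=> n _; rewrite termE ge0_integralZl//; last 2 first.
  - by move=> x _; rewrite lee_fin mulr_ge0 ?expR_ge0// mulr_ge0// ltW.
  - by rewrite lee_fin.
  (* Mode [0] has weight [0 ^ r = 0]. *)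
  - case: n => [|n].
      rewrite powR0; last by apply: lt0r_neq0; move: hr; lra.
      by rewrite mul0r expr0n mulr0 mul0e.
    by rewrite integral_expR_decay ?mule1// mulr_gt0.
  - exact: mk.
rewrite tsum_nneseries// lee_fin.
have [cs ts] := bounded_cvg_series (fun n => sqr_ge0 (n%:R `^ r * be n)) bS.
rewrite tsumZl//.
have -> : 32 * pi * A ^+ 2 / (c * m) = 8 * pi / (c * m) * (4 * A ^+ 2) by lra.
by apply: ler_wpM2l => //; rewrite divr_ge0 ?mulr_ge0 ?pi_ge0// ltW.
Qed.

Lemma integral_Hnorm_half_le (D : set R) : D `<=` `[0%R, +oo[ ->
  (\int[mu]_(t in D) (Hnorm (r + 2^-1) (evolution v t) ^+ 2)
    <= (32 * pi * A ^+ 2 / (c * m))%:E)%E.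
Proof.
move=> D0; apply: le_trans integral_smoothing.
pose G t := (\sum_(n <oo) (smoothing_term n t)%:E)%E.
have G0 t : (0 <= G t)%E.
  by apply: nneseries_ge0 => n _ _; rewrite lee_fin smoothing_term_ge0.
have mG : measurable_fun (`]0%R, +oo[ : set R) G.
  apply: ge0_emeasurable_sum => [n x _ _|n _]; first by rewrite lee_fin smoothing_term_ge0.
  apply/measurable_EFinP; apply: measurable_funTS; apply: continuous_measurable_fun.
  move=> t; apply: cvgM; first exact: cvg_cst.
  by apply: cvgM; [exact: cvg_cst|exact: continuous_expRM].
(* The datum need not be in [H^(r + 1/2)], hence the value at time [0]. *)
pose F t := if t == 0 then +oo%E else G t.
have FG : (\int[mu]_(t in `]0%R, +oo[) F t = \int[mu]_(t in `]0%R, +oo[) G t)%E.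
  apply: eq_integral => t; rewrite inE/= in_itv/= andbT => t0.
  by rewrite /F gt_eqF.
have mF : measurable_fun (`]0%R, +oo[ : set R) F.
  apply: eq_measurable_fun mG => t; rewrite inE/= in_itv/= andbT => t0.
  by rewrite /F gt_eqF.
(* Passing through the open half-line exchanges [G] and [F], since a single point does not
   contribute to the integral. *)
rewrite -[leRHS](@integral_itv_obnd_cbnd R 0 +oo%O G)// -FG (@integral_itv_obnd_cbnd R 0 +oo%O F)//.
apply: ge0_le_integral_subset => //.
- by move=> t _; rewrite expe_ge0// Hnorm_ge0.
- by move=> t _; rewrite /F; case: ifP.
move=> t /D0; rewrite /= in_itv/= andbT le_eqVlt => /predU1P[<-|t0].
  by rewrite /F eqxx leey.
by rewrite /F gt_eqF//; exact: Hnorm_half_le.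
Qed.

End EvolutionIntegral.

(** * Small data *)

Section SmallData.
Context {R : realType}.
Variables (c m gamma r delta A : R) (eta0 : R -> R).
Hypotheses (c0 : 0 < c) (m0 : 0 < m) (g0 : 0 <= gamma) (hr : 3 / 2 < r).
(** The constant [128] is dictated by uniqueness: the constructed modes are bounded by
    [2 delta rho_n], the bootstrap needs twice that, [M = 4 delta], and the contraction asks for
    [32 M rho_sum <= m]. Existence asks for [64 A rho_sum <= m]. *)
Hypotheses (delta0 : 0 < delta) (delta_small : 128 * delta * rho_sum r <= m).
Hypotheses (L0 : L2 eta0) (mean0 : mean eta0 = 0).
Hypotheses (HA : Hnorm r eta0 = A%:E) (A_delta : A <= delta).

Let rn0 : r != 0. Proof. by apply: lt0r_neq0; move: hr; lra. Qed.

Let A0 : 0 <= A. Proof. by rewrite -lee_fin -HA Hnorm_ge0. Qed.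

Let a := modes eta0.

Let a0 b : a b 0%N = 0.
Proof. by case: b; rewrite /a /modes ?fsin0 ?fcos0. Qed.

(** The square of [|x| + |y|] is at most [2 (x ^ 2 + y ^ 2)], and the factor [2] is absorbed by the
    [4 pi] of [Hnorm_ge]. *)
Let aA N : \sum_(0 <= n < N) (n%:R `^ r * (`|a false n| + `|a true n|)) ^+ 2 <= A ^+ 2.
Proof.
apply: (@le_trans _ _ (2 * sobolev_sum r eta0 N)).
  rewrite /sobolev_sum mulr_sumr; apply: ler_sum => n _.
  rewrite [leRHS]mulrCA [leLHS]exprMn; apply: ler_wpM2l; first exact: sqr_ge0.
  rewrite /a /modes -[X in _ <= 2 * (X + _)]real_normK ?num_real//.
  rewrite -[X in _ <= 2 * (_ + X)]real_normK ?num_real//.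
  have := sqr_ge0 (`|fcos eta0 n| - `|fsin eta0 n|); nra.
have s0 : 0 <= sobolev_sum r eta0 N.
  by apply: sumr_ge0 => n _; rewrite mulr_ge0 ?sqr_ge0// addr_ge0 ?sqr_ge0.
have pi2 := @pi_ge2 R.
have p0 : 0 <= 4 * pi * sobolev_sum r eta0 N by rewrite !mulr_ge0// pi_ge0.
have := Hnorm_ge eta0 N rn0; rewrite HA lee_fin => h.
have : Num.sqrt (4 * pi * sobolev_sum r eta0 N) ^+ 2 <= A ^+ 2.
  by rewrite ler_pXn2r ?nnegrE ?sqrtr_ge0.
rewrite sqr_sqrtr//; apply: le_trans; apply: ler_wpM2r => //; lra.
Qed.

Let A_small : 64 * A * rho_sum r <= m.
Proof.
apply: le_trans delta_small; apply: ler_wpM2r; first exact: rho_sum_ge0.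
by move: delta0 A_delta; lra.
Qed.

Let v := solution c m gamma a.
Let be := beta_lim m a.
Let v0 b t : v b 0%N t = 0. Proof. exact: (solution_mode0 c0 m0 g0 hr a0 A0 aA A_small). Qed.
Let cv : family_continuous v. Proof. exact: (continuous_solution c0 m0 g0 hr a0 A0 aA A_small). Qed.
Let vbe : dominated c m v be. Proof. exact: (dominated_solution c0 m0 g0 hr a0 A0 aA A_small). Qed.
Let bM : rho_bounded r (2 * A) be. Proof. exact: (beta_lim_rho_bounded m0 hr a0 A0 aA A_small). Qed.
Let bS := beta_lim_sobolev m0 hr a0 A0 aA A_small.

(** The fixed point equation of the majorant, with the nonnegative contribution of the datum
    dropped. *)
Let be_majorant n : majorant be be n.+1 <= m * n.+1%:R / 4 * be n.+1.
Proof.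
have := beta_lim_fixed m0 hr a0 A0 aA A_small n.+1; rewrite -/be => e.
have x0 : 0 < m * n.+1%:R by rewrite mulr_gt0.
have : majorant be be n.+1 = m * n.+1%:R / 4 * (4 / (m * n.+1%:R) * majorant be be n.+1).
  by move: (m * n.+1%:R) x0 (majorant _ _ _) => x /lt0r_neq0 xn0 y; field.
move=> ->; apply: ler_wpM2l; first by rewrite divr_ge0// ltW.
by rewrite [leRHS]e lerDr addr_ge0.
Qed.

Let dvE b n (t : R) : 0 < t -> is_derive t 1 (v b n) (drift c m gamma v t b n).
Proof. by move=> t0; exact: (is_derive_solution c0 m0 g0 hr a0 A0 aA A_small). Qed.

Let start_modes b n : modes (evolution v 0) b n = modes eta0 b n.
Proof.
rewrite (modes_evolution c0 m0 hr v0 vbe bM).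
exact: (solution_start c0 m0 g0 hr a0 A0 aA A_small).
Qed.

(** The function representing [Lambda ^ r eta0] also represents that of the evolution at time [0],
    as the two have the same modes. *)
Let start_Hr : exists g, is_Lambda r (evolution v 0) g.
Proof.
have [|g Lg] := @Hnorm_fin_Lambda _ r eta0; first by rewrite HA ltry.
exists g; have [_ L hc hs] := (is_LambdaP _ _ rn0).1 Lg.
apply/(is_LambdaP _ _ rn0); split=> //.
- exact: (L2_evolution c0 m0 hr vbe bM).
- by move=> n; rewrite hc -[fcos (evolution v 0) n]/(modes _ false n) start_modes.
- by move=> n; rewrite hs -[fsin (evolution v 0) n]/(modes _ true n) start_modes.
Qed.

Lemma small_data_solution T : 0 < T -> is_solution c m gamma r T eta0 (evolution v).
Proof.
move=> T0; split.
- by move=> t _; exact: (L2_evolution c0 m0 hr vbe bM).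
- by move=> t _; exact: (mean_evolution c0 m0 hr v0 vbe bM).
- move=> t /andP[t0 _].
  by apply: le_lt_trans (Hnorm_evolution_le c0 m0 hr A0 v0 vbe bM bS start_Hr t0) (ltry _).
- move=> t /andP[t0 _].
  exact: (evolution_continuous c0 m0 hr A0 v0 cv vbe bM bS start_Hr).
- have h : `[0%R, T]%classic `<=` `[0%R, +oo[%classic.
    by move=> t /=; rewrite !in_itv/= => /andP[->].
  by apply: le_lt_trans (integral_Hnorm_half_le c0 m0 hr A0 v0 vbe bM bS h) (ltry _).
- apply: ae_eq_circle_fourier.
  + exact: (L2_square_integrable (L2_evolution c0 m0 hr vbe bM 0)).
  + exact: L2_square_integrable.
  + exact: (start_modes false).
  + exact: (start_modes true).
- move=> t /andP[t0 _].
  exact: (evolution_equation c0 m0 g0 hr A0 v0 cv vbe bM be_majorant dvE t0).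
Qed.

Lemma small_data_unique T zeta : 0 < T -> is_solution c m gamma r T eta0 zeta ->
  forall t, 0 <= t <= T -> ae_eq_circle (zeta t) (evolution v t).
Proof.
move=> T0 sol t tT.
have M0 : 0 < 4 * delta by rewrite mulr_gt0.
have MS : 32 * (4 * delta) * rho_sum r <= m by move: delta_small; lra.
have zv b n : solution_modes zeta b n t = v b n t.
  apply: (mode_global_uniqueness c0 m0 g0 hr T0 M0) tT => //.
  - exact: (solution_modes_equicontinuous hr sol).
  - move=> b' n'; rewrite (solution_modes_start T0 sol)//.
    by rewrite /v (solution_start c0 m0 g0 hr a0 A0 aA A_small).
  - exact: (solution_mode_equation hr sol).
  - by move=> s /andP[s0 _] b' n'; exact: dvE.
  - move=> s _ b' n'.
    have h : rho_dominated r (2 * A) (at_time v s).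
      exact: (at_time_rho_dominated c0 m0 vbe bM).
    apply: le_trans (h b' n') _.
    by apply: ler_wpM2r; [exact: rho_ge0|move: A_delta; lra].
apply: ae_eq_circle_fourier.
- exact: (L2_square_integrable (solution_L2 sol tT)).
- exact: (L2_square_integrable (L2_evolution c0 m0 hr vbe bM t)).
- by move=> n; rewrite (fcos_evolution c0 m0 hr v0 vbe bM); exact: (zv false).
- by move=> n; rewrite (fsin_evolution c0 m0 hr v0 vbe bM); exact: (zv true).
Qed.

(** The supremum and the integral contribute at most [32 pi A ^ 2] each: the former is
    [4 pi * 8 A ^ 2], the latter comes from [integral_smoothing]. *)
Lemma small_data_estimate :
  (ereal_sup [set Hnorm r (evolution v t) ^+ 2 | t in `[0%R, +oo[] +
    (c * m)%:E * \int[@lebesgue_measure R]_(t in `[0%R, +oo[)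
      (Hnorm (r + 2^-1) (evolution v t) ^+ 2)
  <= (64 * pi)%:E * Hnorm r eta0 ^+ 2)%E.
Proof.
have pi0 := @pi_ge0 R.
have cm0 : 0 < c * m by rewrite mulr_gt0.
have h1 : (ereal_sup [set Hnorm r (evolution v t) ^+ 2 | t in `[0%R, +oo[] <=
    (32 * pi * A ^+ 2)%:E)%E.
  apply: ge_ereal_sup => x [t /=]; rewrite in_itv/= andbT => t0 <-.
  have := Hnorm_evolution_le c0 m0 hr A0 v0 vbe bM bS start_Hr t0.
  move=> /(lee_sqr (Hnorm_ge0 _ _)); rewrite sqr_sqrtr; last first.
    by rewrite !mulr_ge0// sqr_ge0.
  by move=> /le_trans; apply; rewrite lee_fin; lra.
have h2 := integral_Hnorm_half_le c0 m0 hr A0 v0 vbe bM bS (@subset_refl _ `[0%R, +oo[%classic).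
have h3 : ((c * m)%:E * \int[@lebesgue_measure R]_(t in `[0%R, +oo[)
    (Hnorm (r + 2^-1) (evolution v t) ^+ 2) <= (32 * pi * A ^+ 2)%:E)%E.
  have -> : 32 * pi * A ^+ 2 = c * m * (32 * pi * A ^+ 2 / (c * m)).
    by rewrite [RHS]mulrC divfK// gt_eqF.
  by rewrite [leRHS]EFinM; apply: lee_wpmul2l h2; rewrite lee_fin ltW.
apply: le_trans (leeD h1 h3) _.
by rewrite HA -EFinD expe2 -!EFinM lee_fin; lra.
Qed.

End SmallData.

Theorem theorem2p5 (R : realType) (c m gamma r : R)
    (hc : 0 < c) (hm : 0 < m) (hgamma : 0 <= gamma) (hr : 3 / 2 < r) :
  exists delta C : R, 0 < delta /\
    forall eta0 : R -> R,
      L2 eta0 -> mean eta0 = 0 -> (Hnorm r eta0 <= delta%:E)%E ->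
      exists eta : R -> R -> R,
        [/\ forall T : R, 0 < T -> is_solution c m gamma r T eta0 eta,
            forall (T : R) (zeta : R -> R -> R), 0 < T ->
              is_solution c m gamma r T eta0 zeta ->
              forall t : R, 0 <= t <= T -> ae_eq_circle (zeta t) (eta t) &
            (ereal_sup [set Hnorm r (eta t) ^+ 2 | t in `[0%R, +oo[] +
             (c * m)%:E * \int[@lebesgue_measure R]_(t in `[0%R, +oo[)
               (Hnorm (r + 2^-1) (eta t) ^+ 2)
             <= C%:E * Hnorm r eta0 ^+ 2)%E].
Proof.
have z0 := rho_sum_ge0 r.
have d0 : 0 < 128 * (rho_sum r + 1) by lra.
(* The [+ 1] makes the denominator positive from [rho_sum r >= 0] alone. This [delta] is a function
   of [m] and [r], and the constant [C] is absolute. *)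
exists (m / (128 * (rho_sum r + 1))), (64 * pi).
have delta0 : 0 < m / (128 * (rho_sum r + 1)) by rewrite divr_gt0.
split=> // eta0 L0 mean0 Hdelta.
have delta_small : 128 * (m / (128 * (rho_sum r + 1))) * rho_sum r <= m.
  rewrite mulrA mulrAC ler_pdivrMr//; move: hm z0 => ? ?; nra.
have HA : Hnorm r eta0 = (fine (Hnorm r eta0))%:E.
  rewrite fineK// ge0_fin_numE ?Hnorm_ge0//; exact: le_lt_trans Hdelta (ltry _).
have A_delta : fine (Hnorm r eta0) <= m / (128 * (rho_sum r + 1)) by rewrite -lee_fin -HA.
exists (evolution (solution c m gamma (modes eta0))); split.
- exact: (small_data_solution hc hm hgamma hr delta0 delta_small L0 mean0 HA A_delta).
- exact: (small_data_unique hc hm hgamma hr delta0 delta_small L0 mean0 HA A_delta).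
- exact: (small_data_estimate hc hm hgamma hr delta0 delta_small mean0 HA A_delta).
Qed.
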